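(* Let $G_1$ and $G_2$ be finite simple graphs on disjoint nonempty vertex sets $V_1$ and $V_2$, respectively, not both complete, let $G_1*G_2$ be their join, and let $<$ be any term order on the polynomial ring $S=\mathbb{K}[x_i,y_i : i\in V_1\cup V_2]$. Then: (a) $\operatorname{reg}(J_{G_1*G_2})=\max\{\operatorname{reg}(J_{G_1}),\operatorname{reg}(J_{G_2}),3\}$. (b) $\operatorname{reg}(\operatorname{in}_< J_{G_1*G_2})=\max\{\operatorname{reg}(\operatorname{in}_< J_{G_1}),\operatorname{reg}(\operatorname{in}_< J_{G_2}),3\}$.
   Context: Let $\mathbb{K}$ be a field. For a finite simple graph $G$ on a finite totally ordered vertex set $V$ with edge set $E$, the binomial edge ideal of $G$ is the ideal $J_G=(x_iy_j-x_jy_i : i<j,\ \{i,j\}\in E)$ of $\mathbb{K}[x_i,y_i : i\in V]$. The join $G_1*G_2$ of two graphs with disjoint vertex sets $V_1,V_2$ and edge sets $E_1,E_2$ is the graph with vertex set $V_1\cup V_2$ and edge set $E_1\cup E_2\cup\{\{v,w\} : v\in V_1,\ w\in V_2\}$. For an ideal $I$, $\operatorname{in}_< I$ denotes its initial ideal with respect to the term order $<$; the ideals $\operatorname{in}_< J_{G_p}$ ($p=1,2$) are taken with respect to the restriction of $<$ to $\mathbb{K}[x_i,y_i : i\in V_p]$. $\operatorname{reg}$ denotes Castelnuovo–Mumford regularity of a graded ideal (standard grading), with the convention that the regularity of the zero ideal is $-\infty$ (this occurs exactly when the graph has no edges). *)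

(* Defs.v *)
(* [mpoly] has to be loaded before [constructive_ereal]: in the other order
   their notations clash. *)
From mathcomp Require Import all_boot all_order all_algebra.
From mathcomp Require Import mpoly.
From mathcomp Require Import classical_sets constructive_ereal.

Set Implicit Arguments.
Unset Strict Implicit.
Unset Printing Implicit Defensive.

Import Order.TTheory GRing.Theory Num.Theory.
Local Open Scope ring_scope.

(* A finite simple graph whose vertex set is an arbitrary subset of an ambient
   finite type, so that graphs with disjoint vertex sets live side by side.  *)
Record sgraph (T : finType) := SGraph {
  vset : {set T};
  adj : rel T;
  adj_sym : ssrbool.symmetric adj;
  adj_irr : irreflexive adj;
  adj_vset : forall u v, adj u v -> (u \in vset) && (v \in vset)
}.

Definition complete_graph (T : finType) (G : sgraph T) : bool :=
  [forall u in vset G, forall v in vset G, (u != v) ==> adj G u v].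

Definition join_vset (T : finType) (G1 G2 : sgraph T) : {set T} :=
  vset G1 :|: vset G2.

Definition join_adj (T : finType) (G1 G2 : sgraph T) : rel T := fun u v =>
  [|| adj G1 u v, adj G2 u v, (u \in vset G1) && (v \in vset G2)
    | (u \in vset G2) && (v \in vset G1)].

Lemma join_sym (T : finType) (G1 G2 : sgraph T) :
  ssrbool.symmetric (join_adj G1 G2).
Proof.
move=> u v; rewrite /join_adj (adj_sym G1 u v) (adj_sym G2 u v).
by rewrite (andbC (u \in vset G1)) (andbC (u \in vset G2)) (orbC (_ && _)).
Qed.

Lemma join_irr (T : finType) (G1 G2 : sgraph T) :
  [disjoint vset G1 & vset G2] -> irreflexive (join_adj G1 G2).
Proof.
move=> dis u; rewrite /join_adj !adj_irr /= andbC orbb.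
by apply/negbTE/negP => /andP[u2 u1]; rewrite (disjointFr dis u1) in u2.
Qed.

Lemma join_adj_vset (T : finType) (G1 G2 : sgraph T) u v :
  join_adj G1 G2 u v -> (u \in join_vset G1 G2) && (v \in join_vset G1 G2).
Proof.
rewrite /join_adj /join_vset !inE.
by case/or4P => [/adj_vset|/adj_vset||] /andP[-> ->]; rewrite ?orbT.
Qed.

Definition graph_join (T : finType) (G1 G2 : sgraph T)
    (dis : [disjoint vset G1 & vset G2]) : sgraph T :=
  SGraph (@join_sym T G1 G2) (join_irr dis) (@join_adj_vset T G1 G2).

(* [subv A] is the vertex set A as a type; [nvars A] is the number of variables
   of K[x_i, y_i : i in A], the x_i being numbered before the y_i.           *)
Notation subv A := {v | v \in A}.

Definition nvars (T : finType) (A : {set T}) : nat :=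
  #|{: subv A}| + #|{: subv A}|.

Definition xvar (T : finType) (A : {set T}) (v : subv A) : 'I_(nvars A) :=
  lshift _ (enum_rank v).
Definition yvar (T : finType) (A : {set T}) (v : subv A) : 'I_(nvars A) :=
  rshift _ (enum_rank v).

Definition ideal_gen (R : comNzRingType) (P : set R) : set R :=
  [set f | exists s : seq (R * R),
     (forall p, p \in s -> P p.2) /\ f = \sum_(p <- s) p.1 * p.2]%classic.

Definition binomial_edge_ideal (K : fieldType) (d : Order.disp_t)
    (T : finOrderType d) (G : sgraph T) : set {mpoly K[nvars (vset G)]} :=
  ideal_gen [set f | exists i j : subv (vset G),
    [/\ (val i < val j)%O, adj G (val i) (val j)
      & f = 'X_(xvar i) * 'X_(yvar j) - 'X_(xvar j) * 'X_(yvar i)]]%classic.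

Arguments binomial_edge_ideal K {d T} G.

(* Well-foundedness is not required: for monomials in finitely many variables
   it follows from the conditions below (Dickson's lemma).                   *)
Definition term_order (n : nat) (le : rel 'X_{1..n}) : Prop :=
  [/\ total le, antisymmetric le, transitive le, (forall m, le 0%MM m)
    & forall m1 m2 m, le m1 m2 -> le (m1 + m)%MM (m2 + m)%MM].

Definition is_lead_monomial (K : fieldType) (n : nat) (le : rel 'X_{1..n})
    (f : {mpoly K[n]}) (m : 'X_{1..n}) : Prop :=
  m \in msupp f /\ (forall m', m' \in msupp f -> le m' m).

Definition initial_ideal (K : fieldType) (n : nat) (le : rel 'X_{1..n})
    (I : set {mpoly K[n]}) : set {mpoly K[n]} :=
  ideal_gen [set g | exists f m,
    [/\ I f, is_lead_monomial le f m & g = 'X_[m]]]%classic.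

Definition subv_incl (T : finType) (A B : {set T}) (sAB : A \subset B)
    (u : subv A) : subv B :=
  exist _ (val u) (fintype.subsetP sAB _ (valP u)).

Definition mnm_incl (T : finType) (A B : {set T}) (sAB : A \subset B)
    (m : 'X_{1..nvars A}) : 'X_{1..nvars B} :=
  (\sum_(u : subv A) (U_(xvar (subv_incl sAB u)) *+ m (xvar u)
                      + U_(yvar (subv_incl sAB u)) *+ m (yvar u)))%MM.

Definition restrict_order (T : finType) (A B : {set T}) (sAB : A \subset B)
    (le : rel 'X_{1..nvars B}) : rel 'X_{1..nvars A} :=
  fun m1 m2 => le (mnm_incl sAB m1) (mnm_incl sAB m2).

(* A graded free resolution  ... -> F_1 -> F_0 -> I -> 0  of a homogeneous
   ideal I of S = K[X_0, ..., X_(n-1)] by finitely generated free modules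
   F_i = \bigoplus_k S(- gfr_deg i k). Elements of F_i are row vectors and maps
   are right multiplications by matrices; all maps have degree 0.            *)
Record graded_free_resolution (K : fieldType) (n : nat)
    (I : set {mpoly K[n]}) := GradedFreeResolution {
  gfr_rank : nat -> nat;
  gfr_deg : forall i, 'I_(gfr_rank i) -> nat;
  gfr_aug : 'cV[{mpoly K[n]}]_(gfr_rank 0);
  gfr_diff : forall i, 'M[{mpoly K[n]}]_(gfr_rank i.+1, gfr_rank i);
  gfr_aug_homog : forall k, gfr_aug k 0 \is (gfr_deg k).-homog;
  gfr_diff_homog : forall i k l, (gfr_deg l <= gfr_deg k)%N ->
    gfr_diff i k l \is (gfr_deg k - gfr_deg l).-homog;
  gfr_diff_eq0 : forall i k l, (gfr_deg k < gfr_deg l)%N ->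
    gfr_diff i k l = 0;
  gfr_aug_image : forall f,
    I f <-> exists v : 'rV_(gfr_rank 0), f = (v *m gfr_aug) 0 0;
  gfr_aug_exact : forall v : 'rV_(gfr_rank 0),
    v *m gfr_aug = 0 <-> exists w, v = w *m gfr_diff 0;
  gfr_diff_exact : forall i (v : 'rV_(gfr_rank i.+1)),
    v *m gfr_diff i = 0 <-> exists w, v = w *m gfr_diff i.+1
}.

(* All entries of the differentials lie in (X_0, ..., X_(n-1)). *)
Definition minimal_resolution (K : fieldType) (n : nat) (I : set {mpoly K[n]})
    (F : graded_free_resolution I) : Prop :=
  forall i k l, (gfr_diff F i k l)@_0%MM = 0.

Definition graded_betti (K : fieldType) (n : nat) (I : set {mpoly K[n]})
    (F : graded_free_resolution I) (i j : nat) : nat :=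
  #|[pred k : 'I_(gfr_rank F i) | gfr_deg k == j]|.

(* reg I = sup { j - i | beta_(i,j)(I) != 0 }, the Betti numbers being read off
   a minimal graded free resolution (unique up to isomorphism); the value is
   -oo for the zero ideal, whose minimal resolution is zero.                 *)
Definition reg (K : fieldType) (n : nat) (I : set {mpoly K[n]}) : \bar int :=
  supremum -oo%E [set e | exists (F : graded_free_resolution I) (i j : nat),
    [/\ minimal_resolution F, graded_betti F i j != 0%N
      & e = (j%:Z - i%:Z)%:E]]%classic.

(* Main.v *)
From mathcomp Require Import boolp classical_sets.
From mathcomp Require Import ring zify.
Require Import Defs.
From mathcomp Require Import all_boot all_order all_algebra.
From mathcomp Require Import mpoly.
From mathcomp Require Import constructive_ereal.

(** Write [J] for the ideal of the join and [Q] for the ideal of the complete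
    graph on the same vertices. The idea is that [J] and [Q] agree in every
    multidegree that involves vertices on both sides: by the Plücker relation
    [x_w f_uv = x_u f_wv - x_v f_wu], a minor on one side times a variable of the
    other side already lies in [J]. Hence [Q / J] is the direct sum of the
    quotients [Q_1 / J_1] and [Q_2 / J_2] of the two sides, each killed by the
    variables of the other side. The same holds for initial ideals, because the
    splitting acts diagonally on monomials ([join_situation_bei],
    [join_initial]).

    All homological information is extracted from the Koszul complex of the
    variables. For a minimal graded free resolution of [I], shifting along
    syzygies shows that the Betti number of bidegree [(i, j)] is nonzero exactly
    when the part of that bidegree of the Koszul homology of [I] is; since minimal
    resolutions exist, the regularity is the supremum of the [j - i] for which
    this homology is not zero ([betti_iexact], [minimal_resolution_ex],
    [reg_iexact]). Three facts then determine the set of these differences.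

    First, [Q] and its initial ideals have no homology with [j - i > 2]
    ([complete_iexact], [complete_initial_iexact]). For every term order the
    leading monomials of [Q] are the multiples of the [x_u y_v] with [u] before
    [v] in an order on the vertices that the term order induces
    ([lead_mon_complete]). The simplicial complexes which compute the homology of
    this monomial ideal in each multidegree are contracted above the linear strand
    ([inv_complex_exact]), and the vanishing passes from leading monomials to the
    ideal itself by peeling off leading terms of cycles ([strand_exact]).

    Second, killing the variables of one side is a retraction of the Koszul
    complex of [J] onto that of the other side, so the homology of [J_1] and
    [J_2] embeds in that of [J] ([iexact_ret]). Conversely, if [j - i > 3], then a
    cycle of [J] bounds in [Q], and modulo [J] the bounding chain is a sum of a
    chain of [Q_1] and one of [Q_2], whose boundaries are in [J_1] and [J_2];
    if these have no homology on the diagonal [j - i], the bounding chain can be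
    moved into [J] ([partial_bound], [join_iexact]).

    Third, since one side is not complete, the join has an induced path
    [u - w - v], which gives a class with [(i, j) = (1, 4)]: for the quadric [f]
    that is the minor, or its leading monomial, at [u] and [v], the boundary of
    [f e_{x_w} e_{y_w}] is a cycle of [J] that does not bound in [J]
    ([not_iexact_path]). So the diagonal [j - i = 3] always occurs, and the
    diagonals above it are those of the two sides ([join_reg]). *)

Set Implicit Arguments.
Unset Strict Implicit.
Unset Printing Implicit Defensive.

Import Order.TTheory GRing.Theory Num.Theory.
Local Open Scope ring_scope.

(** * Koszul complexes *)

Definition sgn (V : zmodType) (b : bool) (v : V) : V := if b then - v else v.

Section Sgn.
Variable V : zmodType.
Implicit Types (u v : V) (b : bool).

Lemma sgn0 b : sgn b (0 : V) = 0.
Proof. by case: b; rewrite /sgn ?oppr0. Qed.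

Lemma sgnB b : {morph @sgn V b : u v / u - v}.
Proof. by move=> u v; case: b; rewrite /sgn // opprB opprK addrC. Qed.

Lemma sgnN b v : sgn b (- v) = - sgn b v.
Proof. by case: b. Qed.

Lemma sgnD b : {morph @sgn V b : u v / u + v}.
Proof. by move=> u v; case: b; rewrite /sgn // opprD. Qed.

Lemma sgn_sgn b1 b2 v : sgn b1 (sgn b2 v) = sgn (b1 (+) b2) v.
Proof. by case: b1; case: b2; rewrite /sgn ?opprK. Qed.

Lemma sgn_sum b (I : Type) (r : seq I) (P : pred I) (F : I -> V) :
  sgn b (\sum_(i <- r | P i) F i) = \sum_(i <- r | P i) sgn b (F i).
Proof. by case: b => //; rewrite /sgn sumrN. Qed.

Lemma sgn_eq0 b v : sgn b v = 0 -> v = 0.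
Proof. by case: b => //; rewrite /sgn => /eqP; rewrite oppr_eq0 => /eqP. Qed.

End Sgn.

Lemma sub_morph0 (V W : zmodType) (f : V -> W) :
  {morph f : u v / u - v} -> f 0 = 0.
Proof. by move=> fB; rewrite -(subrr 0) fB subrr. Qed.

Lemma sub_morphN (V W : zmodType) (f : V -> W) :
  {morph f : u v / u - v} -> {morph f : u / - u}.
Proof. by move=> fB u; rewrite -[- u]sub0r fB (sub_morph0 fB) sub0r. Qed.

Lemma sub_morphD (V W : zmodType) (f : V -> W) :
  {morph f : u v / u - v} -> {morph f : u v / u + v}.
Proof. by move=> fB u v; rewrite -{1}(opprK v) fB (sub_morphN fB) opprK. Qed.

Lemma sub_morph_sum (V W : zmodType) (f : V -> W) :
  {morph f : u v / u - v} -> forall (I : Type) (r : seq I) (P : pred I) (F : I -> V),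
  f (\sum_(i <- r | P i) F i) = \sum_(i <- r | P i) f (F i).
Proof.
by move=> fB I r P F; rewrite (big_morph f (sub_morphD fB) (sub_morph0 fB)).
Qed.

Lemma sub_morph_sgn (V W : zmodType) (f : V -> W) :
  {morph f : u v / u - v} -> forall b u, f (sgn b u) = sgn b (f u).
Proof. by move=> fB [] u; rewrite /sgn ?(sub_morphN fB). Qed.

Section KoszulDef.
Variables (I : finType) (key : I -> nat).

(** A Koszul chain is the family [c] of its coefficients, [c A] being that of the
    basis vector indexed by the set of variables [A]. Signs are taken along an
    arbitrary injection [key] into [nat] instead of a fixed order on the indices, so
    that subsets of the variables can carry the signs of the whole set. *)
Definition ksgn (p : I) (A : {set I}) : bool :=
  odd #|[set q in A | (key q < key p)%N]|.

Variables (V : zmodType) (x : I -> V -> V).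

Definition kbd (c : {set I} -> V) (A : {set I}) : V :=
  \sum_(p | p \notin A) sgn (ksgn p A) (x p (c (p |: A))).

(** Exterior multiplication by the basis vector of [p]. *)
Definition kcone (p : I) (c : {set I} -> V) (A : {set I}) : V :=
  if p \in A then sgn (ksgn p (A :\ p)) (c (A :\ p)) else 0.

(** [P s] constrains the coefficients at sets with [s] elements: the basis vector
    of [A] has degree [#|A|], so the degree allowed for [c A] depends on [#|A|]. *)
Definition kchain (P : nat -> V -> Prop) (i : nat) (c : {set I} -> V) : Prop :=
  forall A : {set I}, P #|A| (c A) /\ (#|A| != i -> c A = 0).

Definition kexact (P : nat -> V -> Prop) (i : nat) : Prop :=
  forall c, kchain P i c -> (forall A, kbd c A = 0) ->
  exists w, kchain P i.+1 w /\ forall A, kbd w A = c A.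

Definition ksub (P : nat -> V -> Prop) : Prop :=
  [/\ forall s, P s 0, forall s u v, P s u -> P s v -> P s (u - v)
    & forall s p v, P s.+1 v -> P s (x p v)].

End KoszulDef.

Section Koszul.
Variables (I : finType) (key : I -> nat) (key_inj : injective key).
Variables (V : zmodType) (x : I -> V -> V).
Hypothesis xB : forall p, {morph x p : u v / u - v}.
Implicit Types (c w : {set I} -> V) (A : {set I}) (p q : I).

Local Notation kbd := (kbd key x).

Lemma eq_kbd c w : (forall A, c A = w A) -> forall A, kbd c A = kbd w A.
Proof. by move=> cw A; apply: eq_bigr => p _; rewrite cw. Qed.

Lemma kbdB c w A : kbd (fun A => c A - w A) A = kbd c A - kbd w A.
Proof. by rewrite -sumrB; apply: eq_bigr => p _; rewrite xB sgnB. Qed.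

Lemma kbd0 A : kbd (fun=> 0) A = 0.
Proof. by rewrite /kbd big1 // => p _; rewrite (sub_morph0 (xB p)) sgn0. Qed.

Lemma ksgnU p q A : q \notin A ->
  ksgn key p (q |: A) = (key q < key p)%N (+) ksgn key p A.
Proof.
move=> qA; rewrite /ksgn; set B := [set r in A | _].
have -> : [set r in q |: A | (key r < key p)%N]
    = if (key q < key p)%N then q |: B else B.
  apply/setP=> r; case: ifP => qp; rewrite !inE; case: eqP => [->|] //=.
  by rewrite qp andbF.
by case: ifP => // _; rewrite cardsU1 inE (negbTE qA).
Qed.

Lemma key_neq p q : p != q -> (key q < key p)%N = ~~ (key p < key q)%N.
Proof.
move=> pq; rewrite -leqNgt ltn_neqAle; case: eqP => // e.
by rewrite (key_inj e) eqxx in pq.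
Qed.

Hypothesis xC : forall p q v, x p (x q v) = x q (x p v).

Lemma ksgn_swap p q A : p \notin A -> q \notin A -> p != q ->
  ksgn key q A (+) ksgn key p (q |: A) = ~~ (ksgn key p A (+) ksgn key q (p |: A)).
Proof.
move=> pA qA pq; rewrite !ksgnU // (key_neq pq).
by case: (ksgn key q A); case: (ksgn key p A); case: (key p < key q)%N.
Qed.

(** The terms of the double boundary cancel in pairs; in characteristic two
    this needs the pairing itself, not just the antisymmetry of the sum. *)
Lemma kbd_kbd c A : kbd (kbd c) A = 0.
Proof.
pose F p q := sgn (ksgn key p A (+) ksgn key q (p |: A)) (x p (x q (c (q |: (p |: A))))).
pose D p q := [&& p \notin A, q \notin A & (key p < key q)%N].
have FC p q : D p q -> F q p = - F p q.
  case/and3P=> pA qA pq; rewrite /F xC setUCA -sgnN.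
  rewrite ksgn_swap //; last by apply: contraTneq pq => ->; rewrite ltnn.
  by case: (_ (+) _); rewrite /sgn ?opprK.
have -> : kbd (kbd c) A
    = \sum_p \sum_q ((if D p q then F p q else 0) + (if D q p then F p q else 0)).
  rewrite [LHS]big_mkcond; apply: eq_bigr => p _.
  case: ifP => pA /=; last by rewrite big1 // => q _; rewrite /D pA andbF addr0.
  rewrite (sub_morph_sum (xB p)) sgn_sum big_mkcond; apply: eq_bigr => q _.
  rewrite (sub_morph_sgn (xB p)) sgn_sgn in_setU1 negb_or /D pA /=.
  case: (altP (q =P p)) => [->|qp] /=; first by rewrite ltnn andbF addr0.
  case: (boolP (q \in A)) => qA /=; first by rewrite addr0.
  by rewrite (key_neq qp); case: ltnP; rewrite /= ?addr0 ?add0r.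
under eq_bigr do rewrite big_split /=.
rewrite big_split /= [X in _ + X]exchange_big /= -big_split big1 //= => p _.
rewrite -big_split big1 //= => q _.
by case: ifP => [/FC->|_]; rewrite ?subrr ?addr0.
Qed.

(** The Koszul complex is the cone of [x p] acting on the Koszul complex of the
    other variables, so [x p] acts on it by a null-homotopic map. *)
Lemma kbd_kcone p c A :
  kbd (kcone key p c) A + kcone key p (kbd c) A = x p (c A).
Proof.
rewrite /kbd /kcone; case: ifPn => pA.
  rewrite -[A in RHS](setD1K pA); set B := A :\ p.
  have pB : p \notin B by rewrite !inE eqxx.
  have AB : A = p |: B by rewrite setD1K.
  rewrite [X in sgn _ X](bigD1 p) //= sgnD sgn_sgn addbb /= addrCA -[RHS]addr0.
  congr (_ + _).
  rewrite sgn_sum -[RHS](addrN (\sum_(q | q \notin A)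
    sgn (ksgn key q A) (x q (sgn (ksgn key p (q |: B)) (c (q |: B)))))).
  congr (_ + _).
    apply: eq_bigr => q qA; congr (sgn _ (x q _)).
    rewrite in_setU1 pA orbT AB setUCA setU1K //.
    by rewrite in_setU1 (negbTE pB) orbF; apply: contraNneq qA => <-.
  rewrite -sumrN; apply: eq_big => q.
    by rewrite AB !inE negb_or andbC.
  case/andP=> qB qp; rewrite (sub_morph_sgn (xB q)) !sgn_sgn -sgnN.
  rewrite AB !ksgnU // (key_neq qp).
  by case: (ksgn key q _); case: (ksgn key p _); case: (key q < key p)%N; rewrite /sgn ?opprK.
rewrite addr0 (bigD1 p) //= big1 => [|q /andP[qA qp]].
  by rewrite setU11 setU1K // (sub_morph_sgn (xB p)) sgn_sgn addbb addr0.
rewrite in_setU1 (negbTE pA) orbF eq_sym (negbTE qp).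
by rewrite (sub_morph0 (xB q)) sgn0.
Qed.

Lemma kbd_chain (P : nat -> V -> Prop) i c :
  ksub x P -> kchain P i.+1 c -> kchain P i (kbd c).
Proof.
move=> [P0 PB Px] cP A; split.
  apply: (big_ind (P #|A|)) => [|u v Pu Pv|p pA]; first exact: P0.
    rewrite -(opprK v) -(sub0r v); apply: (PB) => //; exact: (PB).
  have: P #|A| (x p (c (p |: A))).
    by apply: Px; have [] := cP (p |: A); rewrite cardsU1 pA.
  by case: ksgn => //= Pu; rewrite /sgn -sub0r; apply: PB.
move=> Ai; rewrite /kbd big1 // => p pA.
rewrite (cP _).2 ?(sub_morph0 (xB p)) ?sgn0 //.
by rewrite cardsU1 pA add1n eqSS.
Qed.

Lemma kchainB (P : nat -> V -> Prop) i c w : ksub x P ->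
  kchain P i c -> kchain P i w -> kchain P i (fun A => c A - w A).
Proof.
move=> [_ PB _] cP wP A; split; first by apply: PB; [have [] := cP A | have [] := wP A].
by move=> Ai; rewrite (cP A).2 // (wP A).2 // subr0.
Qed.

Lemma kchain0 (P : nat -> V -> Prop) i : ksub x P -> @kchain I V P i (fun=> 0).
Proof. by move=> [P0 _ _] A; split. Qed.

End Koszul.

Lemma kbd_nat (I : finType) (key : I -> nat) (V W : zmodType) (x : I -> V -> V)
    (y : I -> W -> W) (f : V -> W) :
  {morph f : u v / u - v} -> (forall p v, f (x p v) = y p (f v)) ->
  forall c A, f (kbd key x c A) = kbd key y (f \o c) A.
Proof.
move=> fB fx c A; rewrite (sub_morph_sum fB); apply: eq_bigr => p _.
by rewrite (sub_morph_sgn fB) fx.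
Qed.

(** * Ideals, leading monomials and strands *)

Section Ideals.
Variables (K : fieldType) (n : nat).
Implicit Types (f g h : {mpoly K[n]}) (m mu : 'X_{1..n}).

Definition is_ideal (I : {mpoly K[n]} -> Prop) : Prop :=
  [/\ I 0, forall f g, I f -> I g -> I (f - g) & forall h f, I f -> I (h * f)].

Definition is_graded (I : {mpoly K[n]} -> Prop) : Prop :=
  forall d f, I f -> I (pihomog mdeg d f).

(** The offset [s] is the degree of the basis vector that carries [f]; zero
    satisfies the condition in every degree. *)
Definition hpol (j s : nat) f : Prop :=
  forall m, m \in msupp f -> (mdeg m + s)%N = j.

Definition xmul (p : 'I_n) f : {mpoly K[n]} := 'X_p * f.

(** The part of bidegree [(i, j)] of the Koszul homology of [I] vanishes. *)
Definition iexact (key : 'I_n -> nat) (I : {mpoly K[n]} -> Prop) (i j : nat) :=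
  kexact key xmul (fun s f => I f /\ hpol j s f) i.

Definition lead_mon (le : rel 'X_{1..n}) (I : {mpoly K[n]} -> Prop) m : Prop :=
  exists f, I f /\ is_lead_monomial le f m.

Lemma idealD I f g : is_ideal I -> I f -> I g -> I (f + g).
Proof.
move=> [I0 IB _] If Ig; rewrite -(opprK g) -(sub0r g); apply: (IB) => //; exact: IB.
Qed.

Lemma idealN I f : is_ideal I -> I f -> I (- f).
Proof. by move=> [I0 IB _] If; rewrite -sub0r; apply: IB. Qed.

Lemma idealZ I (a : K) f : is_ideal I -> I f -> I (a *: f).
Proof. by move=> [_ _ IM] If; rewrite -mul_mpolyC; apply: IM. Qed.

Lemma ideal_mulr I f g : is_ideal I -> I f -> I (f * g).
Proof. by move=> [_ _ IM] If; rewrite mulrC; apply: IM. Qed.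

Lemma ideal_sum I (J : Type) (r : seq J) (P : pred J) (F : J -> {mpoly K[n]}) :
  is_ideal I -> (forall j, P j -> I (F j)) -> I (\sum_(j <- r | P j) F j).
Proof.
move=> II IF; apply: big_ind => //; first by case: II.
by move=> f g; apply: idealD.
Qed.

Lemma xmulB p : {morph xmul p : f g / f - g}.
Proof. by move=> f g; rewrite /xmul mulrBr. Qed.

Lemma xmulC p q f : xmul p (xmul q f) = xmul q (xmul p f).
Proof. by rewrite /xmul mulrCA. Qed.

Lemma mcoeff_xmul p f m :
  (xmul p f)@_m = if m p == 0%N then 0 else f@_(m - U_(p)).
Proof.
case: (boolP (m p == 0%N)) => mp.
  apply: memN_msupp_eq0; apply/negP; rewrite /xmul mulrC (perm_mem (msuppMX _ _)).
  by case/mapP=> m' _ Em; move: mp; rewrite Em mnmDE mnm1E eqxx.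
rewrite -lep1mP in mp.
by rewrite /xmul mulrC -{1}(submK mp) addmC mcoeffMX.
Qed.

Lemma hpol0 j s : hpol j s 0.
Proof. by move=> m; rewrite msupp0. Qed.

Lemma hpolB j s f g : hpol j s f -> hpol j s g -> hpol j s (f - g).
Proof.
move=> hf hg m /msuppB_le; rewrite mem_cat => /orP[]; [exact: hf | exact: hg].
Qed.

Lemma hpol_xmul j s p f : hpol j s.+1 f -> hpol j s (xmul p f).
Proof.
move=> hf m; rewrite mcoeff_msupp mcoeff_xmul; case: ifPn; rewrite ?eqxx // => mp.
rewrite -mcoeff_msupp => /hf <-; rewrite -lep1mP in mp.
by rewrite -{1}(submK mp) mdegD mdeg1 addn1 addnS addSn.
Qed.

Lemma ksub_ideal I j : is_ideal I -> ksub xmul (fun s f => I f /\ hpol j s f).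
Proof.
move=> [I0 IB IM]; split=> [s|s f g [If hf] [Ig hg]|s p f [If hf]].
- by split=> //; apply: hpol0.
- by split; [apply: IB | apply: hpolB].
- by split; [apply: IM | apply: hpol_xmul].
Qed.

End Ideals.

Lemma mcoeff_pihomog (K : fieldType) (n d : nat) (f : {mpoly K[n]}) m :
  (pihomog mdeg d f)@_m = if mdeg m == d then f@_m else 0.
Proof.
elim/mpolyind: f => [|c m' f _ _ IH]; first by rewrite pihomog0 mcoeff0 if_same.
rewrite pihomogD linearZ /= pihomogX !mcoeffD !mcoeffZ IH mcoeffX.
case: (eqVneq m' m) => [->|mm'].
  by case: ifP => _; rewrite ?mcoeffX ?eqxx ?mcoeff0 ?mulr0 ?addr0.
have -> : (if mdeg m' == d then 'X_[m'] else 0)@_m = 0 :> K.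
  by case: ifP => _; rewrite ?mcoeff0 // mcoeffX (negbTE mm').
by rewrite !mulr0 !add0r.
Qed.

Section TermOrder.
Variables (n : nat) (le : rel 'X_{1..n}) (le_term : term_order le).

Lemma term_le_refl m : le m m.
Proof. by case: le_term => tot _ _ _ _; case/orP: (tot m m). Qed.

Lemma term_le_addr m1 m2 m : le (m1 + m)%MM (m2 + m)%MM = le m1 m2.
Proof.
case: le_term => tot asym _ _ leD; apply/idP/idP; last exact: leD.
move=> le12; case/orP: (tot m1 m2) => // le21.
suff -> : m1 = m2 by apply: term_le_refl.
by apply: (@addIm _ m); apply: asym; rewrite le12 leD.
Qed.

(** Position of [mu] among the monomials of degree [j]: as these are finitely many,
    induction on it replaces the well-foundedness of the term order. *)
Definition term_rank (j : nat) (mu : 'X_{1..n}) : nat :=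
  #|[set b : 'X_{1..n < j.+1} | [&& mdeg b == j, bmnm b != mu & le b mu]]|.

Lemma term_rank_lt j nu mu :
  mdeg nu = j -> nu != mu -> le nu mu -> (term_rank j nu < term_rank j mu)%N.
Proof.
case: le_term => _ asym tr _ _ dnu nmu lnu.
apply: proper_card; apply/properP; split.
  apply/fintype.subsetP=> b; rewrite !inE => /and3P[-> bnu lb] /=.
  rewrite (tr _ _ _ lb lnu) andbT; apply: contraNneq nmu => bmu.
  by apply/eqP/asym; rewrite lnu -bmu.
have lj : (mdeg nu < j.+1)%N by rewrite dnu.
by exists (BMultinom lj); rewrite !inE /= ?eqxx ?andbF // dnu eqxx nmu.
Qed.

End TermOrder.

Section Strands.
Variables (K : fieldType) (n : nat) (key : 'I_n -> nat) (key_inj : injective key).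
Implicit Types (A B : {set 'I_n}) (m mu nu : 'X_{1..n}).
Implicit Types (c w : {set 'I_n} -> {mpoly K[n]}).

Local Notation sbd := (@kbd 'I_n key K (fun _ u => u)).

(** Exactness, at the faces with [i] elements, of the augmented chain complex of
    the simplicial complex [D] with coefficients in [K]: a Koszul complex in which
    every variable acts as the identity. *)
Definition sexact (D : {set 'I_n} -> Prop) (i : nat) : Prop :=
  forall phi : {set 'I_n} -> K,
    (forall A, phi A != 0 -> D A /\ #|A| = i) -> (forall A, sbd phi A = 0) ->
  exists psi : {set 'I_n} -> K,
    (forall A, psi A != 0 -> D A /\ #|A| = i.+1) /\ forall A, sbd psi A = phi A.

(** Coefficients of the part of multidegree [mu]: a term [X^m] at the set [A] has
    multidegree [m] plus the indicator of [A], and the Koszul differential is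
    homogeneous for this grading. *)
Definition strand mu c A : K :=
  if (mesym1 A <= mu)%MM then (c A)@_(mu - mesym1 A) else 0.

Lemma mesym1U p A : p \notin A -> mesym1 (p |: A) = (mesym1 A + U_(p))%MM.
Proof.
move=> pA; apply/mnmP=> q; rewrite mnmDE !mnmE in_setU1 eq_sym.
by case: eqP => [<-|_]; rewrite ?(negbTE pA) ?addn0.
Qed.

Lemma lem_mesym1U p A mu : p \notin A -> (mesym1 A <= mu)%MM ->
  (mesym1 (p |: A) <= mu)%MM = ((mu - mesym1 A)%MM p != 0%N).
Proof.
move=> pA lA; rewrite -lep1mP mesym1U //; apply/mnm_lepP/mnm_lepP => H i.
  by rewrite mnmBE leq_subRL -?mnmDE //; apply: (mnm_lepP lA).
by rewrite mnmDE -leq_subRL -?mnmBE //; apply: (mnm_lepP lA).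
Qed.

Lemma strand_kbd mu c A : strand mu (kbd key (@xmul K n) c) A = sbd (strand mu c) A.
Proof.
rewrite /strand /kbd; case: ifPn => lA.
  rewrite raddf_sum; apply: eq_bigr => p pA; rewrite [LHS]/=.
  have -> : (sgn (ksgn key p A) (xmul p (c (p |: A))))@_(mu - mesym1 A)
      = sgn (ksgn key p A) (xmul p (c (p |: A)))@_(mu - mesym1 A).
    by case: ksgn; rewrite /sgn ?mcoeffN.
  rewrite mcoeff_xmul lem_mesym1U //; case: eqP => //= _.
  by rewrite submDA mesym1U.
rewrite big1 // => p pA; case: ifPn => // lpA; rewrite ?sgn0 //.
case/negP: lA; apply: (lepm_trans _ lpA); rewrite mesym1U //; exact: lem_addr.
Qed.

Lemma mcoeff_strand c A m : (c A)@_m = strand (m + mesym1 A) c A.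
Proof. by rewrite /strand lem_addl addmK. Qed.


Variables (le : rel 'X_{1..n}) (le_term : term_order le).
Variables (I : {mpoly K[n]} -> Prop) (I_ideal : is_ideal I) (I_graded : is_graded I).

(** Scaling and taking the homogeneous component of degree [mdeg m] of an element
    with leading monomial [m] changes neither its membership nor its lead. *)
Lemma lead_lift m (a : K) : lead_mon le I m ->
  exists g, [/\ I g, g@_m = a & forall m', m' \in msupp g -> mdeg m' = mdeg m /\ le m' m].
Proof.
case=> f [If [mf lf]]; exists ((a / f@_m) *: pihomog mdeg (mdeg m) f); split.
- by apply: idealZ => //; apply: I_graded.
- have fm : f@_m != 0 by rewrite -mcoeff_msupp.
  by rewrite mcoeffZ mcoeff_pihomog eqxx divfK.
move=> m' /msuppZ_le; rewrite mcoeff_msupp mcoeff_pihomog.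
case: (mdeg m' =P mdeg m) => [-> |]; last by rewrite eqxx.
by rewrite -mcoeff_msupp => /lf.
Qed.

(** Peeling off leading strands: the strand of a cycle at its largest
    multidegree is a simplicial cycle carried by leading monomials; a simplicial
    chain bounding it lifts to [I], and subtracting the boundary of the lift
    leaves a cycle all of whose multidegrees are smaller. *)
Theorem strand_exact (i j : nat) :
  (forall mu, mdeg mu = j ->
     sexact (fun A => (mesym1 A <= mu)%MM /\ lead_mon le I (mu - mesym1 A)%MM) i) ->
  iexact key I i j.
Proof.
move=> Dex.
have ks := ksub_ideal j I_ideal.
suff Q k c : kchain (fun s f => I f /\ hpol j s f) i c ->
    (forall A, kbd key (@xmul K n) c A = 0) ->
    (forall mu A, strand mu c A != 0 -> (term_rank le j mu < k)%N) ->
    exists w, kchain (fun s f => I f /\ hpol j s f) i.+1 w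
      /\ forall A, kbd key (@xmul K n) w A = c A.
  move=> c cP cZ; apply: (Q #|{: 'X_{1..n < j.+1}}|.+1) => // mu A _.
  by rewrite ltnS; apply: max_card.
elim: k c => [|k IHk] c cP cZ cR.
  exists (fun=> 0); split=> [|A]; first exact: kchain0 ks.
  rewrite kbd0; last exact: xmulB.
  apply/esym/mpolyP => m; rewrite mcoeff0 mcoeff_strand.
  by apply/eqP; apply: contraT => /cR.
have cdeg mu A : strand mu c A != 0 -> mdeg mu = j.
  rewrite /strand; case: ifPn => lA; rewrite ?eqxx // -mcoeff_msupp => /(cP A).1.2.
  by rewrite -(mdeg_mesym1 A) -mdegD submK.
(* Only the case where some strand of [c] has the largest rank allowed is new. *)
have [[mu [A0 [muA0 mu_rk]]]|nomu] :=
    pselect (exists mu A, strand mu c A != 0 /\ term_rank le j mu = k); last first.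
  apply: IHk => // mu A muA; have := cR _ _ muA; rewrite ltnS leq_eqVlt.
  by case/orP=> // /eqP mk; case: nomu; exists mu, A.
have dmu : mdeg mu = j := cdeg _ _ muA0.
have cle nu A : strand nu c A != 0 -> le nu mu.
  move=> nuA; case: (eqVneq mu nu) => [->|munu]; first exact: term_le_refl.
  case: (le_term) => tot _ _ _ _; case/orP: (tot nu mu) => // lmu.
  have := term_rank_lt le_term dmu munu lmu.
  by rewrite mu_rk ltnNge -ltnS (cR _ _ nuA).
have [|A|psi [psiP psiE]] := Dex mu dmu (strand mu c).
- move=> A sA; have [[IcA hcA] ci] := cP A.
  move: (sA); rewrite /strand; case: ifPn => lA; rewrite ?eqxx // => cA.
  split; last first.
    by apply/eqP; apply: contraNT cA => /ci ->; rewrite mcoeff0.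
  split=> //; exists (c A); split=> //; split; first by rewrite mcoeff_msupp.
  move=> m; rewrite mcoeff_msupp mcoeff_strand => /cle.
  by rewrite -{1}(submK lA) term_le_addr.
- rewrite -strand_kbd /strand cZ mcoeff0 if_same //.
(* By the last two clauses, the boundary of the lift has no strand above [mu]
   and the same strand as [c] at [mu]. *)
have liftB B : exists g, [/\ I g, (psi B = 0 -> g = 0),
    strand mu (fun=> g) B = psi B &
    forall m, m \in msupp g -> mdeg (m + mesym1 B)%MM = j /\ le (m + mesym1 B)%MM mu].
  have [pB|/psiP[[lB LB] _]] := eqVneq (psi B) 0.
    exists 0; split=> //; first by case: I_ideal.
      by rewrite /strand mcoeff0 if_same.
    by move=> m; rewrite msupp0.
  have [g [Ig gm gP]] := lead_lift (psi B) LB.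
  have [pB|pB] := eqVneq (psi B) 0.
    exists 0; split=> //; first by case: I_ideal.
      by rewrite /strand mcoeff0 if_same.
    by move=> m; rewrite msupp0.
  exists g; split=> // [p0|| m /gP[dm lm]]; first by rewrite p0 eqxx in pB.
    by rewrite /strand lB.
  rewrite -(submK lB) term_le_addr // lm mdegD dm -mdegD submK //.
have [g gP] := choice liftB.
have gchain : kchain (fun s f => I f /\ hpol j s f) i.+1 g.
  move=> B; have [Ig g0 _ gm] := gP B; split.
    by split=> // m /gm[<- _]; rewrite mdegD mdeg_mesym1.
  by move=> Bi; apply: g0; apply/eqP; apply: contraNT Bi => /psiP[_ ->].
have gmu A : strand mu g A = psi A by case: (gP A).
pose c' A := c A - kbd key (@xmul K n) g A.
have c'E nu A : strand nu c' A = strand nu c A - sbd (strand nu g) A.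
  rewrite -strand_kbd /strand; case: ifP => _; rewrite ?subr0 //.
  by rewrite mcoeffB.
have c'chain : kchain (fun s f => I f /\ hpol j s f) i c'.
  apply: (kchainB ks) => //; apply: kbd_chain => //; exact: xmulB.
have c'Z A : kbd key (@xmul K n) c' A = 0.
  rewrite kbdB; last exact: xmulB.
  by rewrite cZ kbd_kbd ?subr0 //; [exact: xmulB | exact: xmulC].
have [|w [wP wE]] := IHk c' c'chain c'Z.
  move=> nu A nuA; rewrite -mu_rk.
  have numu : nu != mu.
    apply: contraNneq nuA => ->; rewrite c'E -psiE subr_eq0; apply/eqP.
    by apply: eq_kbd => B; rewrite gmu.
  suff [dnu lnu] : mdeg nu = j /\ le nu mu by apply: term_rank_lt.
  have [sA|sA] := eqVneq (strand nu c A) 0; last by split; [exact: cdeg sA | exact: cle sA].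
  have [B nuB] : exists B, strand nu g B != 0.
    apply: contrapT => noB; case/eqP: nuA; rewrite c'E sA sub0r.
    rewrite (eq_kbd _ _ (w := fun=> 0)) ?kbd0 ?oppr0 // => B.
    by apply/eqP; apply: contraT => nuB; case: noB; exists B.
  move: nuB; rewrite /strand; case: ifPn; rewrite ?eqxx // => lB.
  by rewrite -mcoeff_msupp => /(let: And4 _ _ _ H := gP B in H); rewrite submK.
exists (fun A => w A - (- g A)); split=> [|A].
  apply: (kchainB ks) => // B; have [[Ig hg] gi] := gchain B; split.
    split; first exact: idealN.
    rewrite -(sub0r (g B)); apply: hpolB => //; exact: hpol0.
  by move=> Bi; rewrite gi ?oppr0.
rewrite kbdB; last exact: xmulB.
have -> : kbd key (@xmul K n) (fun B => - g B) A = - kbd key (@xmul K n) g A.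
  rewrite (eq_kbd _ _ (w := fun B => 0 - g B)); last by move=> B; rewrite sub0r.
  by rewrite kbdB ?kbd0 ?sub0r //; exact: xmulB.
by rewrite opprK wE /c' subrK.
Qed.

End Strands.

(** * Exactness of the polynomial ring; initial ideals *)

Section Cones.
Variables (K : fieldType) (n : nat) (key : 'I_n -> nat) (key_inj : injective key).
Implicit Types (A B : {set 'I_n}).

Local Notation sbd := (@kbd 'I_n key K (fun _ u => u)).

Lemma sbd_kcone p (phi : {set 'I_n} -> K) A :
  sbd (kcone key p phi) A + kcone key p (sbd phi) A = phi A.
Proof. exact: (kbd_kcone key_inj). Qed.

Lemma kcone_supp p (phi : {set 'I_n} -> K) A :
  kcone key p phi A != 0 -> p \in A /\ phi (A :\ p) != 0.
Proof.
rewrite /kcone; case: ifP => [pA H|_]; last by rewrite eqxx.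
by split=> //; apply: contraNneq H => ->; rewrite sgn0.
Qed.

Lemma kcone0 p (phi : {set 'I_n} -> K) A :
  (forall B, phi B = 0) -> kcone key p phi A = 0.
Proof. by move=> H; rewrite /kcone; case: ifP => // _; rewrite H sgn0. Qed.

(** Coning with the apex [p] is a contracting homotopy. *)
Lemma sexact_cone p (D : {set 'I_n} -> Prop) i :
  (forall A, D A -> D (p |: A)) -> sexact K key D i.
Proof.
move=> Dp phi phiP phiZ; exists (kcone key p phi); split=> [A|A]; last first.
  by rewrite -[RHS](sbd_kcone p) [X in _ + X]kcone0 ?addr0.
case/kcone_supp=> pA /phiP[DA Ai]; split; last by rewrite (cardsD1 p) pA Ai.
by rewrite -(setD1K pA); apply: Dp.
Qed.

Lemma mnmc_term_order : term_order (fun m1 m2 : 'X_{1..n} => (m1 <= m2)%O).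
Proof.
split.
- by move=> m1 m2; apply: le_total.
- by move=> m1 m2; apply: le_anti.
- by move=> m1 m2 m3; apply: le_trans.
- by move=> m; apply: le0m.
- by move=> m1 m2 m; rewrite lemc_add2l.
Qed.

(** In a multidegree other than zero, any variable dividing it is the apex of a
    cone; so the Koszul complex of the polynomial ring has no homology in positive
    degree. *)
Lemma iexact_ring i j : (0 < j)%N -> @iexact K n key (fun=> True) i j.
Proof.
move=> j0; apply: (strand_exact key_inj mnmc_term_order) => // mu dmu.
have [p mup] : exists p, mu p != 0%N.
  apply: contrapT => H; move: j0; rewrite -dmu lt0n mdeg_eq0 => /eqP; apply.
  apply/mnmP=> p; rewrite mnm0E; apply/eqP; apply: contrapT => /negP mp.
  by apply: H; exists p.
apply: (@sexact_cone p) => A [lA _].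
have lpA : (mesym1 (p |: A) <= mu)%MM.
  apply/mnm_lepP => q; rewrite mnmE in_setU1; case: eqP => [->|_] /=.
    by rewrite lt0n.
  by have /mnm_lepP/(_ q) := lA; rewrite mnmE.
split=> //; exists 'X_[mu - mesym1 (p |: A)]; split=> //.
by split=> [|m /mem_msuppXP->]; rewrite ?mcoeff_msupp ?mcoeffX ?eqxx ?oner_eq0.
Qed.

End Cones.

Section IdealGen.
Variables (K : fieldType) (n : nat).
Implicit Types (f g h : {mpoly K[n]}) (m : 'X_{1..n}).

Lemma ideal_gen_ideal (P : set {mpoly K[n]}) : is_ideal (ideal_gen P).
Proof.
split.
- by exists [::]; split=> //; rewrite big_nil.
- move=> f g [s [sP ->]] [t [tP ->]].
  exists (s ++ [seq (- p.1, p.2) | p <- t]); split=> [p|].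
    by rewrite mem_cat => /orP[/sP //|/mapP[q /tP Pq ->]].
  rewrite big_cat big_map /=; congr (_ + _); rewrite -sumrN.
  by apply: eq_bigr => p _; rewrite mulNr.
- move=> h f [s [sP ->]]; exists [seq (h * p.1, p.2) | p <- s]; split=> [p|].
    by case/mapP=> q /sP Pq ->.
  by rewrite big_map mulr_sumr; apply: eq_bigr => p _; rewrite mulrA.
Qed.

Lemma ideal_gen_incl (P : set {mpoly K[n]}) f : P f -> ideal_gen P f.
Proof.
move=> Pf; exists [:: (1, f)]; split=> [p|]; last by rewrite big_seq1 mul1r.
by rewrite inE => /eqP ->.
Qed.

Lemma ideal_gen_min (P : set {mpoly K[n]}) (I : {mpoly K[n]} -> Prop) :
  is_ideal I -> (forall f, P f -> I f) -> forall f, ideal_gen P f -> I f.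
Proof.
move=> II PI f [s [sP ->]]; rewrite big_seq; apply: ideal_sum => // p /sP/PI.
by case: II => _ _; apply.
Qed.

(** The components of all multiples of [f] are considered at once, as these
    statements about [f] form an ideal. *)
Lemma ideal_gen_graded (P : set {mpoly K[n]}) :
  (forall f, P f -> exists d, f \is d.-homog) -> is_graded (ideal_gen P).
Proof.
move=> Ph d f; move: f.
have II := ideal_gen_ideal P.
have Id : is_ideal (fun f => forall h d, ideal_gen P (pihomog mdeg d (h * f))).
  split=> [h e|f g If Ig h e|h f If h' e].
  - by rewrite mulr0 pihomog0; case: II.
  - by rewrite mulrBr pihomogB; case: II => _ IB _; apply: IB.
  - by rewrite mulrA.
suff H f : ideal_gen P f -> forall h d, ideal_gen P (pihomog mdeg d (h * f)).
  by move=> f /H/(_ 1 d); rewrite mul1r.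
apply: (ideal_gen_min Id) => {}f Pf h {}d.
have [e fe] := Ph f Pf.
elim/mpolyind: h => [|c m h _ _ IH]; first by rewrite mul0r pihomog0; case: II.
rewrite mulrDl pihomogD; apply: idealD => //.
have Xf : c *: 'X_[m] * f \is (mdeg m + e).-homog.
  by apply: dhomogM => //; apply: dhomogZ; rewrite dhomogX.
have [<-|de] := eqVneq (mdeg m + e)%N d.
  by rewrite pihomog_dE //; case: II => _ _ IM; apply: IM; apply: ideal_gen_incl.
by rewrite (pihomog_ne0 _ Xf) //; case: II.
Qed.

End IdealGen.

Section InitialIdeal.
Variables (K : fieldType) (n : nat) (le : rel 'X_{1..n}) (le_term : term_order le).
Variables (I : {mpoly K[n]} -> Prop) (I_ideal : is_ideal I).
Implicit Types (f g h : {mpoly K[n]}) (m : 'X_{1..n}).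

Lemma lead_monD m m' : lead_mon le I m -> lead_mon le I (m + m')%MM.
Proof.
case=> f [If [mf lf]]; exists (f * 'X_[m']); split; first exact (ideal_mulr _ I_ideal If).
split; first by rewrite mcoeff_msupp addmC mcoeffMX -mcoeff_msupp.
move=> m1; rewrite (perm_mem (msuppMX _ _)) => /mapP[m2 /lf lm2 ->].
by rewrite addmC term_le_addr.
Qed.

Lemma lead_mon_le m m' : (m <= m')%MM -> lead_mon le I m -> lead_mon le I m'.
Proof. by move=> lm /(lead_monD (m' - m)); rewrite addmC submK. Qed.

(** Multiples of leading monomials are leading monomials, so no sum of multiples of
    them can have other monomials. *)
Lemma initial_idealP f :
  initial_ideal le I f <-> forall m, m \in msupp f -> lead_mon le I m.
Proof.
split=> [|H].
  move: f; apply: ideal_gen_min => [|f [g [m [Ig gm ->]]] m'].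
    split=> [m|f g Hf Hg m|h f Hf m]; first by rewrite msupp0.
      by move/msuppB_le; rewrite mem_cat => /orP[/Hf|/Hg].
    case/msuppM_le/allpairsP=> -[m1 m2] /= [_ /Hf m2f ->].
    by rewrite addmC; apply: lead_monD.
  by move/mem_msuppXP<-; exists g.
exists [seq ((f@_m)%:MP, 'X_[m]) | m <- msupp f]; split=> [p /mapP[m mf ->] /=|].
  by have [g [Ig gm]] := H m mf; exists g, m.
by rewrite big_map {1}(mpolyE f); apply: eq_bigr => m _; rewrite mul_mpolyC.
Qed.

Lemma initial_ideal_ideal : is_ideal (initial_ideal le I).
Proof. exact: ideal_gen_ideal. Qed.

Lemma initial_ideal_graded : is_graded (initial_ideal le I).
Proof.
move=> d f /initial_idealP If; apply/initial_idealP => m.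
by rewrite mcoeff_msupp mcoeff_pihomog; case: ifP; rewrite ?eqxx // -mcoeff_msupp => _ /If.
Qed.

Lemma initial_idealX m : initial_ideal le I 'X_[m] <-> lead_mon le I m.
Proof.
split=> [/initial_idealP/(_ m)|H]; first by apply; rewrite msuppX inE.
by apply/initial_idealP => m' /mem_msuppXP <-.
Qed.

Lemma lead_mon_initial m : lead_mon le (initial_ideal le I) m <-> lead_mon le I m.
Proof.
split=> [[f [/initial_idealP If [mf _]]]|H]; first exact: If.
exists 'X_[m]; split; first exact/initial_idealX.
split=> [|m' /mem_msuppXP<-]; first by rewrite msuppX inE.
exact: term_le_refl.
Qed.

End InitialIdeal.

(** * Binomial edge ideals and the complete graph *)

Section Variables.
Variables (T : finType) (A : {set T}).

Lemma nvars_case (p : 'I_(nvars A)) :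
  (exists v, p = xvar v) \/ (exists v, p = yvar v).
Proof.
case: (split_ordP p) => q ->; [left | right]; exists (enum_val q);
  by rewrite /xvar /yvar enum_valK.
Qed.

Lemma xvar_inj : injective (@xvar T A).
Proof. by move=> u v /lshift_inj/enum_rank_inj. Qed.

Lemma yvar_inj : injective (@yvar T A).
Proof. by move=> u v /rshift_inj/enum_rank_inj. Qed.

Lemma xvar_yvar u v : (xvar u == yvar v :> 'I_(nvars A)) = false.
Proof. exact: eq_lrshift. Qed.

Lemma yvar_xvar u v : (yvar v == xvar u :> 'I_(nvars A)) = false.
Proof. exact: eq_rlshift. Qed.

Lemma xvar_eq u v : (xvar u == xvar v :> 'I_(nvars A)) = (u == v).
Proof. exact: (inj_eq xvar_inj). Qed.

Lemma yvar_eq u v : (yvar u == yvar v :> 'I_(nvars A)) = (u == v).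
Proof. exact: (inj_eq yvar_inj). Qed.

Definition var_eqs := (xvar_yvar, yvar_xvar, xvar_eq, yvar_eq).

(** The exponent of [x_u y_v]. *)
Definition mxy (u v : subv A) : 'X_{1..nvars A} := (U_(xvar u) + U_(yvar v))%MM.

Lemma mxyx u v w : mxy u v (xvar w) = (u == w).
Proof. by rewrite mnmDE !mnm1E !var_eqs addn0. Qed.

Lemma mxyy u v w : mxy u v (yvar w) = (v == w).
Proof. by rewrite mnmDE !mnm1E !var_eqs. Qed.

Lemma mxy_inj u v u' v' : mxy u v = mxy u' v' -> u = u' /\ v = v'.
Proof.
move=> /mnmP e; split.
  by have := e (xvar u'); rewrite !mxyx eqxx; case: eqP.
by have := e (yvar v'); rewrite !mxyy eqxx; case: eqP.
Qed.

Lemma lem_mxy u v (m : 'X_{1..nvars A}) :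
  m (xvar u) != 0%N -> m (yvar v) != 0%N -> (mxy u v <= m)%MM.
Proof.
move=> mu mv; apply/mnm_lepP => p; case: (nvars_case p) => -[w ->].
  by rewrite mxyx; case: eqP => // <-; rewrite lt0n.
by rewrite mxyy; case: eqP => // <-; rewrite lt0n.
Qed.

Lemma mdeg_mxy u v : mdeg (mxy u v) = 2.
Proof. by rewrite mdegD !mdeg1. Qed.

Variable K : fieldType.

Definition minor (u v : subv A) : {mpoly K[nvars A]} :=
  'X_(xvar u) * 'X_(yvar v) - 'X_(xvar v) * 'X_(yvar u).

Lemma minorE u v : minor u v = 'X_[mxy u v] - 'X_[mxy v u].
Proof. by rewrite /minor !mpolyXD. Qed.

Lemma minorN u v : minor u v = - minor v u.
Proof. by rewrite /minor opprB. Qed.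

Lemma minor_homog u v : minor u v \is 2.-homog.
Proof. by rewrite minorE; apply: rpredB; rewrite dhomogX /= mdeg_mxy. Qed.

(** The Plücker relations: modulo the minors that involve [w], the variables at
    [w] annihilate the others. *)
Lemma plucker_x u v w :
  'X_(xvar w) * minor u v = 'X_(xvar u) * minor w v - 'X_(xvar v) * minor w u.
Proof. by rewrite /minor; ring. Qed.

Lemma plucker_y u v w :
  'X_(yvar w) * minor u v = 'X_(yvar u) * minor w v - 'X_(yvar v) * minor w u.
Proof. by rewrite /minor; ring. Qed.

End Variables.

Section EdgeIdeal.
Variables (K : fieldType) (d : Order.disp_t) (T : finOrderType d) (G : sgraph T).

Local Notation J := (binomial_edge_ideal K G).
Local Notation V := (subv (vset G)).

Lemma bei_ideal : is_ideal J.
Proof. exact: ideal_gen_ideal. Qed.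

Lemma bei_minor (u v : V) : adj G (val u) (val v) -> J (minor K u v).
Proof.
wlog uv : u v / (val u < val v)%O => [H uv|].
  have [lt_uv|lt_vu|/val_inj e] := ltgtP (val u) (val v); first exact: H.
    by rewrite minorN; apply: idealN bei_ideal _; apply: H; rewrite 1?adj_sym.
  by rewrite e adj_irr in uv.
by move=> auv; apply: ideal_gen_incl; exists u, v.
Qed.

Lemma bei_min (I : {mpoly K[nvars (vset G)]} -> Prop) : is_ideal I ->
  (forall u v : V, adj G (val u) (val v) -> I (minor K u v)) -> forall f, J f -> I f.
Proof.
by move=> II H; apply: ideal_gen_min => // f [u [v [_ uv ->]]]; apply: H.
Qed.

Lemma bei_graded : is_graded J.
Proof.
apply: ideal_gen_graded => f [u [v [_ _ ->]]]; exists 2; exact: minor_homog.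
Qed.

End EdgeIdeal.

(** * Leading monomials for the complete graph *)

Section Functional.
Variables (K : fieldType) (n : nat) (g : 'X_{1..n} -> K).
Implicit Types (f : {mpoly K[n]}).

Definition msum f : K := \sum_(m <- msupp f) f@_m * g m.

Lemma msumwE k f : (msize f <= k)%N ->
  msum f = \sum_(m : 'X_{1..n < k}) f@_m * g m.
Proof.
move=> lt_fk; pose I : subFinType _ := 'X_{1..n < k}.
rewrite /msum (ssrcomplements.big_mksub I) //=; first last.
+ by move=> x /msize_mdeg_lt /leq_trans /(_ lt_fk) ->.
+ by rewrite msupp_uniq.
rewrite big_rmcond //= => m /memN_msupp_eq0 ->; by rewrite mul0r.
Qed.

Lemma msumB : {morph msum : f h / f - h}.
Proof.
move=> f h; set k := maxn (msize (f - h)) (maxn (msize f) (msize h)).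
rewrite !(@msumwE k) ?leq_max ?leqnn ?orbT // -sumrB.
by apply: eq_bigr => m _; rewrite mcoeffB mulrBl.
Qed.

Lemma msumX (a : K) m : msum (a *: 'X_[m]) = a * g m.
Proof.
have [->|a0] := eqVneq a 0; first by rewrite scale0r mul0r /msum msupp0 big_nil.
by rewrite /msum msuppMCX // big_seq1 mcoeffZ mcoeffX eqxx mulr1.
Qed.

End Functional.

Section CompleteOrder.
Variables (T : finType) (A : {set T}) (le : rel 'X_{1..nvars A}).
Hypothesis le_term : term_order le.
Implicit Types (u v w : subv A) (m : 'X_{1..nvars A}).

(** For any term order, comparing the two terms of each minor totally orders
    the vertices. *)
Definition vle u v : bool := le (mxy v u) (mxy u v).
Definition vlt u v : bool := vle u v && (u != v).

Lemma vle_total u v : vle u v || vle v u.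
Proof. by case: le_term => tot _ _ _ _; apply: tot. Qed.

Lemma vle_anti u v : vle u v -> vle v u -> u = v.
Proof.
case: le_term => _ asym _ _ _ uv vu.
by have /mxy_inj[] : mxy v u = mxy u v by apply: asym; apply/andP.
Qed.

Lemma vle_trans v u w : vle u v -> vle v w -> vle u w.
Proof.
case: (le_term) => _ _ tr _ _; rewrite /vle => uv vw.
rewrite -(term_le_addr le_term _ _ (mxy v v)).
have E (a b c : subv A) : (mxy a b + mxy c c = mxy c b + mxy a c)%MM.
  by apply/mnmP => p; rewrite !mnmDE; lia.
rewrite !E; apply: (tr (mxy w v + mxy u v)%MM).
  by rewrite [X in le _ X]addmC (term_le_addr le_term).
by rewrite (term_le_addr le_term).
Qed.

Lemma vltNge u v : vlt u v = ~~ vle v u.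
Proof.
rewrite /vlt; apply/andP/idP => [[uv nuv]|nvu].
  by apply: contraNN nuv => vu; apply/eqP; apply: vle_anti.
have := vle_total u v; rewrite (negbTE nvu) orbF => uv; split=> //.
by apply: contraNneq nvu => e; move: uv; rewrite e.
Qed.

Lemma vle_lt_trans v u w : vle u v -> vlt v w -> vlt u w.
Proof. by move=> uv; rewrite !vltNge; apply: contraNN => wu; apply: vle_trans wu uv. Qed.

(** The monomials divisible by the leading term of some minor. *)
Definition inverted m : bool :=
  [exists u, exists v, [&& vlt u v, m (xvar u) != 0%N & m (yvar v) != 0%N]].

Lemma invertedP m : reflect
  (exists u v, [/\ vlt u v, m (xvar u) != 0%N & m (yvar v) != 0%N]) (inverted m).
Proof.
apply: (iffP existsP) => [[u /existsP[v /and3P[uv mu mv]]]|[u [v [uv mu mv]]]].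
  by exists u, v.
by exists u; apply/existsP; exists v; apply/and3P.
Qed.

(** The fibre of [m] for the Segre parametrisation [x_v = s z_v],
    [y_v = t z_v], whose kernel is the ideal of the complete graph. *)
Definition fibre m m' : bool :=
  [forall v, m (xvar v) + m (yvar v) == m' (xvar v) + m' (yvar v)]%N
  && (\sum_v m (xvar v) == \sum_v m' (xvar v))%N.

Lemma fibreP m m' : reflect
  ((forall v, m (xvar v) + m (yvar v) = m' (xvar v) + m' (yvar v))%N /\
  (\sum_v m (xvar v) = \sum_v m' (xvar v))%N) (fibre m m').
Proof.
apply: (iffP andP) => [[/forallP H /eqP e]|[H e]]; split=> //.
- by move=> v; apply/eqP.
- by apply/forallP => v; apply/eqP.
- exact/eqP.
Qed.

Lemma fibre_swap m m' u v : fibre m (m' + mxy u v)%MM = fibre m (m' + mxy v u)%MM.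
Proof.
have E w : ((m' + mxy u v)%MM (xvar w) + (m' + mxy u v)%MM (yvar w)
    = (m' + mxy v u)%MM (xvar w) + (m' + mxy v u)%MM (yvar w))%N.
  by rewrite !(mnmDE, mxyx, mxyy); lia.
have S (a b : subv A) : (\sum_w (m' + mxy a b)%MM (xvar w) = (\sum_w m' (xvar w)).+1)%N.
  under eq_bigr do rewrite mnmDE mxyx.
  rewrite big_split /= -addn1; congr (_ + _)%N.
  by rewrite (bigD1 a) //= eqxx big1 // => w; rewrite eq_sym => /negbTE->.
by rewrite /fibre !S; congr (_ && _); apply: eq_forallb => w; rewrite E.
Qed.

Lemma mdeg_xy m : mdeg m = (\sum_v (m (xvar v) + m (yvar v)))%N.
Proof.
rewrite mdegE big_split_ord big_split /=; congr (_ + _)%N.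
  rewrite (reindex (@enum_rank _)) /=; last exact/onW_bij/enum_rank_bij.
  by apply: eq_bigr.
rewrite (reindex (@enum_rank _)) /=; last exact/onW_bij/enum_rank_bij.
by apply: eq_bigr.
Qed.

Lemma fibre_mdeg m m' : fibre m m' -> mdeg m = mdeg m'.
Proof. by case/fibreP => E _; rewrite !mdeg_xy; apply: eq_bigr => v _. Qed.

(** A non-inverted monomial of a fibre has its y-variables at the smallest
    possible vertices, hence is unique. *)
Lemma fibre_standard m m' :
  fibre m m' -> ~~ inverted m -> ~~ inverted m' -> m = m'.
Proof.
move=> /fibreP[E S] /invertedP nm /invertedP nm'.
have Ex : forall v, m (xvar v) = m' (xvar v).
  suff H m1 m2 : (forall v, m1 (xvar v) + m1 (yvar v) = m2 (xvar v) + m2 (yvar v))%N ->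
      (\sum_v m1 (xvar v) = \sum_v m2 (xvar v))%N ->
      ~ (exists u v, [/\ vlt u v, m1 (xvar u) != 0%N & m1 (yvar v) != 0%N]) ->
      ~ (exists u v, [/\ vlt u v, m2 (xvar u) != 0%N & m2 (yvar v) != 0%N]) ->
      forall v, (m1 (xvar v) <= m2 (xvar v))%N.
    by move=> v; apply/eqP; rewrite eqn_leq !H.
  move=> {}E {}S n1 n2 v; rewrite leqNgt; apply/negP => v12.
  have [w w21] : exists w, (m1 (xvar w) < m2 (xvar w))%N.
    apply: contrapT => nw; move: S; apply/eqP; rewrite gtn_eqF //.
    rewrite (bigD1 v) //= [X in (_ < X)%N](bigD1 v) //= -addSn leq_add //.
    by apply: leq_sum => w _; rewrite leqNgt; apply/negP => w21; apply: nw; exists w.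
  have Ev := E v; have Ew := E w.
  have [vw|wv] : vlt v w \/ vle w v by rewrite vltNge; case: vle; [right | left].
    by apply: n1; exists v, w; split=> //; lia.
  apply: n2; exists w, v; split; [|lia|lia].
  rewrite /vlt wv; apply/eqP => e; rewrite e in w21; lia.
apply/mnmP => p; case: (nvars_case p) => -[v ->]; first exact: Ex.
by have := E v; rewrite Ex => /addnI.
Qed.

(** Swapping an inversion lowers a monomial, so that the smallest monomial of a
    fibre has no inversion. *)
Lemma standard_min m m' : ~~ inverted m -> fibre m m' -> le m m'.
Proof.
move=> nm fm; pose j := mdeg m.
have lm : (mdeg m < j.+1)%N by [].
pose P := [pred b : bmultinom (nvars A) j.+1 | fibre m b].
have fmm : fibre m m by apply/fibreP.
have Pm : P (BMultinom lm) by [].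
case: (@arg_minnP _ (BMultinom lm) P (fun b => term_rank le j b) Pm) => b Pb bmin.
have nb : ~~ inverted b.
  apply/negP => /invertedP[u [v [uv bu bv]]].
  have lb := lem_mxy bu bv.
  set r := (b - mxy u v + mxy v u)%MM.
  have bE : (b - mxy u v + mxy u v)%MM = b by rewrite submK.
  have Pr : fibre m r by rewrite -fibre_swap bE.
  have lr : (mdeg r < j.+1)%N by rewrite -(fibre_mdeg Pr).
  have := bmin (BMultinom lr) Pr; rewrite leqNgt => /negP; apply.
  apply: (term_rank_lt le_term) => /=; first by rewrite -(fibre_mdeg Pr).
    apply/eqP => rb; have /mxy_inj[e _] : mxy v u = mxy u v.
      by apply: (@addmI _ (b - mxy u v)%MM); rewrite bE.
    by move: uv; rewrite e /vlt eqxx andbF.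
  by rewrite -[X in le _ X]bE /r ![(_ - _ + _)%MM]addmC (term_le_addr le_term); case/andP: uv.
have mb : m = b by apply: fibre_standard.
have lm' : (mdeg m' < j.+1)%N by rewrite -(fibre_mdeg fm).
case: (eqVneq m m') => [->|mm']; first exact: term_le_refl.
case: (le_term) => tot _ _ _ _; case/orP: (tot m m') => // lm'm.
have := bmin (BMultinom lm') fm; rewrite leqNgt => /negP[].
rewrite -mb; apply: (term_rank_lt le_term) => //; first by rewrite -(fibre_mdeg fm).
by rewrite eq_sym.
Qed.

End CompleteOrder.

Section CompleteLead.
Variables (K : fieldType) (d : Order.disp_t) (T : finOrderType d) (G : sgraph T).
Hypothesis G_complete : complete_graph G.
Variables (le : rel 'X_{1..nvars (vset G)}) (le_term : term_order le).

Local Notation L := (binomial_edge_ideal K G).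

Lemma complete_adj (u v : subv (vset G)) : u != v -> adj G (val u) (val v).
Proof.
move=> uv; move/forall_inP: G_complete => /(_ _ (valP u))/forall_inP/(_ _ (valP v)).
by rewrite (inj_eq val_inj) uv.
Qed.

Lemma lead_minor u v : vlt le u v -> is_lead_monomial le (minor K u v) (mxy u v).
Proof.
case/andP => uv nuv.
have nm : mxy v u != mxy u v by apply: contraNneq nuv => /mxy_inj[->].
split; first by rewrite minorE mcoeff_msupp mcoeffB !mcoeffX eqxx (negbTE nm) subr0 oner_eq0.
move=> m; rewrite minorE => /msuppB_le; rewrite mem_cat !msuppX !inE => /orP[] /eqP-> //.
exact: term_le_refl.
Qed.

(** Summing the coefficients over a fibre is a functional that vanishes on [L], as
    the two terms of a minor are in the same fibre. If a leading monomial had no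
    inversion, it would be both the smallest element of its fibre and the largest
    term of the polynomial, hence the only term of the polynomial in that fibre. *)
Theorem lead_mon_complete m : lead_mon le L m <-> inverted le m.
Proof.
split=> [[f [Lf [mf lf]]]|/invertedP[u [v [uv mu mv]]]]; last first.
  apply: (lead_mon_le le_term (bei_ideal K G) (lem_mxy mu mv)).
  exists (minor K u v); split; last exact: lead_minor.
  by apply: bei_minor; apply: complete_adj; case/andP: uv.
apply: contraT => nm.
pose g m' : K := (fibre m m')%:R.
have f0 : msum g f = 0.
  have gI : is_ideal (fun f => forall h, msum g (h * f) = 0).
    split=> [h|f1 f2 H1 H2 h|h f1 H h'].
    - by rewrite mulr0 (sub_morph0 (msumB g)).
    - by rewrite mulrBr msumB H1 H2 subr0.
    - by rewrite mulrA.
  rewrite -[f]mul1r; apply: (bei_min gI _ Lf) => u v _ h.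
  elim/mpolyind: h => [|c m1 h _ _ IH]; first by rewrite mul0r (sub_morph0 (msumB g)).
  rewrite mulrDl (sub_morphD (msumB g)) IH addr0 minorE -scalerAl mulrBr -!mpolyXD.
  by rewrite scalerBr msumB !msumX /g fibre_swap subrr.
suff : msum g f != 0 by rewrite f0 eqxx.
rewrite /msum (bigD1_seq m) ?msupp_uniq //= big1_seq; last first.
  move=> m' /andP[m'm m'f]; rewrite /g; case: (boolP (fibre m m')) => [fm|]; last by rewrite mulr0.
  have lm := standard_min le_term nm fm.
  case/eqP: m'm; case: (le_term) => _ asym _ _ _; apply: asym.
  by rewrite lm lf.
have -> : g m = 1 by rewrite /g (introT (fibreP _ _)).
by rewrite mulr1 addr0 -mcoeff_msupp.
Qed.

End CompleteLead.

(** * Linearity of the resolution for the complete graph *)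

Section Inversions.
Variables (K : fieldType) (T : finType) (V : {set T}).
Variables (le : rel 'X_{1..nvars V}) (le_term : term_order le).
Variables (key : 'I_(nvars V) -> nat) (key_inj : injective key).
Variable mu : 'X_{1..nvars V}.
Implicit Types (A B : {set 'I_(nvars V)}) (m : 'X_{1..nvars V}).

Local Notation sbd := (@kbd 'I_(nvars V) key K (fun _ u => u)).

(** In multidegree [mu], the Koszul complex of the ideal of inverted monomials is
    the chain complex of this simplicial complex. *)
Definition inv_complex A : Prop :=
  (mesym1 A <= mu)%MM /\ inverted le (mu - mesym1 A)%MM.

Lemma inverted_le m m' : (m <= m')%MM -> inverted le m -> inverted le m'.
Proof.
move=> /mnm_lepP lm /invertedP[u [v [uv mu0 mv0]]]; apply/invertedP.
by exists u, v; split=> //; rewrite -lt0n; apply: leq_trans (lm _); rewrite lt0n.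
Qed.

Lemma inv_complexS A B : A \subset B -> inv_complex B -> inv_complex A.
Proof.
move=> AB [lB iB].
have lAB : (mesym1 A <= mesym1 B)%MM.
  apply/mnm_lepP => p; rewrite !mnmE; case: (boolP (p \in A)) => // pA.
  by rewrite (fintype.subsetP AB).
split; first exact: lepm_trans lAB lB.
by apply: inverted_le iB; apply/mnm_lepP => p; rewrite !mnmBE leq_sub2l // (mnm_lepP lAB).
Qed.

Lemma inv_complexU p A : p \notin A -> mu p != 0%N -> (mesym1 A <= mu)%MM ->
  inverted le (mu - mesym1 A - U_(p))%MM -> inv_complex (p |: A).
Proof.
move=> pA mp lA H; split; last by rewrite mesym1U // -submDA.
rewrite lem_mesym1U //; rewrite mnmBE mnmE (negbTE pA) subn0 //.
Qed.

(** Let [x_a] be the last x-variable dividing [mu]. Faces to which [x_a] cannot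
    be added leave [x_a] as their only x-variable; in degree above the linear
    strand they are paired off by a suitable y-variable, and what remains is a
    cone with apex [x_a]. *)
Theorem inv_complex_exact i : (i + 2 < mdeg mu)%N -> sexact K key inv_complex i.
Proof.
move=> i2 phi phiP phiZ.
have [[a0 a0P]|nox] := pselect (exists a, mu (@xvar T V a) != 0%N); last first.
  exists (fun=> 0); split=> [A|A]; first by rewrite eqxx.
  rewrite kbd0 //; apply/esym/eqP; apply: contraT => /phiP[[_ /invertedP[u [v [_ mu0 _]]]] _].
  by case: nox; exists u; apply: contraNneq mu0; rewrite mnmBE => ->.
(* [a] is the last vertex whose x-variable divides [mu]. *)
have [a aP amax] : exists2 a, mu (@xvar T V a) != 0%N &
    forall v, mu (xvar v) != 0%N -> vle le v a.
  pose S (v : subv V) := [set w | vle le w v].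
  case: (@arg_maxnP _ a0 (fun v => mu (xvar v) != 0%N) (fun v => #|S v|) a0P) => a aP amax.
  exists a => // v /amax; apply: contraLR => nva; rewrite -ltnNge.
  have av : vle le a v by have := vle_total le_term a v; rewrite (negbTE nva) orbF.
  apply/proper_card/properP; split.
    by apply/fintype.subsetP => w; rewrite !inE => wa; apply: (vle_trans le_term wa).
  by exists v; rewrite !inE //; have := vle_total le_term v v; rewrite orbb.
pose p := xvar a.
have [[b0 b0P]|noy] := pselect (exists b, mu (@yvar T V b) != 0%N); last first.
  exists (fun=> 0); split=> [A|A]; first by rewrite eqxx.
  rewrite kbd0 //; apply/esym/eqP; apply: contraT => /phiP[[_ /invertedP[u [v [_ _ mv0]]]] _].
  by case: noy; exists v; apply: contraNneq mv0; rewrite mnmBE => ->.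
(* A y-variable that cannot form an inversion with [x_a] is preferred: removing it
   is always harmless. Otherwise every y-variable forms one. *)
have [b bP bmin] : exists2 b, mu (@yvar T V b) != 0%N &
    (forall v, mu (yvar v) != 0%N -> vlt le a v) \/ vle le b a.
  have [[b [bP ba]]|nb] := pselect (exists b, mu (yvar b) != 0%N /\ vle le b a).
    by exists b => //; right.
  exists b0 => //; left=> v vP; rewrite vltNge //; apply/negP => va.
  by apply: nb; exists v.
pose q := yvar b.
have qp : q != p by rewrite /q /p var_eqs.
(* The faces outside the star of [p]. *)
pose Rel A := [/\ inv_complex A, p \notin A & ~ inv_complex (p |: A)].
have Rx A : Rel A -> forall v, ((mu - mesym1 A - U_(p))%MM (xvar v) = 0)%N
    /\ exists2 w, vlt le a w & (mu - mesym1 A)%MM (yvar w) != 0%N.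
  case=> [[lA iA] pA npA].
  have npI : ~~ inverted le (mu - mesym1 A - U_(p))%MM.
    by apply/negP => H; apply: npA; apply: inv_complexU.
  set m := (mu - mesym1 A)%MM in iA npI *.
  have mU r : (m - U_(p))%MM r = (m r - (p == r))%N by rewrite mnmBE mnm1E.
  case/invertedP: iA => u [w [uw mu0 mw0]].
  have mle (x : subv V) : m (xvar x) != 0%N -> vle le x a.
    by move=> mx; apply: amax; apply: contraNneq mx; rewrite mnmBE => ->.
  have ua : u = a.
    apply/eqP; apply: contraNT npI => nua; apply/invertedP; exists u, w.
    by split; rewrite // mU /p var_eqs ?(eq_sym a) ?(negbTE nua) subn0.
  rewrite {u}ua in uw mu0; move=> v; split; last by exists w.
  apply/eqP; apply: contraNT npI => mv0; apply/invertedP; exists v, w.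
  split; rewrite // ?mU /p ?var_eqs ?subn0 //.
  apply: (vle_lt_trans le_term _ uw); apply: mle; apply: contraNneq mv0.
  by rewrite mU => ->.
have Rq A : Rel A -> #|A| = i -> q \notin A -> inv_complex (q |: A).
  move=> RA Ai qA; have [[lA iA] pA _] := RA; have Rx' := Rx A RA.
  apply: inv_complexU => //; set m := (mu - mesym1 A)%MM in iA Rx' *.
  have mU r : (m - U_(q))%MM r = (m r - (q == r))%N by rewrite mnmBE mnm1E.
  have [w aw mw0] := (Rx' a).2.
  have ma : (m - U_(q))%MM (xvar a) != 0%N.
    by rewrite mU /q var_eqs subn0 /m mnmBE mnmE -/p (negbTE pA) subn0.
  case: bmin => [bmin|ba]; last first.
    apply/invertedP; exists a, w; split=> //; rewrite mU /q var_eqs.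
    case: (b =P w) => [bw|_]; last by rewrite subn0.
    by move: aw; rewrite -bw (vltNge le_term) ba.
  (* This is where the degree must exceed that of the linear strand. *)
  have [r mr] : exists r, (m - U_(p) - U_(q))%MM r != 0%N.
    have dm : mdeg m = (mdeg mu - i)%N.
      by rewrite -(submK lA) mdegD mdeg_mesym1 Ai addnK.
    have up : (U_(p) <= m)%MM by rewrite lep1mP /m mnmBE mnmE (negbTE pA) subn0.
    have uq : (U_(q) <= m - U_(p))%MM.
      rewrite lep1mP mnmBE mnm1E (eq_sym p) (negbTE qp) subn0.
      by rewrite /m mnmBE mnmE (negbTE qA) subn0.
    have e1 := congr1 (@mdeg _) (submK up); have e2 := congr1 (@mdeg _) (submK uq).
    rewrite mdegD mdeg1 dm in e1; rewrite mdegD mdeg1 in e2.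
    apply: contrapT => nr.
    have nz : mdeg (m - U_(p) - U_(q))%MM != 0%N by apply/eqP; lia.
    case/negP: nz; rewrite mdeg_eq0; apply/eqP/mnmP => r; rewrite mnm0E; apply/eqP.
    by apply: contraT => mr; case: nr; exists r.
  case: (nvars_case r) => -[v rv].
    by move: mr; rewrite rv mnmBE (Rx' v).1.
  have mv : (m - U_(q))%MM (yvar v) != 0%N.
    apply: contraNneq mr; rewrite rv !mnmBE !mnm1E /p var_eqs subn0 => ->.
    by [].
  apply/invertedP; exists a, v; split=> //; apply: bmin.
  by apply: contraNneq mv; rewrite mU /m mnmBE => ->.
have RqD A : Rel A -> q \in A -> Rel (A :\ q).
  move=> RA qA; have [DA pA _] := RA; split.
  - by apply: inv_complexS DA; apply: subD1set.
  - by rewrite !inE negb_and pA orbT.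
  case=> [lA' /invertedP[u [w [uw mu0 _]]]].
  have [Ex _] := Rx A RA u; case/eqP: mu0.
  rewrite !mnmBE in Ex *; move: Ex; rewrite mnm1E !mnmE !inE /p /q !var_eqs.
  rewrite (eq_sym a); case: (eqVneq u a) => [->|_]; last by case: (_ \in A) => /=; lia.
  by rewrite (negbTE pA) /=; lia.
(* Coning off the part of [phi] outside the star of [p] with apex [q] leaves a
   cycle supported in the star. *)
pose rphi A := if `[< Rel A >] then phi A else 0.
have rphiZ A : Rel A -> sbd rphi A = 0.
  move=> RA; rewrite -[RHS](phiZ A); apply: eq_bigr => r rA; congr (sgn _ _).
  rewrite /rphi; case: asboolP => // nR; apply/esym/eqP; apply: contraT => /phiP[DrA _].
  have [DA pA npA] := RA; case: nR; split=> //.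
    rewrite in_setU1 negb_or pA andbT; apply/eqP => e.
    by apply: npA; rewrite e.
  by move=> H; apply: npA; apply: inv_complexS H; apply: setUS; apply: subsetUr.
have rphiP A : rphi A != 0 -> Rel A /\ #|A| = i.
  by rewrite /rphi; case: asboolP => [RA /phiP[]|]; rewrite ?eqxx.
pose psi := kcone key q rphi.
have psiP A : psi A != 0 -> inv_complex A /\ #|A| = i.+1.
  case/kcone_supp => qA /rphiP[RA Ai].
  rewrite (cardsD1 q) qA Ai; split=> //; rewrite -(setD1K qA).
  by apply: Rq => //; rewrite !inE eqxx.
pose phi' A := phi A - sbd psi A.
have phi'P A : phi' A != 0 -> [/\ inv_complex A, #|A| = i & ~ Rel A].
  move=> nz.
  have [DA Ai] : inv_complex A /\ #|A| = i.
    have [p0|/phiP //] := eqVneq (phi A) 0.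
    have [r [rA nr]] : exists r, r \notin A /\ psi (r |: A) != 0.
      apply: contrapT => nr; case/eqP: nz; rewrite /phi' p0 sub0r /kbd big1 ?oppr0 // => r rA.
      rewrite (_ : psi _ = 0) ?sgn0 //; apply/eqP; apply: contraT => H.
      by case: nr; exists r.
    have [D c] := psiP _ nr; split; first by apply: inv_complexS D; apply: subsetUr.
    by move: c; rewrite cardsU1 rA add1n => -[].
  split=> // RA; case/eqP: nz.
  have := sbd_kcone key_inj q rphi A; rewrite -/psi {2}/rphi asboolT // /phi' => <-.
  rewrite addrAC subrr add0r /kcone; case: ifP => // qA.
  by rewrite rphiZ ?sgn0 //; apply: RqD.
have phi'Z A : sbd phi' A = 0.
  by rewrite kbdB // phiZ kbd_kbd // subr0.
exists (fun A => psi A + kcone key p phi' A); split=> [A nz|A]; last first.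
  have E := sbd_kcone key_inj p phi' A.
  rewrite [X in _ + X]kcone0 ?addr0 // in E.
  have -> : sbd (fun A => psi A + kcone key p phi' A) A
      = sbd psi A + sbd (kcone key p phi') A.
    by rewrite /kbd -big_split; apply: eq_bigr => r _; rewrite sgnD.
  by rewrite E /phi' addrC subrK.
have [s0|/psiP //] := eqVneq (psi A) 0.
move: nz; rewrite s0 add0r => /kcone_supp[pA /phi'P[DA Ai nR]].
split; last by rewrite (cardsD1 p) pA Ai.
apply: contrapT => nD; apply: nR; split=> //; first by rewrite !inE eqxx.
by rewrite setD1K.
Qed.

End Inversions.

Section CompleteLinear.
Variables (K : fieldType) (d : Order.disp_t) (T : finOrderType d) (G : sgraph T).
Hypothesis G_complete : complete_graph G.
Variables (le : rel 'X_{1..nvars (vset G)}) (le_term : term_order le).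
Variables (key : 'I_(nvars (vset G)) -> nat) (key_inj : injective key).

Local Notation L := (binomial_edge_ideal K G).

Lemma complete_sexact mu i : (i + 2 < mdeg mu)%N ->
  sexact K key (fun A => (mesym1 A <= mu)%MM /\ lead_mon le L (mu - mesym1 A)%MM) i.
Proof.
move=> imu phi phiP phiZ.
have E A : ((mesym1 A <= mu)%MM /\ lead_mon le L (mu - mesym1 A)%MM)
    <-> inv_complex le mu A.
  by split=> -[lA H]; split=> //; apply/(lead_mon_complete K G_complete le_term).
have [|psi [psiP psiE]] := inv_complex_exact (K := K) le_term key_inj imu (phi := phi) _ phiZ.
  by move=> A /phiP[/E].
by exists psi; split=> // A /psiP[/E].
Qed.

(** The leading monomials of [L] are the inverted monomials, so that the vanishing
    for the complexes of inversions lifts to [L]. *)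
Theorem complete_iexact i j : (i + 2 < j)%N -> iexact key L i j.
Proof.
move=> ij; apply: (strand_exact key_inj le_term (bei_ideal K G) (@bei_graded _ _ _ G)).
by move=> mu dmu; apply: complete_sexact; rewrite dmu.
Qed.

Theorem complete_initial_iexact i j : (i + 2 < j)%N ->
  iexact key (initial_ideal le L) i j.
Proof.
move=> ij; apply: (strand_exact key_inj le_term (initial_ideal_ideal _ _)).
  exact: (initial_ideal_graded le_term (bei_ideal K G)).
move=> mu dmu phi phiP phiZ.
have [||psi [psiP psiE]] := @complete_sexact mu i _ phi _ phiZ.
- by rewrite dmu.
- by move=> A /phiP[[lA /(lead_mon_initial le_term (bei_ideal K G))]].
exists psi; split=> // A /psiP[[lA H] Ai]; split=> //; split=> //.
exact/(lead_mon_initial le_term (bei_ideal K G)).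
Qed.

End CompleteLinear.

(** * Renaming variables and killing variables *)

Section Embedding.
Variables (K : fieldType) (n1 n : nat) (phi : 'I_n1 -> 'I_n) (phi_inj : injective phi).
Implicit Types (f : {mpoly K[n1]}) (g : {mpoly K[n]}).

Definition emb f : {mpoly K[n]} := f \mPo [tuple 'X_(phi i) | i < n1].

Definition ret_var (p : 'I_n) : {mpoly K[n1]} :=
  if [pick q | phi q == p] is Some q then 'X_q else 0.

(** The retraction of [emb] that kills the variables outside the range of [phi]. *)
Definition ret g : {mpoly K[n1]} := g \mPo [tuple ret_var p | p < n].

Definition memb (m : 'X_{1..n1}) : 'X_{1..n} := (\sum_i U_(phi i) *+ m i)%MM.

Lemma ret_var_phi q : ret_var (phi q) = 'X_q.
Proof.
rewrite /ret_var; case: pickP => [r /eqP/phi_inj -> //|/(_ q)].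
by rewrite eqxx.
Qed.

Lemma ret_var_out p : (forall q, p <> phi q) -> ret_var p = 0.
Proof.
by move=> out; rewrite /ret_var; case: pickP => // q /eqP/esym/out.
Qed.

Lemma embB : {morph emb : f g / f - g}. Proof. exact: raddfB. Qed.
Lemma retB : {morph ret : f g / f - g}. Proof. exact: raddfB. Qed.
Lemma embM : {morph emb : f g / f * g}. Proof. exact: rmorphM. Qed.
Lemma retM : {morph ret : f g / f * g}. Proof. exact: rmorphM. Qed.
Lemma embZ c : {morph emb : f / c *: f}. Proof. exact: linearZ. Qed.
Lemma retZ c : {morph ret : f / c *: f}. Proof. exact: linearZ. Qed.

Lemma emb_var q : emb 'X_q = 'X_(phi q).
Proof. by rewrite /emb comp_mpolyXU (nth_mktuple _ _ q). Qed.

Lemma ret_var_E p : ret 'X_p = ret_var p.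
Proof. by rewrite /ret comp_mpolyXU (nth_mktuple _ _ p). Qed.

Lemma memb_phi m q : memb m (phi q) = m q.
Proof.
rewrite mnm_sumE (bigD1 q) //= mulmnE mnm1E eqxx mul1n big1 ?addn0 // => r rq.
by rewrite mulmnE mnm1E (inj_eq phi_inj) (negbTE rq).
Qed.

Lemma memb_out m p : (forall q, p <> phi q) -> memb m p = 0%N.
Proof.
move=> out; rewrite mnm_sumE big1 // => r _.
by rewrite mulmnE mnm1E; case: eqP => // /esym/out.
Qed.

Lemma mdeg_memb m : mdeg (memb m) = mdeg m.
Proof.
by rewrite mdeg_sum mdegE; apply: eq_bigr => q _; rewrite mdegMn mdeg1 mul1n.
Qed.

Lemma memb_inj : injective memb.
Proof.
by move=> m m' e; apply/mnmP => q; rewrite -!memb_phi e.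
Qed.

Lemma membD m m' : memb (m + m')%MM = (memb m + memb m')%MM.
Proof.
apply/mnmP => p; rewrite mnmDE.
have [[q ->]|out] := pselect (exists q, p = phi q); first by rewrite !memb_phi mnmDE.
by rewrite !memb_out // => q e; apply: out; exists q.
Qed.

Lemma memb_cases (m : 'X_{1..n}) :
  (exists m', m = memb m') \/ (exists p, (forall q, p <> phi q) /\ m p != 0%N).
Proof.
have [[p H]|H] := pselect (exists p, (forall q, p <> phi q) /\ m p != 0%N).
  by right; exists p.
left; exists [multinom m (phi q) | q < n1]; apply/mnmP => p.
have [[q ->]|out] := pselect (exists q, p = phi q); first by rewrite memb_phi mnmE.
have op q : p <> phi q by move=> e; apply: out; exists q.
by rewrite memb_out //; apply/eqP; apply: contraT => mp; case: H; exists p.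
Qed.

Lemma embX m : emb 'X_[m] = 'X_[memb m].
Proof.
rewrite /emb comp_mpolyX; under eq_bigr do rewrite tnth_mktuple.
by rewrite mprodXnE.
Qed.

Lemma ret_out (m : 'X_{1..n}) p : (forall q, p <> phi q) -> m p != 0%N -> ret 'X_[m] = 0.
Proof.
move=> out mp; rewrite -(submK (m := U_(p)%MM) (m' := m)) ?lep1mP //.
by rewrite mpolyXD retM ret_var_E ret_var_out // mulr0.
Qed.

Lemma ret_membX m : ret 'X_[memb m] = 'X_[m].
Proof.
rewrite /memb -mprodXnE [RHS]mpolyXE_id /ret rmorph_prod.
by apply: eq_bigr => q _; rewrite rmorphXn /= -/(ret _) ret_var_E ret_var_phi.
Qed.

Lemma embK f : ret (emb f) = f.
Proof.
elim/mpolyind: f => [|c m f _ _ IH]; first by rewrite (sub_morph0 embB) (sub_morph0 retB).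
rewrite (sub_morphD embB) (sub_morphD retB) IH embZ retZ embX ret_membX //.
Qed.

Lemma mcoeff_ret g m : (ret g)@_m = g@_(memb m).
Proof.
elim/mpolyind: g => [|c m' g _ _ IH]; first by rewrite (sub_morph0 retB) !mcoeff0.
rewrite (sub_morphD retB) !mcoeffD IH retZ !mcoeffZ mcoeffX; congr (_ * _ + _).
have [[m1 ->]|[p [out mp]]] := memb_cases m'.
  by rewrite ret_membX mcoeffX (inj_eq memb_inj).
rewrite (ret_out out mp) mcoeff0; case: eqP => // e.
by move: mp; rewrite e memb_out.
Qed.

Lemma mcoeff_emb f m : (emb f)@_(memb m) = f@_m.
Proof. by rewrite -mcoeff_ret embK. Qed.

Lemma msupp_ret g m : (m \in msupp (ret g)) = (memb m \in msupp g).
Proof. by rewrite !mcoeff_msupp mcoeff_ret. Qed.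

Lemma mcoeff_emb_out f (m : 'X_{1..n}) p : (forall q, p <> phi q) -> m p != 0%N -> (emb f)@_m = 0.
Proof.
move=> out mp; elim/mpolyind: f => [|c m' f _ _ IH]; first by rewrite (sub_morph0 embB) mcoeff0.
rewrite (sub_morphD embB) mcoeffD IH embZ mcoeffZ embX mcoeffX.
case: eqP => [e|_]; last by rewrite mulr0 addr0.
by move: mp; rewrite -e memb_out.
Qed.

Lemma msupp_emb f m : m \in msupp (emb f) -> exists2 m', m' \in msupp f & m = memb m'.
Proof.
rewrite mcoeff_msupp; have [[m' ->]|[p [out mp]]] := memb_cases m.
  by rewrite mcoeff_emb -mcoeff_msupp; exists m'.
by rewrite (mcoeff_emb_out _ out mp) eqxx.
Qed.

Lemma hpol_emb j s f : hpol j s f -> hpol j s (emb f).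
Proof. by move=> hf m /msupp_emb[m' /hf <- ->]; rewrite mdeg_memb. Qed.

Lemma hpol_ret j s g : hpol j s g -> hpol j s (ret g).
Proof. by move=> hg m; rewrite msupp_ret => /hg <-; rewrite mdeg_memb. Qed.

Lemma emb_xmul q f : emb (xmul q f) = xmul (phi q) (emb f).
Proof. by rewrite /xmul embM emb_var. Qed.

Lemma ret_xmul q g : ret (xmul (phi q) g) = xmul q (ret g).
Proof. by rewrite /xmul retM ret_var_E ret_var_phi. Qed.

Lemma ret_xmul_out p g : (forall q, p <> phi q) -> ret (xmul p g) = 0.
Proof. by move=> out; rewrite /xmul retM ret_var_E ret_var_out ?mul0r. Qed.

End Embedding.

(** * Koszul complexes over a partition of the variables *)

Section Join.
Variables (K : fieldType) (n1 n2 n : nat).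
Variables (phi1 : 'I_n1 -> 'I_n) (phi2 : 'I_n2 -> 'I_n).
Hypotheses (inj1 : injective phi1) (inj2 : injective phi2).
Hypothesis cover : forall p, (exists q, p = phi1 q) \/ (exists r, p = phi2 r).
Hypothesis disj : forall q r, phi1 q <> phi2 r.
Variables (key : 'I_n -> nat) (key_inj : injective key).

Definition pre1 (A : {set 'I_n}) : {set 'I_n1} := [set q | phi1 q \in A].
Definition pre2 (A : {set 'I_n}) : {set 'I_n2} := [set r | phi2 r \in A].
(** Every set of variables is [uset A1 A2] for unique [A1] and [A2], namely [pre1 A]
    and [pre2 A]. *)
Definition uset (A1 : {set 'I_n1}) (A2 : {set 'I_n2}) : {set 'I_n} :=
  [set phi1 q | q in A1] :|: [set phi2 r | r in A2].

Lemma in_uset1 q A1 A2 : (phi1 q \in uset A1 A2) = (q \in A1).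
Proof.
rewrite in_setU mem_imset //; case: (boolP (phi1 q \in imset _ _)).
  by case/imsetP => r _ /disj.
by rewrite orbF.
Qed.

Lemma in_uset2 r A1 A2 : (phi2 r \in uset A1 A2) = (r \in A2).
Proof.
rewrite in_setU orbC mem_imset //; case: (boolP (phi2 r \in imset _ _)).
  by case/imsetP => q _ /esym/disj.
by rewrite orbF.
Qed.

Lemma eq_sets (A B : {set 'I_n}) : (forall q, (phi1 q \in A) = (phi1 q \in B)) ->
  (forall r, (phi2 r \in A) = (phi2 r \in B)) -> A = B.
Proof. by move=> E1 E2; apply/setP => p; case: (cover p) => -[q ->]. Qed.

Lemma pre1_uset A1 A2 : pre1 (uset A1 A2) = A1.
Proof. by apply/setP => q; rewrite inE in_uset1. Qed.

Lemma pre2_uset A1 A2 : pre2 (uset A1 A2) = A2.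
Proof. by apply/setP => q; rewrite inE in_uset2. Qed.

Lemma uset_pre A : uset (pre1 A) (pre2 A) = A.
Proof. by apply: eq_sets => q; rewrite ?in_uset1 ?in_uset2 inE. Qed.

Lemma setU1_uset q A1 A2 : phi1 q |: uset A1 A2 = uset (q |: A1) A2.
Proof.
apply: eq_sets => r; rewrite in_setU1 ?in_uset1 ?in_uset2 ?in_setU1 ?(inj_eq inj1) //.
by case: eqP => // /esym/disj.
Qed.

Lemma card_uset A1 A2 : #|uset A1 A2| = (#|A1| + #|A2|)%N.
Proof.
rewrite cardsU !card_imset // (_ : _ :&: _ = set0) ?cards0 ?subn0 //.
apply/setP => p; rewrite in_setI in_set0.
by apply/negP => /andP[/imsetP[q _ ->] /imsetP[r _ /disj]].
Qed.

Lemma card_pre (A : {set 'I_n}) : #|A| = (#|pre1 A| + #|pre2 A|)%N.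
Proof. by rewrite -{1}(uset_pre A) card_uset. Qed.

Lemma sum_split (V : zmodType) (P : pred 'I_n) (F : 'I_n -> V) :
  \sum_(p | P p) F p = \sum_(q | P (phi1 q)) F (phi1 q) + \sum_(r | P (phi2 r)) F (phi2 r).
Proof.
rewrite (bigID (fun p => p \in [set phi1 q | q in setT])) /=; congr (_ + _).
  rewrite [RHS]big_mkcond big_mkcondl /=.
  rewrite big_imset /=; last by move=> q q' _ _ /inj1.
  by apply: eq_bigl => q; rewrite inE.
rewrite [RHS]big_mkcond big_mkcondl /=.
rewrite (eq_bigl (fun p => p \in [set phi2 r | r in setT])); last first.
  move=> p; apply/idP/idP => [np|/imsetP[r _ ->]].
    case: (cover p) np => -[q ->]; last by rewrite imset_f.
    by rewrite imset_f.
  by apply/negP => /imsetP[q _ /esym/disj].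
rewrite big_imset /=; last by move=> q q' _ _ /inj2.
by apply: eq_bigl => q; rewrite inE.
Qed.

(** The variables of the second block contribute a sign to the differential of
    the first, which the twist [twist A2] turns into the differential of the
    Koszul complex of the first block alone. *)
Definition tau (q : 'I_n1) (A2 : {set 'I_n2}) : bool :=
  odd #|[set r in A2 | (key (phi2 r) < key (phi1 q))%N]|.

Definition twist (A2 : {set 'I_n2}) (A1 : {set 'I_n1}) : bool :=
  \big[addb/false]_(q in A1) tau q A2.

Lemma ksgn_uset q A1 A2 :
  ksgn key (phi1 q) (uset A1 A2) = ksgn (key \o phi1) q A1 (+) tau q A2.
Proof.
rewrite /ksgn /tau card_pre oddD; congr (addb (odd _) (odd _)); apply: eq_card => r;
  by rewrite [LHS]inE [LHS]inE [RHS]inE ?in_uset1 ?in_uset2.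
Qed.

Lemma twistU q (A1 : {set 'I_n1}) (A2 : {set 'I_n2}) :
  q \notin A1 -> twist A2 (q |: A1) = tau q A2 (+) twist A2 A1.
Proof. by move=> qA; rewrite /twist big_setU1. Qed.

Lemma tau0 q : tau q set0 = false.
Proof.
rewrite /tau (_ : [set r in _ | _] = set0) ?cards0 //.
by apply/setP => r; rewrite !inE.
Qed.

Definition kbd1 (F : {set 'I_n} -> {mpoly K[n1]}) (A : {set 'I_n}) : {mpoly K[n1]} :=
  \sum_(q | phi1 q \notin A) sgn (ksgn key (phi1 q) A) (xmul q (F (phi1 q |: A))).

Lemma kbd_twist F A1 A2 :
  kbd (key \o phi1) (@xmul K n1) (fun B1 => sgn (twist A2 B1) (F (uset B1 A2))) A1
  = sgn (twist A2 A1) (kbd1 F (uset A1 A2)).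
Proof.
rewrite /kbd1 sgn_sum; apply: eq_big => [q|q qA]; first by rewrite in_uset1.
rewrite (sub_morph_sgn (xmulB q)) !sgn_sgn setU1_uset ksgn_uset twistU //.
by congr sgn; case: ksgn; case: tau; case: twist.
Qed.

Lemma kbd1_twist (v : {set 'I_n2} -> {set 'I_n1} -> {mpoly K[n1]}) A :
  kbd1 (fun B => sgn (twist (pre2 B) (pre1 B)) (v (pre2 B) (pre1 B))) A
  = sgn (twist (pre2 A) (pre1 A)) (kbd (key \o phi1) (@xmul K n1) (v (pre2 A)) (pre1 A)).
Proof.
set F := fun B => _.
have := kbd_twist F (pre1 A) (pre2 A); rewrite uset_pre => E.
have {}E := congr1 (sgn (twist (pre2 A) (pre1 A))) E.
rewrite [in RHS]sgn_sgn addbb /= in E; rewrite -{}E; congr (sgn _ _).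
by apply: eq_kbd => B1; rewrite /F pre1_uset pre2_uset sgn_sgn addbb.
Qed.

Lemma ret_kbd (c : {set 'I_n} -> {mpoly K[n]}) A :
  ret phi1 (kbd key (@xmul K n) c A) = kbd1 (fun B => ret phi1 (c B)) A.
Proof.
rewrite /kbd sum_split (sub_morphD (retB _)) !(sub_morph_sum (retB _)).
rewrite [X in _ + X]big1 ?addr0 => [|r _].
  by apply: eq_bigr => q _; rewrite (sub_morph_sgn (retB _)) ret_xmul.
rewrite (sub_morph_sgn (retB _)) ret_xmul_out ?sgn0 // => q /esym; exact: disj.
Qed.

Lemma kbd_emb F A :
  kbd key (@xmul K n) (fun B => emb phi1 (F B)) A - emb phi1 (kbd1 F A)
  = \sum_(r | phi2 r \notin A)
      sgn (ksgn key (phi2 r) A) (xmul (phi2 r) (emb phi1 (F (phi2 r |: A)))).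
Proof.
rewrite /kbd sum_split (sub_morph_sum (embB _)) addrAC -[RHS]add0r; congr (_ + _).
apply/eqP; rewrite subr_eq0; apply/eqP; apply: eq_bigr => q _.
by rewrite (sub_morph_sgn (embB _)) emb_xmul.
Qed.

(** A cycle of [P1] extends by zero to a cycle of [P]; if that bounds in [P], killing
    the second block retracts the bounding chain onto one of [P1]. *)
Lemma iexact_ret (P : {mpoly K[n]} -> Prop) (P1 : {mpoly K[n1]} -> Prop) i j :
  is_ideal P ->
  (forall f, P1 f -> P (emb phi1 f)) -> (forall g, P g -> P1 (ret phi1 g)) ->
  iexact key P i j -> iexact (key \o phi1) P1 i j.
Proof.
move=> PI PE PR Pex c cP cZ.
pose C A := if pre2 A == set0 then emb phi1 (c (pre1 A)) else 0.
have E A1 : uset A1 set0 = [set phi1 q | q in A1].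
  by rewrite /uset imset0 setU0.
have [A|A|w [wP wE]] := Pex C.
- rewrite /C; case: eqP => [A20|_]; last by split=> //; split; [case: PI | exact: hpol0].
  have cA : #|A| = #|pre1 A| by rewrite card_pre A20 cards0 addn0.
  have [[P1c hc] ci] := cP (pre1 A); rewrite cA; split.
    by split; [exact: PE | exact: hpol_emb].
  by move/ci=> ->; rewrite (sub_morph0 (embB _)).
- rewrite /kbd sum_split [X in _ + X]big1 ?addr0 => [|r rA].
    have [A20|A20] := boolP (pre2 A == set0); last first.
      rewrite big1 // => q qA; rewrite /C (_ : pre2 _ = pre2 A).
        by rewrite (negbTE A20) (sub_morph0 (xmulB _)) sgn0.
      apply/setP => r; rewrite !inE; case: eqP => // /esym/disj //.
    rewrite -[RHS](sub_morph0 (embB phi1)) -(cZ (pre1 A)) /kbd (sub_morph_sum (embB _)).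
    apply: eq_big => [q|q qA]; first by rewrite inE.
    rewrite (sub_morph_sgn (embB _)) emb_xmul; congr (sgn _ (xmul _ _)).
      by rewrite -{1}(uset_pre A) ksgn_uset (eqP A20) tau0 addbF.
    rewrite /C -(uset_pre A) setU1_uset pre2_uset pre1_uset (eqP A20) eqxx.
    by rewrite pre1_uset.
  rewrite /C; case: eqP => [/setP/(_ r)|_]; first by rewrite !inE eqxx.
  by rewrite (sub_morph0 (xmulB _)) sgn0.
exists (fun A1 => ret phi1 (w (uset A1 set0))); split=> [A1|A1].
  have [[Pw hw] wi] := wP (uset A1 set0).
  rewrite card_uset cards0 addn0 in hw wi; split; first by split; [exact: PR | exact: hpol_ret].
  by move/wi => ->; rewrite (sub_morph0 (retB _)).
have tw0 B1 : twist set0 B1 = false.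
  by rewrite /twist big1 // => q _; rewrite tau0.
have := kbd_twist (fun B => ret phi1 (w B)) A1 set0.
rewrite tw0 -ret_kbd wE /C pre2_uset eqxx pre1_uset embK // => E1.
rewrite -[RHS]/(sgn false (c A1)) -E1; by apply: eq_kbd => B1; rewrite tw0.
Qed.

(** The twisted slices of [U] over each [A2] are Koszul chains of the first block;
    their boundaries, being cycles of [P1], bound in [P1], and the cycles obtained
    by subtracting the bounding chains bound in [Q1]. *)
Lemma partial_bound (Q1 P1 : {mpoly K[n1]} -> Prop) i d :
  is_ideal P1 -> is_ideal Q1 -> (forall f, P1 f -> Q1 f) -> (3 < d)%N ->
  (forall i', iexact (key \o phi1) P1 i' (i' + d)) ->
  (forall i' j', (i' + 2 < j')%N -> iexact (key \o phi1) Q1 i' j') ->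
  forall U : {set 'I_n} -> {mpoly K[n1]},
  kchain (fun s f => Q1 f /\ hpol (i + d) s f) i.+1 U ->
  (forall A, P1 (kbd1 U A)) ->
  exists W V : {set 'I_n} -> {mpoly K[n1]},
  [/\ kchain (fun s f => P1 f /\ hpol (i + d) s f) i.+1 W,
      kchain (fun s f => Q1 f /\ hpol (i + d) s f) i.+2 V &
      forall A, U A = W A + kbd1 V A].
Proof.
move=> P1I Q1I PQ d3 P1ex Q1ex U UQ UP.
pose u A2 A1 := sgn (twist A2 A1) (U (uset A1 A2)).
have sgnI (I : {mpoly K[n1]} -> Prop) b f : is_ideal I -> I f -> I (sgn b f).
  by case: b => //= II; apply: idealN.
have sgnh b j s (f : {mpoly K[n1]}) : hpol j s f -> hpol j s (sgn b f).
  by case: b => //= hf m; rewrite (perm_mem (msuppN _)); apply: hf.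
have slice (A2 : {set 'I_n2}) :
  exists wv : ({set 'I_n1} -> {mpoly K[n1]}) * ({set 'I_n1} -> {mpoly K[n1]}),
    [/\ forall A1 : {set 'I_n1}, [/\ P1 (wv.1 A1), hpol (i + d) (#|A1| + #|A2|) (wv.1 A1)
          & (#|A1| + #|A2|)%N != i.+1 -> wv.1 A1 = 0],
        forall A1 : {set 'I_n1}, [/\ Q1 (wv.2 A1), hpol (i + d) (#|A1| + #|A2|) (wv.2 A1)
          & (#|A1| + #|A2|)%N != i.+2 -> wv.2 A1 = 0]
      & forall A1, u A2 A1 = wv.1 A1 + kbd (key \o phi1) (@xmul K n1) wv.2 A1].
  have uQ (A1 : {set 'I_n1}) : [/\ Q1 (u A2 A1), hpol (i + d) (#|A1| + #|A2|) (u A2 A1)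
          & (#|A1| + #|A2|)%N != i.+1 -> u A2 A1 = 0].
    have [[UQ1 hU] Ui] := UQ (uset A1 A2); rewrite card_uset in hU Ui.
    by split; [exact: sgnI | exact: sgnh | move=> /Ui; rewrite /u => ->; rewrite sgn0].
  have uP A1 : P1 (kbd (key \o phi1) (@xmul K n1) (u A2) A1).
    by rewrite kbd_twist; apply: sgnI => //.
  have hshift j k s (f : {mpoly K[n1]}) : hpol (j + k) (s + k) f <-> hpol j s f.
    by split=> H m /H; lia.
  have k0 : forall A1, kbd (key \o phi1) (@xmul K n1) (fun=> 0) A1 = 0.
    by move=> A1; rewrite kbd0 //; exact: xmulB.
  have inj11 : injective (key \o phi1) by apply: inj_comp.
  (* Slices over sets [A2] that are too large vanish; over the others, both
     degrees drop by [#|A2|], so the difference of degrees is preserved. *)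
  have [k_big|k_small] := ltnP i.+1 #|A2|.
    exists (fun=> 0, fun=> 0); split=> [A1|A1|A1] /=.
    - by split=> //; [case: P1I | exact: hpol0].
    - by split=> //; [case: Q1I | exact: hpol0].
    - by rewrite k0 addr0; have [_ _ ->] := uQ A1; rewrite // gtn_eqF // ltn_addl.
  set k := #|A2| in k_small uQ *.
  have [i1 Ei1] : exists i1, i.+1 = (i1 + k)%N by exists (i.+1 - k)%N; rewrite subnK.
  have Ed : (i + d = (i1 + d.-1) + k)%N by lia.
  have uC : kchain (fun s f => Q1 f /\ hpol (i1 + d.-1) s f) i1 (u A2).
    move=> A1; have [Qu hu ui] := uQ A1; split.
      by split=> //; apply/(hshift _ k); rewrite -Ed.
    by move=> Ai; apply: ui; rewrite Ei1 eqn_add2r.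
  have [w [wC wE]] : exists w, kchain (fun s f => P1 f /\ hpol (i1 + d.-1) s f) i1 w
      /\ forall A1, kbd (key \o phi1) (@xmul K n1) w A1
                  = kbd (key \o phi1) (@xmul K n1) (u A2) A1.
    case: i1 => [|i1] in Ei1 Ed uC *.
      exists (fun=> 0); split=> [A1|A1].
        by split=> //; split; [case: P1I | exact: hpol0].
      rewrite k0 /kbd big1 // => q qA; rewrite (uC _).2 ?(sub_morph0 (xmulB _)) ?sgn0 //.
      by rewrite cardsU1 qA.
    have Ed' : (i1.+1 + d.-1 = i1 + d)%N by lia.
    rewrite Ed' in uC *; apply: P1ex => [A1|A1]; last first.
      by rewrite kbd_kbd //; [exact: xmulB | exact: xmulC].
    have [[_ hk] ki] := kbd_chain (key \o phi1) (@xmulB _ _) (ksub_ideal _ Q1I) uC A1.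
    by split=> //; split.
  have wCQ : kchain (fun s f => Q1 f /\ hpol (i1 + d.-1) s f) i1 w.
    by move=> A1; have [[Pw hw] wi] := wC A1; split=> //; split=> //; apply: PQ.
  have [|A1||v [vC vE]] := Q1ex i1 (i1 + d.-1)%N _ (fun A1 => u A2 A1 - w A1).
  - by lia.
  - exact: (kchainB (ksub_ideal _ Q1I) uC wCQ).
  - by move=> A1; rewrite kbdB ?wE ?subrr //; exact: xmulB.
  exists (w, v); split=> /= A1.
  - have [[Pw hw] wi] := wC A1; split=> //; first by rewrite Ed; apply/hshift.
    by rewrite Ei1 eqn_add2r.
  - have [[Qv hv] vi] := vC A1; split=> //; first by rewrite Ed; apply/hshift.
    by rewrite -addn1 Ei1 addnAC addn1 eqn_add2r.
  - by rewrite vE addrC subrK.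
have [wv wvP] := choice slice.
pose W A := sgn (twist (pre2 A) (pre1 A)) ((wv (pre2 A)).1 (pre1 A)).
pose V A := sgn (twist (pre2 A) (pre1 A)) ((wv (pre2 A)).2 (pre1 A)).
exists W, V; split=> A.
- have [H _ _] := wvP (pre2 A); have [Pw hw wi] := H (pre1 A); rewrite /W.
  rewrite (card_pre A); split; first by split; [exact: sgnI | exact: sgnh].
  by move/wi=> ->; rewrite sgn0.
- have [_ H _] := wvP (pre2 A); have [Pw hw wi] := H (pre1 A); rewrite /V.
  rewrite (card_pre A); split; first by split; [exact: sgnI | exact: sgnh].
  by move/wi=> ->; rewrite sgn0.
have [_ _ H] := wvP (pre2 A); have {}H := H (pre1 A).
rewrite /V (kbd1_twist (fun A2 => (wv A2).2)) /W -sgnD -H /u uset_pre.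
by rewrite sgn_sgn addbb.
Qed.

End Join.

(** * The Koszul homology of a join *)

Section JoinExact.
Variables (K : fieldType) (n1 n2 n : nat).
Variables (phi1 : 'I_n1 -> 'I_n) (phi2 : 'I_n2 -> 'I_n).
Hypotheses (inj1 : injective phi1) (inj2 : injective phi2).
Hypothesis cover : forall p, (exists q, p = phi1 q) \/ (exists r, p = phi2 r).
Hypothesis disj : forall q r, phi1 q <> phi2 r.
Variables (key : 'I_n -> nat) (key_inj : injective key).
Variables (P Q : {mpoly K[n]} -> Prop) (P1 Q1 : {mpoly K[n1]} -> Prop).
Variables (P2 Q2 : {mpoly K[n2]} -> Prop).

(** What the ideals [P] of a join, [Q] of the complete graph and their counterparts
    on the two blocks have in common with their initial ideals. *)
Record join_situation : Prop := JoinSituation {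
  js_ideal : is_ideal P; js_idealQ : is_ideal Q;
  js_ideal1 : is_ideal P1; js_idealQ1 : is_ideal Q1;
  js_ideal2 : is_ideal P2; js_idealQ2 : is_ideal Q2;
  js_sub : forall f, P f -> Q f;
  js_sub1 : forall f, P1 f -> Q1 f;
  js_sub2 : forall f, P2 f -> Q2 f;
  js_emb1 : forall f, P1 f -> P (emb phi1 f);
  js_emb2 : forall f, P2 f -> P (emb phi2 f);
  js_ret1 : forall f, P f -> P1 (ret phi1 f);
  js_ret2 : forall f, P f -> P2 (ret phi2 f);
  js_retQ1 : forall f, Q f -> Q1 (ret phi1 f);
  js_retQ2 : forall f, Q f -> Q2 (ret phi2 f);
  js_mul1 : forall r f, Q1 f -> P (xmul (phi2 r) (emb phi1 f));
  js_mul2 : forall q f, Q2 f -> P (xmul (phi1 q) (emb phi2 f));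
  js_decomp : forall f, Q f ->
    P (f - emb phi1 (ret phi1 f) - emb phi2 (ret phi2 f))
}.

Hypothesis js : join_situation.

(** [Q / P] is the direct sum of [Q1 / P1] and [Q2 / P2], each killed by the
    variables of the other block. A cycle of [P] bounds in [Q], and the bounding
    chain is corrected into [P] one summand at a time. *)
Theorem join_iexact i d : (3 < d)%N ->
  (forall i' j', (i' + 2 < j')%N -> iexact key Q i' j') ->
  (forall i' j', (i' + 2 < j')%N -> iexact (key \o phi1) Q1 i' j') ->
  (forall i' j', (i' + 2 < j')%N -> iexact (key \o phi2) Q2 i' j') ->
  (forall i', iexact (key \o phi1) P1 i' (i' + d)) ->
  (forall i', iexact (key \o phi2) P2 i' (i' + d)) ->
  iexact key P i (i + d).
Proof.
case: js => PI QI P1I Q1I P2I Q2I PQ PQ1 PQ2 E1 E2 R1 R2 RQ1 RQ2 M1 M2 dec.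
move=> d3 Qex Q1ex Q2ex P1ex P2ex c cP cZ.
have [||z [zQ zE]] := Qex i (i + d)%N _ c _ cZ; first by lia.
  by move=> A; have [[Pc hc] ci] := cP A; split=> //; split=> //; exact: PQ.
have cover' p : (exists r, p = phi2 r) \/ (exists q, p = phi1 q).
  by case: (cover p); [right | left].
have disj' r q : phi2 r <> phi1 q by move/esym/disj.
have [W1 [V1 [W1P V1Q UE1]]] : exists W V : {set 'I_n} -> {mpoly K[n1]},
  [/\ kchain (fun s f => P1 f /\ hpol (i + d) s f) i.+1 W,
      kchain (fun s f => Q1 f /\ hpol (i + d) s f) i.+2 V &
      forall A, ret phi1 (z A) = W A + kbd1 phi1 key V A].
  apply: (partial_bound inj1 inj2 cover disj key_inj P1I Q1I) => // A.
    have [[Qz hz] zi] := zQ A; split; first by split; [exact: RQ1 | exact: hpol_ret].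
    by move/zi => ->; rewrite (sub_morph0 (retB _)).
  by rewrite -(ret_kbd inj1 inj2 cover disj) zE; apply: R1; have [[]] := cP A.
have [W2 [V2 [W2P V2Q UE2]]] : exists W V : {set 'I_n} -> {mpoly K[n2]},
  [/\ kchain (fun s f => P2 f /\ hpol (i + d) s f) i.+1 W,
      kchain (fun s f => Q2 f /\ hpol (i + d) s f) i.+2 V &
      forall A, ret phi2 (z A) = W A + kbd1 phi2 key V A].
  apply: (partial_bound inj2 inj1 cover' disj' key_inj P2I Q2I) => // A.
    have [[Qz hz] zi] := zQ A; split; first by split; [exact: RQ2 | exact: hpol_ret].
    by move/zi => ->; rewrite (sub_morph0 (retB _)).
  by rewrite -(ret_kbd inj2 inj1 cover' disj') zE; apply: R2; have [[]] := cP A.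
(* Subtracting the boundary of [V] from [z] moves [z] into [P]. *)
pose V A := emb phi1 (V1 A) + emb phi2 (V2 A).
have TI : @is_ideal K n (fun=> True) by split.
have VT : kchain (fun s f => True /\ hpol (i + d) s f) i.+2 V.
  move=> A; have [[_ h1] v1] := V1Q A; have [[_ h2] v2] := V2Q A; split.
    split=> // m /msuppD_le; rewrite mem_cat => /orP[].
      exact: hpol_emb.
    exact: hpol_emb.
  by move=> Ai; rewrite /V v1 // v2 // !(sub_morph0 (embB _)) addr0.
have kV := kbd_chain key (@xmulB K n) (ksub_ideal _ TI) VT.
have kVE A : kbd key (@xmul K n) V A = kbd key (@xmul K n) (fun B => emb phi1 (V1 B)) A
    + kbd key (@xmul K n) (fun B => emb phi2 (V2 B)) A.
  rewrite (eq_kbd _ _ (w := fun B => emb phi1 (V1 B) - (- emb phi2 (V2 B)))); last first.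
    by move=> B; rewrite opprK.
  rewrite kbdB; last exact: xmulB.
  congr (_ + _); rewrite (eq_kbd _ _ (w := fun B => 0 - emb phi2 (V2 B))); last first.
    by move=> B; rewrite sub0r.
  rewrite kbdB ?kbd0 ?sub0r ?opprK //; exact: xmulB.
have sgnP b f : P f -> P (sgn b f) by case: b => //=; apply: idealN.
exists (fun A => z A - kbd key (@xmul K n) V A); split=> [A|A]; last first.
  by rewrite kbdB ?kbd_kbd ?subr0 //; [exact: xmulB | exact: xmulC | exact: xmulB].
have [[Qz hz] zi] := zQ A; have [[_ hk] ki] := kV A; split; last first.
  by move=> Ai; rewrite zi // ki // subr0.
split; last exact: hpolB.
have K1 := kbd_emb inj1 inj2 cover disj key V1 A.
have K2 := kbd_emb inj2 inj1 cover' disj' key V2 A.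
have -> : z A - kbd key (@xmul K n) V A
    = (z A - emb phi1 (ret phi1 (z A)) - emb phi2 (ret phi2 (z A)))
      + emb phi1 (W1 A) + emb phi2 (W2 A)
      - (kbd key (@xmul K n) (fun B => emb phi1 (V1 B)) A - emb phi1 (kbd1 phi1 key V1 A))
      - (kbd key (@xmul K n) (fun B => emb phi2 (V2 B)) A - emb phi2 (kbd1 phi2 key V2 A)).
  rewrite kVE UE1 UE2 !(sub_morphD (embB _)).
  set a := emb _ (W1 A); set b := emb _ (kbd1 _ _ _ _); set a2 := emb _ (W2 A).
  set b2 := emb _ (kbd1 phi2 _ _ _); ring.
have [_ PB _] := PI.
apply: (PB); last first.
  rewrite K2; apply: ideal_sum => // q _; apply: sgnP; apply: M2.
  by have [[]] := V2Q (phi1 q |: A).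
apply: (PB); last first.
  rewrite K1; apply: ideal_sum => // q _; apply: sgnP; apply: M1.
  by have [[]] := V1Q (phi2 q |: A).
have [[Pw1 _] _] := W1P A; have [[Pw2 _] _] := W2P A.
apply: idealD => //; last exact: E2.
apply: idealD => //; last exact: E1.
exact: dec.
Qed.

End JoinExact.

Section NonVanishing.
Variables (K : fieldType) (n : nat) (key : 'I_n -> nat) (key_inj : injective key).
Implicit Types (A : {set 'I_n}) (a b c : 'I_n).

Lemma kbd_mcoeff3 (F : {set 'I_n} -> {mpoly K[n]}) A a b c :
  [&& a \notin A, b \notin A & c \notin A] -> [&& a != b, a != c & b != c] ->
  (kbd key (@xmul K n) F A)@_(U_(a) + U_(b) + U_(c))
  = sgn (ksgn key a A) (F (a |: A))@_(U_(b) + U_(c))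
    + (sgn (ksgn key b A) (F (b |: A))@_(U_(a) + U_(c))
    + sgn (ksgn key c A) (F (c |: A))@_(U_(a) + U_(b))).
Proof.
move=> /and3P[aA bA cA] /and3P[ab ac bc].
set m := (_ + _ + _)%MM; rewrite /kbd raddf_sum /=.
have E p : (sgn (ksgn key p A) (xmul p (F (p |: A))))@_m
    = sgn (ksgn key p A) (if m p == 0%N then 0 else (F (p |: A))@_(m - U_(p))).
  by rewrite -mcoeff_xmul; case: ksgn; rewrite /sgn ?mcoeffN.
under eq_bigr do rewrite E.
rewrite (bigD1 a) //= (bigD1 b) /=; last by rewrite bA eq_sym.
rewrite (bigD1 c) /=; last by rewrite cA eq_sym ac eq_sym.
rewrite big1 => [|p /andP[/andP[/andP[_ pa] pb] pc]]; last first.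
  rewrite (_ : m p = 0%N) ?sgn0 // /m !mnmDE !mnm1E.
  by rewrite eq_sym (negbTE pa) eq_sym (negbTE pb) eq_sym (negbTE pc).
have Em p : m p = ((a == p) + (b == p) + (c == p))%N by rewrite /m !mnmDE !mnm1E.
have ma : m a = 1%N by rewrite Em eqxx (eq_sym b) (negbTE ab) (eq_sym c) (negbTE ac).
have mb : m b = 1%N by rewrite Em eqxx (negbTE ab) (eq_sym c) (negbTE bc).
have mc : m c = 1%N by rewrite Em eqxx (negbTE ac) (negbTE bc).
rewrite addr0 ma mb mc /=.
have Ea : (m - U_(a) = U_(b) + U_(c))%MM by apply/mnmP => p; rewrite /m !(mnmBE, mnmDE); lia.
have Eb : (m - U_(b) = U_(a) + U_(c))%MM by apply/mnmP => p; rewrite /m !(mnmBE, mnmDE); lia.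
have Ec : (m - U_(c) = U_(a) + U_(b))%MM by apply/mnmP => p; rewrite /m !(mnmBE, mnmDE); lia.
by rewrite Ea Eb Ec.
Qed.

(** The case in mind is an induced path [i - k - j], with [g] the minor at [i] and
    [j] or its leading monomial: both variables at [k] multiply [g] into [P], so
    the boundary of [g e_{x_k} e_{y_k}] is a cycle of [P]. If it bounded a chain [w]
    of [P], two coefficient comparisons would give contradictory values of the
    coefficient of [x_i y_k] in [w] at [{x_k, y_j}]. *)
Lemma not_iexact_path (P : {mpoly K[n]} -> Prop) (g : {mpoly K[n]})
    (xi yj xk yk : 'I_n) :
  uniq [:: xi; yj; xk; yk] -> is_ideal P ->
  hpol 2 0 g -> P (xmul xk g) -> P (xmul yk g) -> g@_(U_(xi) + U_(yj)) != 0 ->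
  (forall f, P f -> [/\ f@_(U_(xi) + U_(yj)) = 0, f@_(U_(yj) + U_(yk)) = 0,
    f@_(U_(xi) + U_(xk)) = 0 & f@_(U_(xk) + U_(yk)) = 0]) ->
  ~ iexact key P 1 4.
Proof.
rewrite /= !inE !negb_or !andbT => /and3P[/and3P[ij xik xiyk] /andP[jxk jyk] kk].
move=> PI hg Pxk Pyk g0 PZ ex.
pose S := [set xk; yk]; pose z A := if A == S then g else 0.
have cS : #|S| = 2 by rewrite cards2 kk.
have TI : @is_ideal K n (fun=> True) by split.
have zT : kchain (fun s f => True /\ hpol 4 s f) 2 z.
  move=> A; rewrite /z; case: eqP => [->|]; last by split=> //; split=> //; exact: hpol0.
  by rewrite cS; split=> //; split=> // m /hg; lia.
have kz := kbd_chain key (@xmulB K n) (ksub_ideal _ TI) zT.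
have [A||w [wP wE]] := ex (kbd key (@xmul K n) z).
- have [[_ h] s] := kz A; split=> //; split=> //.
  apply: ideal_sum => // p pA.
  suff: P (xmul p (z (p |: A))) by case: ksgn => //= Pz; apply: idealN.
  rewrite /z; case: eqP => [E|]; last by rewrite (sub_morph0 (xmulB _)); case: PI.
  have : p \in S by rewrite -E setU11.
  by rewrite !inE => /orP[] /eqP ->.
- by move=> A; apply: kbd_kbd => //; [exact: xmulB | exact: xmulC].
have wZ A := PZ _ (wP A).1.1.
have zx p q : p \notin S -> z [set p; q] = 0.
  move=> pS; rewrite /z; case: eqP => // E.
  by rewrite -E !inE eqxx in pS.
have xiS : xi \notin S by rewrite !inE negb_or xik.
have yjS : yj \notin S by rewrite !inE negb_or jxk.
have zk : z (yk |: [set xk]) = g by rewrite setUC /z eqxx.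
have yjxk : yj |: [set xk] = xk |: [set yj] by rewrite setUC.
have zjk : z (xk |: [set yj]) = 0 by rewrite setUC zx.
have zkj : z (yk |: [set yj]) = 0 by rewrite setUC zx.
have sN (t : bool) : sgn t (0 : K) = 0 by rewrite sgn0.
have xkS : (xk == yj) = false by rewrite eq_sym (negbTE jxk).
have ykS : (yk == yj) = false by rewrite eq_sym (negbTE jyk).
have ykxk : (yk == xk) = false by rewrite eq_sym (negbTE kk).
(* At [x_k], the coefficient of [x_i y_j y_k]. *)
have /(congr1 (fun f => f@_(U_(xi) + U_(yj) + U_(yk)))) := wE [set xk].
rewrite !kbd_mcoeff3 ?inE ?ykxk ?ij ?xik ?xiyk ?jxk ?jyk ?kk // zk (zx xi) // (zx yj) //.
have [_ -> _ _] := wZ (xi |: [set xk]); have [-> _ _ _] := wZ (yk |: [set xk]).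
rewrite !mcoeff0 !sN !add0r addr0 => Ek.
(* At [y_j], the coefficient of [x_i x_k y_k]. *)
have /(congr1 (fun f => f@_(U_(xi) + U_(xk) + U_(yk)))) := wE [set yj].
rewrite !kbd_mcoeff3 ?inE ?xkS ?ykS ?ij ?xik ?xiyk ?kk // zjk zkj (zx xi) //.
have [_ _ _ ->] := wZ (xi |: [set yj]); have [_ _ -> _] := wZ (yk |: [set yj]).
rewrite !mcoeff0 !sN !add0r addr0 => /sgn_eq0 Ej.
by move: Ek; rewrite yjxk Ej sN => /esym/sgn_eq0/eqP; rewrite (negbTE g0).
Qed.

End NonVanishing.

(** * Initial ideals and the splitting of a join *)

Section InitialJoin.
Variables (K : fieldType) (n1 n2 n : nat).
Variables (phi1 : 'I_n1 -> 'I_n) (phi2 : 'I_n2 -> 'I_n).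
Hypotheses (inj1 : injective phi1) (inj2 : injective phi2).
Variables (le : rel 'X_{1..n}) (le_term : term_order le).

Definition pull_order n' (phi : 'I_n' -> 'I_n) : rel 'X_{1..n'} :=
  fun m m' => le (memb phi m) (memb phi m').

Lemma pull_term_order n' (phi : 'I_n' -> 'I_n) :
  injective phi -> term_order (pull_order phi).
Proof.
case: le_term => tot asym tr le0 leD inj; split.
- by move=> m m'; apply: tot.
- by move=> m m' /asym/(memb_inj inj).
- by move=> m m' m''; apply: tr.
- move=> m; rewrite /pull_order (_ : memb phi 0%MM = 0%MM) //.
  by apply/eqP; rewrite -mdeg_eq0 mdeg_memb mdeg0.
- by move=> m m' m''; rewrite /pull_order !membD //; apply: leD.
Qed.

Lemma lead_ret n' (phi : 'I_n' -> 'I_n) (g : {mpoly K[n]}) m : injective phi ->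
  is_lead_monomial le g (memb phi m) -> is_lead_monomial (pull_order phi) (ret phi g) m.
Proof.
move=> inj [mg lg]; split; first by rewrite msupp_ret.
by move=> m'; rewrite msupp_ret // => /lg.
Qed.

Lemma lead_emb n' (phi : 'I_n' -> 'I_n) (f : {mpoly K[n']}) m : injective phi ->
  is_lead_monomial (pull_order phi) f m -> is_lead_monomial le (emb phi f) (memb phi m).
Proof.
move=> inj [mf lf]; split; first by rewrite mcoeff_msupp mcoeff_emb // -mcoeff_msupp.
by move=> m' /(msupp_emb inj)[m1 /lf H ->].
Qed.

Lemma lead_xmul p (f : {mpoly K[n]}) m :
  is_lead_monomial le f m -> is_lead_monomial le (xmul p f) (m + U_(p))%MM.
Proof.
move=> [mf lf]; rewrite /xmul mulrC; split.
  by rewrite mcoeff_msupp addmC mcoeffMX -mcoeff_msupp.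
move=> m'; rewrite (perm_mem (msuppMX _ _)) => /mapP[m1 /lf lm1 ->].
by rewrite addmC (term_le_addr le_term).
Qed.

(** Here [a] is 1 or 0, according to whether [m] is a monomial in the variables in
    the range of [phi]. *)
Lemma mcoeff_emb_ret n' (phi : 'I_n' -> 'I_n) : injective phi ->
  forall m, exists a : K, forall f : {mpoly K[n]}, (emb phi (ret phi f))@_m = a * f@_m.
Proof.
move=> inj m; have [[m' ->]|[p [out mp]]] := memb_cases inj m.
  by exists 1 => f; rewrite mcoeff_emb // mcoeff_ret // mul1r.
by exists 0 => f; rewrite (mcoeff_emb_out _ out mp) mul0r.
Qed.

Lemma initial_ret n' (phi : 'I_n' -> 'I_n) (P : {mpoly K[n]} -> Prop)
    (P' : {mpoly K[n']} -> Prop) : injective phi -> is_ideal P -> is_ideal P' ->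
  (forall f, P f -> P' (ret phi f)) ->
  forall f, initial_ideal le P f -> initial_ideal (pull_order phi) P' (ret phi f).
Proof.
move=> inj PI PI' R f /(initial_idealP le_term PI) H.
apply/(initial_idealP (pull_term_order inj) PI') => m; rewrite msupp_ret //.
move/H => [g [Pg lg]]; exists (ret phi g); split; first exact: R.
exact: lead_ret.
Qed.

Lemma initial_emb n' (phi : 'I_n' -> 'I_n) (P : {mpoly K[n]} -> Prop)
    (P' : {mpoly K[n']} -> Prop) : injective phi -> is_ideal P -> is_ideal P' ->
  (forall f, P' f -> P (emb phi f)) ->
  forall f, initial_ideal (pull_order phi) P' f -> initial_ideal le P (emb phi f).
Proof.
move=> inj PI PI' E f /(initial_idealP (pull_term_order inj) PI') H.
apply/(initial_idealP le_term PI) => m /(msupp_emb inj)[m' /H[g [Pg lg]] ->].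
by exists (emb phi g); split; [exact: E | exact: lead_emb].
Qed.

Lemma initial_mul n' (phi : 'I_n' -> 'I_n) p (P : {mpoly K[n]} -> Prop)
    (Q' : {mpoly K[n']} -> Prop) : injective phi -> is_ideal P -> is_ideal Q' ->
  (forall f, Q' f -> P (xmul p (emb phi f))) ->
  forall f, initial_ideal (pull_order phi) Q' f ->
    initial_ideal le P (xmul p (emb phi f)).
Proof.
move=> inj PI QI' M f /(initial_idealP (pull_term_order inj) QI') H.
apply/(initial_idealP le_term PI) => m; rewrite /xmul mulrC (perm_mem (msuppMX _ _)).
case/mapP=> m1 /(msupp_emb inj)[m' /H[g [Pg lg]] ->] ->.
exists (xmul p (emb phi g)); split; first exact: M.
by rewrite addmC; apply: lead_xmul; apply: lead_emb.
Qed.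

Lemma initial_sub n' (le' : rel 'X_{1..n'}) (P Q : {mpoly K[n']} -> Prop) :
  (forall f, P f -> Q f) -> forall f, initial_ideal le' P f -> initial_ideal le' Q f.
Proof.
move=> PQ; apply: ideal_gen_min => [|f [g [m [Pg lg ->]]]]; first exact: ideal_gen_ideal.
by apply: ideal_gen_incl; exists g, m; split=> //; apply: PQ.
Qed.

Variables (P Q : {mpoly K[n]} -> Prop) (P1 Q1 : {mpoly K[n1]} -> Prop).
Variables (P2 Q2 : {mpoly K[n2]} -> Prop).

(** Passing to initial ideals preserves the decomposition, since the projection
    [f - emb1 (ret1 f) - emb2 (ret2 f)] scales each coefficient of [f] by a
    constant that depends only on the monomial. *)
Theorem join_initial : join_situation phi1 phi2 P Q P1 Q1 P2 Q2 ->
  join_situation phi1 phi2 (initial_ideal le P) (initial_ideal le Q)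
    (initial_ideal (pull_order phi1) P1) (initial_ideal (pull_order phi1) Q1)
    (initial_ideal (pull_order phi2) P2) (initial_ideal (pull_order phi2) Q2).
Proof.
case=> PI QI P1I Q1I P2I Q2I PQ PQ1 PQ2 E1 E2 R1 R2 RQ1 RQ2 M1 M2 dec.
split; try exact: ideal_gen_ideal; try by [apply: initial_sub | apply: initial_emb
  | apply: initial_ret].
- by move=> r f; apply: initial_mul => // g; apply: M1.
- by move=> r f; apply: initial_mul => // g; apply: M2.
move=> f /(initial_idealP le_term QI) H; apply/(initial_idealP le_term PI) => m.
have [a1 A1] := mcoeff_emb_ret inj1 m; have [a2 A2] := mcoeff_emb_ret inj2 m.
have D (g : {mpoly K[n]}) : (g - emb phi1 (ret phi1 g) - emb phi2 (ret phi2 g))@_m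
    = (1 - a1 - a2) * g@_m.
  by rewrite !mcoeffB A1 A2; ring.
rewrite mcoeff_msupp D mulf_eq0 negb_or => /andP[a0]; rewrite -mcoeff_msupp.
move/H => [g [Qg [mg lg]]].
exists (g - emb phi1 (ret phi1 g) - emb phi2 (ret phi2 g)); split; first exact: dec.
split; first by rewrite mcoeff_msupp D mulf_neq0 // -mcoeff_msupp.
move=> m' m'D; apply: lg; move: m'D; rewrite !mcoeff_msupp.
apply: contraNneq => g0; rewrite !mcoeffB.
have [b1 ->] := mcoeff_emb_ret inj1 m'; have [b2 ->] := mcoeff_emb_ret inj2 m'.
by rewrite g0 !mulr0 !subr0.
Qed.

End InitialJoin.

(** * Joins of graphs *)

Section InclVar.
Variables (T : finType) (A B : {set T}) (sAB : A \subset B).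

Definition incl_var (p : 'I_(nvars A)) : 'I_(nvars B) :=
  match fintype.split p with
  | inl q => xvar (subv_incl sAB (enum_val q))
  | inr q => yvar (subv_incl sAB (enum_val q))
  end.

Lemma incl_xvar u : incl_var (xvar u) = xvar (subv_incl sAB u).
Proof. by rewrite /incl_var /xvar (unsplitK (inl _ : 'I_ _ + 'I_ _)) enum_rankK. Qed.

Lemma incl_yvar u : incl_var (yvar u) = yvar (subv_incl sAB u).
Proof. by rewrite /incl_var /yvar (unsplitK (inr _ : 'I_ _ + 'I_ _)) enum_rankK. Qed.

Lemma subv_incl_inj : injective (subv_incl sAB).
Proof. by move=> u v /(congr1 val) /= /val_inj. Qed.

Lemma incl_var_inj : injective incl_var.
Proof.
move=> p q; case: (nvars_case p) => -[u ->]; case: (nvars_case q) => -[v ->];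
  rewrite ?incl_xvar ?incl_yvar => /eqP; rewrite var_eqs // => /eqP/subv_incl_inj -> //.
Qed.

Lemma mnm_inclE : mnm_incl sAB = memb incl_var.
Proof.
apply/funext => m; apply/mnmP => p; rewrite /mnm_incl /memb !mnm_sumE.
rewrite big_split_ord /=.
rewrite (reindex (@enum_rank _)) /=; last exact/onW_bij/enum_rank_bij.
rewrite [X in _ = (_ + X)%N](reindex (@enum_rank _)) /=; last exact/onW_bij/enum_rank_bij.
rewrite -big_split; apply: eq_bigr => u _ /=.
by rewrite mnmDE -/(xvar u) -/(yvar u) incl_xvar incl_yvar.
Qed.

Lemma restrict_orderE le : restrict_order sAB le = pull_order le incl_var.
Proof. by rewrite /restrict_order mnm_inclE. Qed.

Variable K : fieldType.

Lemma emb_minor u v :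
  emb incl_var (minor K u v) = minor K (subv_incl sAB u) (subv_incl sAB v).
Proof. by rewrite /minor embB !embM !emb_var !incl_xvar !incl_yvar. Qed.

Lemma ret_minor u v : ret incl_var (minor K (subv_incl sAB u) (subv_incl sAB v)) = minor K u v.
Proof. by rewrite -emb_minor embK //; exact: incl_var_inj. Qed.

Lemma ret_xvar_out (w : subv B) : val w \notin A -> ret_var K incl_var (xvar w) = 0.
Proof.
move=> wA; apply: ret_var_out => q; case: (nvars_case q) => -[u ->];
  rewrite ?incl_xvar ?incl_yvar => /eqP; rewrite var_eqs // => /eqP e.
by case/negP: wA; rewrite e /=; apply: valP.
Qed.

Lemma ret_yvar_out (w : subv B) : val w \notin A -> ret_var K incl_var (yvar w) = 0.
Proof.
move=> wA; apply: ret_var_out => q; case: (nvars_case q) => -[u ->];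
  rewrite ?incl_xvar ?incl_yvar => /eqP; rewrite var_eqs // => /eqP e.
by case/negP: wA; rewrite e /=; apply: valP.
Qed.

Lemma ret_minor_out (u v : subv B) : val u \notin A -> ret incl_var (minor K u v) = 0.
Proof.
move=> uA; rewrite /minor retB !retM !ret_var_E (ret_xvar_out uA) (ret_yvar_out uA).
by rewrite mul0r mulr0 subrr.
Qed.

Lemma subv_inclP (u : subv B) : val u \in A -> exists u', u = subv_incl sAB u'.
Proof. by move=> uA; exists (exist _ (val u) uA); apply: val_inj. Qed.

End InclVar.

Section Complete.
Variables (T : finType) (A : {set T}).

Definition kadj : rel T := fun u v => [&& u \in A, v \in A & u != v].

Lemma kadj_sym : ssrbool.symmetric kadj.
Proof. by move=> u v; rewrite /kadj andbCA eq_sym. Qed.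

Lemma kadj_irr : irreflexive kadj.
Proof. by move=> u; rewrite /kadj eqxx !andbF. Qed.

Lemma kadj_vset u v : kadj u v -> (u \in A) && (v \in A).
Proof. by case/and3P => -> ->. Qed.

Definition complete_on : sgraph T := SGraph kadj_sym kadj_irr kadj_vset.

Lemma complete_on_complete : complete_graph complete_on.
Proof.
by apply/forall_inP => u uA; apply/forall_inP => v vA; apply/implyP => uv; apply/and3P.
Qed.

End Complete.

Section Pullback.
Variables (K : fieldType) (n1 n : nat) (phi : 'I_n1 -> 'I_n) (inj : injective phi).

Lemma ideal_emb (P : {mpoly K[n]} -> Prop) : is_ideal P -> is_ideal (fun f => P (emb phi f)).
Proof.
case=> P0 PB PM; split=> [|f g Pf Pg|h f Pf]; first by rewrite (sub_morph0 (embB _)).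
  by rewrite embB; apply: PB.
by rewrite embM; apply: PM.
Qed.

Lemma ideal_ret (P : {mpoly K[n1]} -> Prop) : is_ideal P -> is_ideal (fun f => P (ret phi f)).
Proof.
case=> P0 PB PM; split=> [|f g Pf Pg|h f Pf]; first by rewrite (sub_morph0 (retB _)).
  by rewrite retB; apply: PB.
by rewrite retM; apply: PM.
Qed.

Lemma ideal_xmul (P : {mpoly K[n]} -> Prop) p : is_ideal P -> is_ideal (fun f => P (xmul p f)).
Proof.
case=> P0 PB PM; split=> [|f g Pf Pg|h f Pf]; first by rewrite (sub_morph0 (xmulB _)).
  by rewrite xmulB; apply: PB.
by rewrite /xmul mulrCA; apply: PM.
Qed.

End Pullback.

Section Sides.
Variables (K : fieldType) (d : Order.disp_t) (T : finOrderType d) (H : sgraph T).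
Variables (A : {set T}) (sA : A \subset vset H).

Local Notation phi := (incl_var sA).
Local Notation J := (binomial_edge_ideal K H).
Local Notation JK := (binomial_edge_ideal K (complete_on A)).

Lemma bei_emb (G : sgraph T) (sG : vset G \subset vset H) :
  (forall u v, adj G u v -> adj H u v) ->
  forall f, binomial_edge_ideal K G f -> J (emb (incl_var sG) f).
Proof.
move=> GH; apply: bei_min => [|u v uv]; first exact/ideal_emb/bei_ideal.
by rewrite emb_minor; apply: bei_minor; apply: GH.
Qed.

Lemma bei_ret (G : sgraph T) (sG : vset G \subset vset H) :
  (forall u v, u \in vset G -> v \in vset G -> adj H u v -> adj G u v) ->
  forall f, J f -> binomial_edge_ideal K G (ret (incl_var sG) f).
Proof.
move=> GH; have GI := bei_ideal K G.
apply: bei_min => [|u v uv]; first exact/ideal_ret.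
have [uG|uG] := boolP (val u \in vset G); last first.
  by rewrite ret_minor_out //; case: GI.
have [vG|vG] := boolP (val v \in vset G); last first.
  by rewrite minorN (sub_morphN (retB _)) ret_minor_out // oppr0; case: GI.
have [u' Eu] := subv_inclP sG uG; have [v' Ev] := subv_inclP sG vG.
rewrite Eu Ev ret_minor; apply: bei_minor.
by move: uv uG vG; rewrite Eu Ev /= => uv uG vG; apply: GH.
Qed.

Hypothesis mixed : forall u w, u \in A -> w \in vset H -> w \notin A -> adj H w u.

(** A Plücker relation rewrites the product of a minor and an outer variable in
    terms of minors of edges between the two sides. *)
Lemma complete_mul p f : (forall q, p <> phi q) -> JK f -> J (xmul p (emb phi f)).
Proof.
move=> out; move: f; have JI := bei_ideal K H.
apply: (@bei_min K d T (complete_on A)) => [|u v _].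
  exact: (ideal_emb phi (ideal_xmul p JI)).
rewrite emb_minor; have [_ JB JM] := JI.
case: (nvars_case p) => -[w ew].
  have wA : val w \notin A.
    by apply/negP => /(subv_inclP sA)[w' e]; apply: (out (xvar w')); rewrite incl_xvar -e.
  rewrite /xmul ew plucker_x; apply: JB; apply: JM; apply: bei_minor;
    by apply: mixed => //=; apply: valP.
have wA : val w \notin A.
  by apply/negP => /(subv_inclP sA)[w' e]; apply: (out (yvar w')); rewrite incl_yvar -e.
rewrite /xmul ew plucker_y; apply: JB; apply: JM; apply: bei_minor;
  by apply: mixed => //=; apply: valP.
Qed.

(** A multiple of a minor on [A] by a monomial either lies in the subring of [A]
    or is divisible by an outer variable. *)
Lemma minor_decomp (u v : subv A) h : u != v ->
  J (h * minor K (subv_incl sA u) (subv_incl sA v)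
     - emb phi (ret phi (h * minor K (subv_incl sA u) (subv_incl sA v)))).
Proof.
move=> uv; have JI := bei_ideal K H; set m := minor _ _ _.
have inj := @incl_var_inj _ _ _ sA.
have em : emb phi (ret phi m) = m by rewrite /m ret_minor emb_minor.
elim/mpolyind: h => [|c mm h _ _ IH].
  by rewrite mul0r (sub_morph0 (retB _)) (sub_morph0 (embB _)) subr0; case: JI.
rewrite mulrDl (sub_morphD (retB _)) (sub_morphD (embB _)) opprD addrACA.
apply: idealD => //; rewrite retM embM em -mulrBl retZ embZ -scalerBr -scalerAl.
apply: idealZ => //.
have [[m' ->]|[p [out mp]]] := memb_cases inj mm.
  by rewrite ret_membX // embX subrr mul0r; case: JI.
rewrite (ret_out _ out mp) (sub_morph0 (embB _)) subr0.
rewrite -(submK (m := U_(p)%MM) (m' := mm)) ?lep1mP // mpolyXD -mulrA.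
have [_ _ JM] := JI; apply: JM.
rewrite -/(xmul p m) /m -emb_minor; apply: complete_mul => //.
apply: (@bei_minor K d T (complete_on A)) => /=; apply/and3P; split; try exact: valP.
by rewrite (inj_eq val_inj).
Qed.

End Sides.

Section InducedPath.
Variables (K : fieldType) (d : Order.disp_t) (T : finOrderType d) (H : sgraph T).

Local Notation J := (binomial_edge_ideal K H).
Local Notation V := (subv (vset H)).

(** The coefficients at the divisors of [m] are considered together because a
    coefficient of a product at [m] depends on all of them. *)
Lemma ideal_low n (m : 'X_{1..n}) :
  is_ideal (fun f : {mpoly K[n]} => forall m', (m' <= m)%MM -> f@_m' = 0).
Proof.
split=> [m' _|f g Hf Hg m' lm|h f Hf m' lm]; first by rewrite mcoeff0.
  by rewrite mcoeffB Hf // Hg // subr0.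
apply: memN_msupp_eq0; apply/negP => /msuppM_le/allpairsP[[m1 m2] /= [_ m2f e]].
move: m2f; rewrite mcoeff_msupp Hf ?eqxx //.
by apply: lepm_trans lm; rewrite e lem_addl.
Qed.

Lemma bei_mcoeff (m : 'X_{1..nvars (vset H)}) f : mdeg m = 2 ->
  (forall u v : V, adj H (val u) (val v) -> m <> mxy u v) -> J f -> f@_m = 0.
Proof.
move=> dm nm Jf; suff: forall m', (m' <= m)%MM -> f@_m' = 0 by apply; apply: lepm_refl.
move: f Jf; apply: bei_min => [|u v uv m' lm]; first exact: ideal_low.
have ne a b : adj H (val a) (val b) -> (mxy a b == m') = false.
  move=> ab; apply/eqP => e; apply: (nm a b ab).
  have := submK lm; rewrite -e => E; have := congr1 (@mdeg _) E.
  rewrite mdegD dm mdeg_mxy => /(canRL (addnK 2)); rewrite subnn => /eqP.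
  by rewrite mdeg_eq0 => /eqP e0; move: E; rewrite e0 add0m.
by rewrite minorE mcoeffB !mcoeffX !ne ?subrr // adj_sym.
Qed.

Variables (u v w : V).
Hypotheses (uv : u != v) (nuv : ~~ adj H (val u) (val v)).
Hypotheses (wu : adj H (val w) (val u)) (wv : adj H (val w) (val v)).

Lemma path_mcoeff f : J f -> [/\ f@_(mxy u v) = 0, f@_(U_(yvar v) + U_(yvar w)) = 0,
  f@_(U_(xvar u) + U_(xvar w)) = 0 & f@_(mxy w w) = 0].
Proof.
move=> Jf; split; apply: bei_mcoeff; rewrite ?mdeg_mxy // ?mdegD ?mdeg1 //.
- by move=> a b ab /mxy_inj[ua vb]; case/negP: nuv; rewrite ua vb.
- move=> a b _ /mnmP/(_ (xvar a)); rewrite mxyx mnmDE !mnm1E !var_eqs eqxx.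
  by [].
- move=> a b _ /mnmP/(_ (yvar b)); rewrite mxyy mnmDE !mnm1E !var_eqs eqxx.
  by [].
- by move=> a b ab /mxy_inj[wa wb]; move: ab; rewrite -wa -wb adj_irr.
Qed.

Lemma path_uniq : uniq [:: xvar u; yvar v; xvar w; yvar w].
Proof.
have uw : u != w by apply: contraTneq wu => ->; rewrite adj_irr.
have vw : v != w by apply: contraTneq wv => ->; rewrite adj_irr.
by rewrite /= !inE !negb_or !var_eqs uw vw.
Qed.

Lemma path_mul : J (xmul (xvar w) (minor K u v)) /\ J (xmul (yvar w) (minor K u v)).
Proof.
have [_ JB JM] := bei_ideal K H.
rewrite /xmul plucker_x plucker_y; split; apply: JB; apply: JM; exact: bei_minor.
Qed.

Variables (key : 'I_(nvars (vset H)) -> nat) (key_inj : injective key).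

Lemma bei_not_exact : ~ iexact key J 1 4.
Proof.
have [Jx Jy] := path_mul.
apply: (not_iexact_path key_inj path_uniq (bei_ideal K H) _ Jx Jy).
- by move=> m /(dhomog_mf (minor_homog K u v)); rewrite addn0.
- rewrite minorE -/(mxy u v) mcoeffB !mcoeffX eqxx.
  rewrite (_ : (mxy v u == mxy u v) = false) ?subr0 ?oner_eq0 //.
  by apply: contraNF uv => /eqP/mxy_inj[->]; rewrite eqxx.
- exact: path_mcoeff.
Qed.

Variables (le : rel 'X_{1..nvars (vset H)}) (le_term : term_order le).

Lemma initial_not_exact : vle le u v -> ~ iexact key (initial_ideal le J) 1 4.
Proof.
move=> lt_uv; have [Jx Jy] := path_mul; have JI := bei_ideal K H.
have lm : is_lead_monomial le (minor K u v) (mxy u v).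
  by apply: lead_minor => //; rewrite /vlt lt_uv.
have xX p : J (xmul p (minor K u v)) -> initial_ideal le J (xmul p 'X_[mxy u v]).
  move=> Jp; rewrite /xmul -mpolyXD addmC; apply/(initial_idealX le_term JI).
  by exists (xmul p (minor K u v)); split=> //; apply: lead_xmul.
apply: (not_iexact_path key_inj path_uniq (initial_ideal_ideal _ _) _ (xX _ Jx) (xX _ Jy)).
- by move=> m /mem_msuppXP <-; rewrite mdeg_mxy.
- by rewrite mcoeffX eqxx oner_eq0.
move=> f /(initial_idealP le_term JI) Hf.
have Z m : (forall g, J g -> g@_m = 0) -> f@_m = 0.
  move=> Jm; apply: memN_msupp_eq0; apply/negP => /Hf[g [Jg [mg _]]].
  by move: mg; rewrite mcoeff_msupp Jm // eqxx.
by split; apply: Z => g /path_mcoeff[].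
Qed.

End InducedPath.

Section JoinGraph.
Variables (K : fieldType) (d : Order.disp_t) (T : finOrderType d) (G1 G2 : sgraph T).
Hypothesis dis : [disjoint vset G1 & vset G2].

Local Notation H := (graph_join dis).
Local Notation s1 := (subsetUl (vset G1) (vset G2)).
Local Notation s2 := (subsetUr (vset G1) (vset G2)).
Local Notation phi1 := (incl_var s1).
Local Notation phi2 := (incl_var s2).
Local Notation J := (binomial_edge_ideal K H).

Lemma join_cover (p : 'I_(nvars (vset H))) :
  (exists q, p = phi1 q) \/ (exists r, p = phi2 r).
Proof.
have side (w : subv (vset H)) : (val w \in vset G1) || (val w \in vset G2).
  by have := valP w; rewrite /= /join_vset in_setU.
case: (nvars_case p) => -[w ->]; case/orP: (side w) => wA.
- by have [w' ->] := subv_inclP s1 wA; left; exists (xvar w'); rewrite incl_xvar.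
- by have [w' ->] := subv_inclP s2 wA; right; exists (xvar w'); rewrite incl_xvar.
- by have [w' ->] := subv_inclP s1 wA; left; exists (yvar w'); rewrite incl_yvar.
- by have [w' ->] := subv_inclP s2 wA; right; exists (yvar w'); rewrite incl_yvar.
Qed.

Lemma join_disj q r : phi1 q <> phi2 r.
Proof.
have ne (u : subv (vset G1)) (v : subv (vset G2)) : subv_incl s1 u <> subv_incl s2 v.
  move=> /(congr1 val) /= e; have := valP u; have := valP v; rewrite /= -e => v2 u1.
  by rewrite (disjointFr dis u1) in v2.
case: (nvars_case q) => -[u ->]; case: (nvars_case r) => -[v ->];
  by rewrite ?incl_xvar ?incl_yvar => /eqP; rewrite var_eqs // => /eqP/ne.
Qed.

Lemma vset1_notin2 u : u \in vset G1 -> u \notin vset G2.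
Proof. by move=> u1; rewrite (disjointFr dis u1). Qed.

Lemma vset2_notin1 u : u \in vset G2 -> u \notin vset G1.
Proof. by move=> u2; rewrite (disjointFl dis u2). Qed.

Lemma join_adj1 u v : u \in vset G1 -> v \in vset G1 -> adj H u v -> adj G1 u v.
Proof.
move=> u1 v1 /or4P[//|/adj_vset/andP[u2 _]|/andP[_ v2]|/andP[u2 _]].
- by case/negP: (vset1_notin2 u1).
- by case/negP: (vset1_notin2 v1).
- by case/negP: (vset1_notin2 u1).
Qed.

Lemma join_adj2 u v : u \in vset G2 -> v \in vset G2 -> adj H u v -> adj G2 u v.
Proof.
move=> u2 v2 /or4P[/adj_vset/andP[u1 _]|//|/andP[u1 _]|/andP[_ v1]].
- by case/negP: (vset2_notin1 u2).
- by case/negP: (vset2_notin1 u2).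
- by case/negP: (vset2_notin1 v2).
Qed.

Lemma join_mixed u v : u \in vset G1 -> v \in vset G2 -> adj H u v.
Proof. by move=> u1 v2; apply/or4P/Or43; rewrite u1. Qed.

Lemma join_mixed1 u w : u \in vset G1 -> w \in vset H -> w \notin vset G1 -> adj H w u.
Proof.
move=> u1 wH w1; rewrite adj_sym; apply: join_mixed => //.
by move: wH; rewrite /= in_setU (negbTE w1).
Qed.

Lemma join_mixed2 u w : u \in vset G2 -> w \in vset H -> w \notin vset G2 -> adj H w u.
Proof.
move=> u2 wH w2; apply: join_mixed => //.
by move: wH; rewrite /= in_setU (negbTE w2) orbF.
Qed.

(** The join agrees with the complete graph except on the two sides: by the
    Plücker relations, a minor on one side times a variable of the other lies in
    the ideal of the join. *)
Theorem join_situation_bei : join_situation phi1 phi2 J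
  (binomial_edge_ideal K (complete_on (vset H)))
  (binomial_edge_ideal K G1) (binomial_edge_ideal K (complete_on (vset G1)))
  (binomial_edge_ideal K G2) (binomial_edge_ideal K (complete_on (vset G2))).
Proof.
have bsub (G : sgraph T) f : binomial_edge_ideal K G f ->
    binomial_edge_ideal K (complete_on (vset G)) f.
  apply: bei_min => [|u v uv]; first exact: ideal_gen_ideal.
  apply: (@bei_minor K d T (complete_on (vset G))) => /=.
  apply/and3P; split; try exact: valP.
  by apply/eqP => e; move: uv; rewrite (val_inj e) adj_irr.
have JI := bei_ideal K H.
have out1 r q : phi2 r <> phi1 q by move/esym; apply: join_disj.
split; try exact: ideal_gen_ideal; try exact: bsub.
- exact: (bsub H).
- by apply: (@bei_emb K d T H G1 s1) => u v uv; apply/or4P/Or41.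
- by apply: (@bei_emb K d T H G2 s2) => u v uv; apply/or4P/Or42.
- by apply: (@bei_ret K d T H G1 s1); apply: join_adj1.
- by apply: (@bei_ret K d T H G2 s2); apply: join_adj2.
- apply: (@bei_ret K d T (complete_on (vset H)) (complete_on (vset G1)) s1).
  by move=> u v u1 v1 /and3P[_ _ uv]; apply/and3P.
- apply: (@bei_ret K d T (complete_on (vset H)) (complete_on (vset G2)) s2).
  by move=> u v u1 v1 /and3P[_ _ uv]; apply/and3P.
- move=> r f; apply: (complete_mul (H := H) (sA := s1)) => [u w|q]; last exact: out1.
  exact: join_mixed1.
- move=> r f; apply: (complete_mul (H := H) (sA := s2)) => [u w|q]; last exact: join_disj.
  exact: join_mixed2.
pose D (f : {mpoly K[nvars (vset H)]}) : {mpoly K[nvars (vset H)]} :=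
  f - emb phi1 (ret phi1 f) - emb phi2 (ret phi2 f).
have DB : {morph D : f g / f - g}.
  by move=> f g; rewrite /D !(retB, embB); ring.
suff: forall f, binomial_edge_ideal K (complete_on (vset H)) f -> forall h, J (D (h * f)).
  by move=> Df f /Df/(_ 1); rewrite mul1r.
apply: (@bei_min K d T (complete_on (vset H))).
  have [J0 JB JM] := JI.
  split=> [h|f g Jf Jg h|h f Jf h']; first by rewrite mulr0 (sub_morph0 DB).
    by rewrite mulrBr DB; apply: JB.
  by rewrite mulrA.
move=> u v /= /and3P[uH vH uv] h.
wlog u1 : u v uH vH uv / (val u \in vset G1) || ((val u \in vset G2) && (val v \in vset G2)).
  move=> W; case u1 : (val u \in vset G1); first by apply: W; rewrite ?u1.
  have u2 : val u \in vset G2 by move: (uH); rewrite in_setU u1.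
  case v1 : (val v \in vset G1); last first.
    apply: W; rewrite ?u2 ?orbT //; move: (vH); rewrite in_setU v1 /= => ->.
    by rewrite orbT.
  rewrite minorN mulrN -sub0r DB (sub_morph0 DB) sub0r; apply: idealN => //.
  by apply: W; rewrite ?v1 // eq_sym.
case/orP: u1 => [u1|/andP[u2 v2]]; last first.
  have [u' Eu] := subv_inclP s2 u2; have [v' Ev] := subv_inclP s2 v2.
  rewrite /D [X in _ - X - _](_ : _ = 0); last first.
    rewrite retM (@ret_minor_out _ _ _ s1) ?mulr0 ?(sub_morph0 (embB _)) //.
    exact: vset2_notin1.
  rewrite subr0 Eu Ev; apply: minor_decomp; first exact: join_mixed2.
  by apply: contraNneq uv => e; rewrite Eu Ev e.
have [v1|v1] := boolP (val v \in vset G1).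
  have [u' Eu] := subv_inclP s1 u1; have [v' Ev] := subv_inclP s1 v1.
  rewrite /D [X in _ - _ - X](_ : _ = 0); last first.
    rewrite retM (@ret_minor_out _ _ _ s2) ?mulr0 ?(sub_morph0 (embB _)) //.
    exact: vset1_notin2.
  rewrite subr0 Eu Ev; apply: minor_decomp; first exact: join_mixed1.
  by apply: contraNneq uv => e; rewrite Eu Ev e.
rewrite /D !retM (@ret_minor_out _ _ _ s2); last exact: vset1_notin2.
rewrite minorN (sub_morphN (retB _)) (@ret_minor_out _ _ _ s1) //.
rewrite oppr0 !mulr0 !(sub_morph0 (embB _)) !subr0 mulrN -mulrN -minorN.
have [_ _ JM] := JI; apply: JM; apply: bei_minor; apply: join_mixed => //.
by move: (vH); rewrite in_setU (negbTE v1).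
Qed.

Hypotheses (ne1 : vset G1 != set0) (ne2 : vset G2 != set0).
Hypothesis incomplete : ~ (complete_graph G1 /\ complete_graph G2).

Lemma join_induced_path : exists u v w : subv (vset H),
  [/\ u != v, ~~ adj H (val u) (val v), adj H (val w) (val u) & adj H (val w) (val v)].
Proof.
have build u v w : u \in vset H -> v \in vset H -> w \in vset H ->
    u != v -> ~~ adj H u v -> adj H w u -> adj H w v ->
  exists u v w : subv (vset H),
  [/\ u != v, ~~ adj H (val u) (val v), adj H (val w) (val u) & adj H (val w) (val v)].
  move=> uH vH wH uv nuv wu wv.
  by exists (exist _ u uH), (exist _ v vH), (exist _ w wH); split.
have noedge (G : sgraph T) : ~~ complete_graph G -> exists u v,
    [/\ u \in vset G, v \in vset G, u != v & ~~ adj G u v].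
  case/forall_inPn => u uG /forall_inPn[v vG]; rewrite negb_imply => /andP[uv nuv].
  by exists u, v.
have in1 u : u \in vset G1 -> u \in vset H by rewrite /= in_setU => ->.
have in2 u : u \in vset G2 -> u \in vset H by rewrite /= in_setU orbC => ->.
have [c1|/noedge[u [v [u1 v1 uv nuv]]]] := boolP (complete_graph G1); last first.
  have [w w2] := set0Pn _ ne2.
  apply: (build u v w (in1 _ u1) (in1 _ v1) (in2 _ w2) uv).
  - by apply: contraNN nuv => /join_adj1; apply.
  - by rewrite adj_sym; apply: join_mixed.
  - by rewrite adj_sym; apply: join_mixed.
have [c2|/noedge[u [v [u1 v1 uv nuv]]]] := boolP (complete_graph G2); first by case: incomplete.
have [w w1] := set0Pn _ ne1.
apply: (build u v w (in2 _ u1) (in2 _ v1) (in1 _ w1) uv); try exact: join_mixed.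
by apply: contraNN nuv => /join_adj2; apply.
Qed.

End JoinGraph.

(** * Finite generation *)

Section Dickson.

(** The subsequence visits a minimum of the remaining tail at each step. *)
Lemma nat_monotone_subseq (f : nat -> nat) : exists g : nat -> nat,
  (forall k, g k < g k.+1)%N /\ forall k, (f (g k) <= f (g k.+1))%N.
Proof.
have H N : exists i, (N <= i)%N /\ forall j, (N <= j)%N -> (f i <= f j)%N.
  pose P v := `[< exists i, (N <= i)%N /\ f i = v >].
  have exP : exists v, P v by exists (f N); apply/asboolP; exists N.
  case: (ex_minnP exP) => v /asboolP[i [Ni <-]] vmin.
  by exists i; split=> // j Nj; apply: vmin; apply/asboolP; exists j.
have [h hP] := choice H.
pose g := fix g k := if k is k'.+1 then h (g k').+1 else h 0%N.
exists g; split=> k; first by have [] := hP (g k).+1.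
have [i Ei] : exists i, g k = h i /\ (i <= g k)%N.
  by case: k => [|k]; [exists 0%N | exists (g k).+1]; split=> //; have [] := hP (g k).+1.
have [Eg ik] := Ei; rewrite Eg; apply: (hP i).2.
by apply: leq_trans (hP (g k).+1).1; apply: leq_trans ik _.
Qed.

(** Passing to a subsequence for one variable after the other makes all exponents
    nondecreasing. *)
Lemma dickson n (m : nat -> 'X_{1..n}) : exists i j, (i < j)%N /\ (m i <= m j)%MM.
Proof.
have H (l : seq 'I_n) : exists g : nat -> nat, (forall k, g k < g k.+1)%N /\
    forall p, p \in l -> forall k, (m (g k) p <= m (g k.+1) p)%N.
  elim: l => [|p l [g [gi gm]]]; first by exists id.
  have [h [hi hm]] := nat_monotone_subseq (fun k => m (g k) p).
  have gmono : {homo g : x y / (x < y)%N}.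
    by apply: homo_ltn => //; apply: ltn_trans.
  exists (g \o h); split=> [k|q]; first exact: gmono.
  rewrite inE => /orP[/eqP -> //|ql k].
  have /(_ (h k) (h k.+1)) : {homo (fun k => m (g k) q) : x y / (x <= y)%N}.
    by apply: homo_leq => // [x y z|x]; [exact: leq_trans | exact: gm].
  by apply; apply: ltnW.
have [g [gi gm]] := H (enum 'I_n); exists (g 0%N), (g 1%N); split=> //.
by apply/mnm_lepP => p; apply: gm; rewrite mem_enum.
Qed.

End Dickson.

Section Noether.
Variables (K : fieldType) (n : nat).
Local Notation R := {mpoly K[n]}.

Definition lead_basis (I : R -> Prop) (t : seq R) : Prop :=
  (forall g, g \in t -> I g) /\
  forall f, I f -> f != 0 -> exists g, [/\ g \in t, g != 0 & (mlead g <= mlead f)%MM].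

(** Multivariate division: each step cancels the leading monomial, so that the
    remainder, being in [I], ends up as zero. *)
Lemma lead_basis_gen (I : R -> Prop) t : is_ideal I -> lead_basis I t ->
  forall f, I f -> ideal_gen [set` t] f.
Proof.
move=> II [tI tb]; have [g0 _ _] := ideal_gen_ideal [set` t].
suff H m f : mlead f = m -> I f -> ideal_gen [set` t] f by move=> f; apply: H.
move: m f; apply: (well_founded_induction (@ltom_wf n)) => m IH f fm If.
have [->//|f0] := eqVneq f 0.
have [g [gt g_neq0 lg]] := tb f If f0.
pose q := (mleadc f / mleadc g) *: 'X_[mlead f - mlead g] : R.
have tq : ideal_gen [set` t] (q * g).
  by have [_ _ JM] := ideal_gen_ideal [set` t]; apply: JM; apply: ideal_gen_incl.
rewrite -(subrK (q * g) f); apply: idealD => //; first exact: ideal_gen_ideal.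
have Ih : I (f - q * g).
  by have [_ IB IM] := II; apply: IB => //; apply: IM; apply: tI.
have [->//|h0] := eqVneq (f - q * g) 0.
apply: (IH (mlead (f - q * g))) => //.
have lq : mlead (q * g) = mlead f.
  have c0 : mleadc f / mleadc g != 0.
    by rewrite mulf_neq0 ?invr_eq0 ?mleadc_eq0.
  rewrite mleadM //; last first.
    by rewrite scaler_eq0 negb_or c0 -msize_poly_eq0 msizeX.
  by rewrite mleadZ // mleadXm submK.
have cq : (q * g)@_(mlead f) = mleadc f.
  rewrite -{1}(submK lg) /q -scalerAl mcoeffZ mulrC (mulrC 'X_[_]) mcoeffMX.
  by rewrite mulrC divfK // mleadc_eq0.
rewrite lt_neqAle; apply/andP; split.
  apply: contraNneq h0 => e; by rewrite -mleadc_eq0 e -fm mcoeffB cq subrr.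
by have := mleadB_le f (q * g); rewrite lq joinxx fm.
Qed.

(** Otherwise leading monomials none of which is divisible by an earlier one can be
    chosen for ever. *)
Lemma ideal_fg (I : R -> Prop) : is_ideal I ->
  exists t : seq R, (forall g, g \in t -> I g) /\ forall f, I f -> ideal_gen [set` t] f.
Proof.
move=> II; apply: contrapT => nfg.
have next (t : seq R) : exists f, (forall g, g \in t -> I g) ->
    [/\ I f, f != 0 & forall g, g \in t -> g != 0 -> ~~ (mlead g <= mlead f)%MM].
  have [tI|ntI] := pselect (forall g, g \in t -> I g); last by exists 0.
  apply: contrapT => nf; apply: nfg; exists t; split=> //.
  apply: lead_basis_gen => //; split=> // f If f0.
  apply: contrapT => ng; apply: nf; exists f => _; split=> // g gt g0.
  by apply/negP => lg; apply: ng; exists g.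
have [F FP] := choice next.
pose t := fix t k := if k is k'.+1 then F (t k') :: t k' else [::].
have tI k : forall g, g \in t k -> I g.
  elim: k => // k IH g /=; rewrite inE => /orP[/eqP->|/IH //].
  by have [] := FP (t k) IH.
have [i [j [ij lij]]] := dickson (fun k => mlead (F (t k))).
have tmono : forall k l, (k <= l)%N -> {subset t k <= t l}.
  move=> k; elim=> [|l IH]; first by rewrite leqn0 => /eqP ->.
  rewrite leq_eqVlt => /orP[/eqP -> //|kl] g /(IH kl) gt /=.
  by rewrite inE gt orbT.
have [_ _ /(_ (F (t i)))] := FP (t j) (tI j).
have [_ Fi0 _] := FP (t i) (tI i).
move=> /(_ (tmono i.+1 j ij _ (mem_head _ _)) Fi0); by rewrite lij.
Qed.

Section Modules.
Variable r : nat.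
Local Notation M := 'rV[R]_r.

Definition is_submod (N : M -> Prop) : Prop :=
  [/\ N 0, forall u v, N u -> N v -> N (u - v) & forall f v, N v -> N (f *: v)].

Inductive mspan (s : seq M) : M -> Prop :=
| mspan0 : mspan s 0
| mspanD f v u : v \in s -> mspan s u -> mspan s (f *: v + u).

Lemma mspan_add s u v : mspan s u -> mspan s v -> mspan s (u + v).
Proof.
by move=> su sv; elim: su => [|f w {}u ws _ IH]; rewrite ?add0r // -addrA; apply: mspanD.
Qed.

Lemma mspan_scale s f v : mspan s v -> mspan s (f *: v).
Proof.
elim=> [|g w u ws _ IH]; first by rewrite scaler0; exact: mspan0.
by rewrite scalerDr scalerA; apply: mspanD.
Qed.

Lemma mspan_gen s v : v \in s -> mspan s v.
Proof. by move=> vs; rewrite -(addr0 v) -(scale1r v); apply: mspanD => //; exact: mspan0. Qed.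

Lemma mspan_sum s (J : Type) (t : seq J) (P : pred J) (F : J -> M) :
  (forall j, P j -> mspan s (F j)) -> mspan s (\sum_(j <- t | P j) F j).
Proof. by move=> H; apply: big_ind => //; [exact: mspan0 | exact: mspan_add]. Qed.

Lemma mspan_trans s t v : (forall u, u \in s -> mspan t u) -> mspan s v -> mspan t v.
Proof.
move=> st; elim=> [|f w u ws _ IH]; first exact: mspan0.
by apply: mspan_add => //; apply: mspan_scale; apply: st.
Qed.

Lemma mspan_submod (N : M -> Prop) s v : is_submod N ->
  (forall u, u \in s -> N u) -> mspan s v -> N v.
Proof.
move=> [N0 NB NZ] sN; elim=> // f w u ws _ IH.
rewrite -(opprK u) -(sub0r u); apply: (NB); first by apply: NZ; apply: sN.
exact: NB.
Qed.

(** By induction on the number of leading coordinates that may be nonzero: the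
    ideal of the values of the last of them is finitely generated, and so is the
    submodule where it vanishes. *)
Lemma submod_fg (N : M -> Prop) : is_submod N ->
  exists s, (forall v, v \in s -> N v) /\ forall v, N v -> mspan s v.
Proof.
suff H k (L : M -> Prop) : is_submod L ->
    (forall v, L v -> forall l : 'I_r, (k <= l)%N -> v 0 l = 0) ->
    exists s, (forall v, v \in s -> L v) /\ forall v, L v -> mspan s v.
  by move=> NS; apply: (H r) => // v _ l; rewrite leqNgt ltn_ord.
elim: k L => [|k IH] L LS Lz.
  exists [::]; split=> // v Lv; have -> : v = 0; last exact: mspan0.
  by apply/rowP => l; rewrite Lz // mxE.
have [kr|rk] := ltnP k r; last first.
  by apply: IH => // v Lv l kl; have := leq_trans rk kl; rewrite leqNgt ltn_ord.
pose l := Ordinal kr; have [L0 LB LZ] := LS.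
have [||s [sL sg]] := IH (fun v => L v /\ v 0 l = 0).
- split=> [|u v [Lu u0] [Lv v0]|f v [Lv v0]]; first by rewrite mxE.
    by rewrite !mxE u0 v0 subr0; split=> //; apply: LB.
  by rewrite mxE v0 mulr0; split=> //; apply: LZ.
- move=> v [Lv v0] l'; rewrite leq_eqVlt => /orP[/eqP e|kl]; last exact: Lz.
  by rewrite (_ : l' = l) //; apply: val_inj.
pose I f := exists v, L v /\ v 0 l = f.
have II : is_ideal I.
  split=> [|f g [u [Lu <-]] [v [Lv <-]]|h f [v [Lv <-]]].
  - by exists 0; rewrite mxE.
  - by exists (u - v); rewrite !mxE; split=> //; apply: LB.
  - by exists (h *: v); rewrite mxE; split=> //; apply: LZ.
have [t [tI tg]] := ideal_fg II.
have lift g : exists v, I g -> L v /\ v 0 l = g.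
  have [[v vP]|nI] := pselect (I g); first by exists v.
  by exists 0.
have [ell ellP] := choice lift.
exists ([seq ell g | g <- t] ++ s); split=> [v|v Lv].
  rewrite mem_cat => /orP[/mapP[g gt ->]|/sL[] //].
  by have [] := ellP g (tI g gt).
have [q [qt Eq]] := tg (v 0 l) (ex_intro _ v (conj Lv erefl)).
pose w := \sum_(p <- q) p.1 *: ell p.2.
have ws : mspan ([seq ell g | g <- t] ++ s) w.
  rewrite /w big_seq; apply: mspan_sum => p pq; apply: mspan_scale; apply: mspan_gen.
  by rewrite mem_cat map_f //; apply: qt.
rewrite -(subrK w v); apply: mspan_add => //.
apply: (mspan_trans (s := s)); first by move=> u us; apply: mspan_gen; rewrite mem_cat us orbT.
apply: sg; split.
  apply: LB => //; apply: (mspan_submod LS _ ws) => u.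
  rewrite mem_cat => /orP[/mapP[g gt ->]|/sL[] //].
  by have [] := ellP g (tI g gt).
rewrite !mxE Eq /w summxE big_seq [X in _ - X]big_seq; apply/eqP; rewrite subr_eq0; apply/eqP.
apply: eq_bigr => p pq; rewrite mxE; congr (_ * _).
by have [_ ->] := ellP p.2 (tI _ (qt _ pq)).
Qed.

End Modules.
End Noether.

(** * Koszul homology and syzygies *)

Section Components.
Variables (K : fieldType) (n : nat).
Local Notation R := {mpoly K[n]}.
Implicit Types (f g : R).

(** The part of [f] selected by [hpol j s]. *)
Definition hcomp (j s : nat) f : R := if (s <= j)%N then pihomog mdeg (j - s) f else 0.

Lemma mcoeff_hcomp j s f m : (hcomp j s f)@_m = if (mdeg m + s)%N == j then f@_m else 0.
Proof.
rewrite /hcomp; case: leqP => sj; last first.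
  by rewrite mcoeff0 gtn_eqF // (leq_trans sj) // leq_addl.
by rewrite mcoeff_pihomog -(eqn_add2r s) subnK.
Qed.

Lemma hpol_hcomp j s f : hpol j s (hcomp j s f).
Proof.
by move=> m; rewrite mcoeff_msupp mcoeff_hcomp; case: (_ =P j) => //; rewrite eqxx.
Qed.

Lemma hcomp_id j s f : hpol j s f -> hcomp j s f = f.
Proof.
move=> hf; apply/mpolyP => m; rewrite mcoeff_hcomp; case: eqP => // ne.
by apply/esym/memN_msupp_eq0/negP => /hf.
Qed.

Lemma hcompB j s : {morph hcomp j s : f g / f - g}.
Proof.
move=> f g; apply/mpolyP => m; rewrite mcoeffB !mcoeff_hcomp mcoeffB.
by case: ifP; rewrite ?subr0.
Qed.

Lemma hpolM i b a s f g : hpol i (b + s) f -> hpol b a g -> hpol i (a + s) (f * g).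
Proof.
move=> hf hg m /msuppM_le/allpairsP[[m1 m2] /= [/hf <- /hg <- ->]].
by rewrite mdegD; lia.
Qed.

Lemma hcompM j a b s f g : hpol b a g -> hcomp j (a + s) (f * g) = hcomp j (b + s) f * g.
Proof.
move=> hg; elim/mpolyind: f => [|c m f _ _ IH].
  by rewrite mul0r !(sub_morph0 (hcompB _ _)) mul0r.
rewrite mulrDl !(sub_morphD (hcompB _ _)) mulrDl IH; congr (_ + _).
have hX : hpol (mdeg m + (b + s)) (b + s) (c *: 'X_[m] : R).
  by move=> m' /msuppZ_le/mem_msuppXP <-.
have hXg := hpolM hX hg.
have Z i' s' (f' : R) : hpol i' s' f' -> i' != j -> hcomp j s' f' = 0.
  move=> hf' ne; apply/mpolyP => m'; rewrite mcoeff_hcomp mcoeff0; case: eqP => // e.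
  apply: memN_msupp_eq0; apply: contraNN ne => /hf' <-; exact/eqP.
have [e|ne] := eqVneq (mdeg m + (b + s))%N j.
  by rewrite e in hX hXg; rewrite !hcomp_id.
by rewrite (Z _ _ _ hXg ne) (Z _ _ _ hX ne) mul0r.
Qed.

End Components.

Section Rows.
Variables (K : fieldType) (n : nat).
Local Notation R := {mpoly K[n]}.

(** Homogeneity in a graded free module with generators in degrees [a]; matrices
    act on rows from the right, and [hmat] is homogeneity of degree zero. *)
Definition hrow r (a : 'I_r -> nat) (j s : nat) (v : 'rV[R]_r) : Prop :=
  forall k, hpol j (a k + s) (v 0 k).

Definition rcomp r (a : 'I_r -> nat) (j s : nat) (v : 'rV[R]_r) : 'rV[R]_r :=
  \row_k hcomp j (a k + s) (v 0 k).

Definition hmat r' r (b : 'I_r' -> nat) (a : 'I_r -> nat) (D : 'M[R]_(r', r)) : Prop :=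
  forall k l, hpol (b k) (a l) (D k l).

Lemma hpol_sum (J : Type) (t : seq J) (P : pred J) (F : J -> R) j s :
  (forall x, P x -> hpol j s (F x)) -> hpol j s (\sum_(x <- t | P x) F x).
Proof.
move=> H; apply: big_ind => //; first exact: hpol0.
move=> f g hf hg m /msuppD_le; rewrite mem_cat => /orP[]; [exact: hf | exact: hg].
Qed.

Lemma hrow_rcomp r (a : 'I_r -> nat) j s v : hrow a j s (rcomp a j s v).
Proof. by move=> k; rewrite mxE; apply: hpol_hcomp. Qed.

Lemma rcomp_id r (a : 'I_r -> nat) j s v : hrow a j s v -> rcomp a j s v = v.
Proof. by move=> hv; apply/rowP => k; rewrite mxE hcomp_id. Qed.

Lemma hrow0 r (a : 'I_r -> nat) j s : hrow a j s 0.
Proof. by move=> k; rewrite mxE; apply: hpol0. Qed.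

Lemma hrowB r (a : 'I_r -> nat) j s u v : hrow a j s u -> hrow a j s v -> hrow a j s (u - v).
Proof. by move=> hu hv k; rewrite !mxE; apply: hpolB. Qed.

Section Maps.
Variables (r' r : nat) (b : 'I_r' -> nat) (a : 'I_r -> nat) (D : 'M[R]_(r', r)).
Hypothesis hD : hmat b a D.

Lemma hrow_mul j s u : hrow b j s u -> hrow a j s (u *m D).
Proof. by move=> hu l; rewrite mxE; apply: hpol_sum => k _; apply: hpolM. Qed.

Lemma rcomp_mul j s u : rcomp a j s (u *m D) = rcomp b j s u *m D.
Proof.
apply/rowP => l; rewrite !mxE (sub_morph_sum (hcompB _ _)).
by apply: eq_bigr => k _; rewrite mxE; apply: hcompM; apply: hD.
Qed.

End Maps.

Definition xscale r (p : 'I_n) (v : 'rV[R]_r) : 'rV[R]_r := 'X_p *: v.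

Lemma xscaleB r p : {morph @xscale r p : u v / u - v}.
Proof. by move=> u v; rewrite /xscale scalerBr. Qed.

Lemma xscaleC r p q (v : 'rV[R]_r) : xscale p (xscale q v) = xscale q (xscale p v).
Proof. by rewrite /xscale !scalerA mulrC. Qed.

Definition mexact (key : 'I_n -> nat) r (a : 'I_r -> nat) (N : 'rV[R]_r -> Prop) (i j : nat) :=
  kexact key (@xscale r) (fun s v => N v /\ hrow a j s v) i.

Lemma ksub_submod r (a : 'I_r -> nat) N j : is_submod N ->
  ksub (@xscale r) (fun s v => N v /\ hrow a j s v).
Proof.
case=> N0 NB NZ; split=> [s|s u v [Nu hu] [Nv hv]|s p v [Nv hv]].
- by split=> //; apply: hrow0.
- by split; [apply: NB | apply: hrowB].
- split; first exact: NZ.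
  by move=> k; rewrite mxE; apply: (@hpol_xmul K n j _ p); rewrite -addnS; apply: hv.
Qed.

Lemma submodT r : @is_submod K n r (fun=> True). Proof. by split. Qed.

Section Shift.
Variables (key : 'I_n -> nat) (key_inj : injective key).
Variables (r' r : nat) (b : 'I_r' -> nat) (a : 'I_r -> nat) (D : 'M[R]_(r', r)).
Hypothesis hD : hmat b a D.
Variable N : 'rV[R]_r -> Prop.
Hypothesis N_image : forall v, N v <-> exists u, v = u *m D.
Hypothesis minimal : forall (u : 'rV[R]_r') k, u *m D = 0 -> (u 0 k)@_0%MM = 0.

Local Notation N' := (fun u : 'rV[R]_r' => u *m D = 0).
Local Notation kbdF := (kbd key (@xscale r')).
Local Notation kbdN := (kbd key (@xscale r)).

Lemma image_submod : is_submod N.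
Proof.
split=> [|u v /N_image[u' ->] /N_image[v' ->]|f v /N_image[v' ->]]; apply/N_image.
- by exists 0; rewrite mul0mx.
- by exists (u' - v'); rewrite mulmxBl.
- by exists (f *: v'); rewrite scalemxAl.
Qed.

Lemma kernel_submod : is_submod N'.
Proof.
split=> [|u v u0 v0|f v v0]; first by rewrite mul0mx.
- by rewrite mulmxBl u0 v0 subr0.
- by rewrite -scalemxAl v0 scaler0.
Qed.

(** Coordinatewise, this is the exactness of the Koszul complex of the ring in
    positive degree; in degree zero only constants contribute. *)
Lemma free_exact i j (c : {set 'I_n} -> 'rV[R]_r') :
  kchain (fun s v => True /\ hrow b j s v) i c -> (forall A, kbdF c A = 0) ->
  (i = 0%N -> forall A k, (c A 0 k)@_0%MM = 0) ->
  exists w, kchain (fun s v => True /\ hrow b j s v) i.+1 w /\ forall A, kbdF w A = c A.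
Proof.
move=> cP cZ c0.
have coord k : exists w : {set 'I_n} -> R,
    kchain (fun s f => True /\ hpol j (b k + s) f) i.+1 w /\
    forall A, kbd key (@xmul K n) w A = c A 0 k.
  have ckZ A : kbd key (@xmul K n) (fun B => c B 0 k) A = 0.
    transitivity (kbdF c A 0 k); last by rewrite cZ mxE.
    apply/esym; apply: (kbd_nat key (x := @xscale r') (y := @xmul K n)
      (f := fun v : 'rV[R]_r' => v 0 k)) => [u v|p v]; by rewrite !mxE.
  have [bj|jb] := ltnP (b k) j.
    have [|A||w [wP wE]] := @iexact_ring K n key key_inj i (j - b k)%N _ (fun B => c B 0 k).
    - by rewrite subn_gt0.
    - have [[_ hc] ci] := cP A; split; last by move/ci => ->; rewrite mxE.
      by split=> // m /hc H; rewrite -H addnCA addKn.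
    - exact: ckZ.
    exists w; split=> // A; have [[_ hw] wi] := wP A; split=> //; split=> // m /hw e.
    by rewrite addnCA e subnKC // ltnW.
  exists (fun=> 0); split=> [A|A]; first by split=> //; split=> //; exact: hpol0.
  rewrite kbd0; last exact: xmulB.
  have [[_ hc] ci] := cP A.
  apply/mpolyP => m; rewrite mcoeff0; apply/esym.
  have [mc|mc] := boolP (m \in msupp (c A 0 k)); last first.
    exact: memN_msupp_eq0.
  have e := hc k m mc.
  have [m0 A0] : mdeg m = 0%N /\ #|A| = 0%N.
    by move: (mdeg m) #|A| (b k) e jb => x y z; lia.
  have {}m0 : m = 0%MM by apply/eqP; rewrite -mdeg_eq0 m0.
  rewrite m0 c0 //; apply/eqP; rewrite -A0 eq_sym; apply: contraTT mc => /ci ->.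
  by rewrite mxE msupp0.
have [w wP] := choice coord.
exists (fun A => \row_k w k A); split=> A.
  split; first by split=> // k; rewrite mxE; have [wk _] := wP k; have [[]] := wk A.
  by move=> Ai; apply/rowP => k; rewrite !mxE; have [wk _] := wP k; have [_ ->] := wk A.
apply/rowP => k; have [_ <-] := wP k.
rewrite (kbd_nat key (x := @xscale r') (y := @xmul K n) (f := fun v : 'rV[R]_r' => v 0 k)).
- by apply: eq_kbd => B; rewrite /= mxE.
- by move=> u v; rewrite !mxE.
- by move=> p v; rewrite !mxE.
Qed.

Lemma kbd_mul c A : kbdF c A *m D = kbdN (fun B => c B *m D) A.
Proof.
apply: (kbd_nat key (x := @xscale r') (y := @xscale r) (f := fun v => v *m D)) => [u v|p v].
  by rewrite mulmxBl.
by rewrite /xscale scalemxAl.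
Qed.

(** Projection onto the right degree makes any lift homogeneous. *)
Lemma chain_lift i j (c : {set 'I_n} -> 'rV[R]_r) :
  kchain (fun s v => N v /\ hrow a j s v) i c ->
  exists c', kchain (fun s v => True /\ hrow b j s v) i c' /\ forall A, c' A *m D = c A.
Proof.
move=> cP.
have lift (A : {set 'I_n}) : exists u, [/\ hrow b j #|A| u, (#|A| != i -> u = 0) & u *m D = c A].
  have [[/N_image[u Eu] hc] ci] := cP A.
  have [Ai|Ai] := eqVneq #|A| i.
    exists (rcomp b j #|A| u); split=> //; first exact: hrow_rcomp.
    by rewrite -(rcomp_mul hD) -Eu rcomp_id.
  by exists 0; split=> //; [exact: hrow0 | rewrite mul0mx ci].
have [c' c'P] := choice lift; exists c'; split=> A; have [h z e] := c'P A; by [].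
Qed.

Lemma chain_image i j (c : {set 'I_n} -> 'rV[R]_r') :
  kchain (fun s v => True /\ hrow b j s v) i c ->
  kchain (fun s v => N v /\ hrow a j s v) i (fun A => c A *m D).
Proof.
move=> cP A; have [[_ h] z] := cP A; split; last by move/z => ->; rewrite mul0mx.
by split; [apply/N_image; exists (c A) | apply: (hrow_mul hD)].
Qed.

(** The connecting homomorphism of [0 -> N' -> F -> N -> 0] is bijective: the
    homology of [F] is concentrated at [i = 0], where by minimality the map from
    the homology of [N'] to that of [F] is zero. *)
Lemma syzygy_shift i j : mexact key a N i.+1 j <-> mexact key b N' i j.
Proof.
have kF := ksub_submod b j (@submodT r').
have kK := ksub_submod b j kernel_submod.
have kN := ksub_submod a j image_submod.
have chT i' (c : {set 'I_n} -> 'rV[R]_r') : kchain (fun s v => N' v /\ hrow b j s v) i' c ->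
    kchain (fun s v => True /\ hrow b j s v) i' c.
  by move=> cP A; have [[_ h] z] := cP A.
have dd (c : {set 'I_n} -> 'rV[R]_r') A : kbdF (kbdF c) A = 0.
  by apply: kbd_kbd => //; [exact: xscaleB | exact: xscaleC].
split=> ex c cP cZ.
- have [|g [gP gE]] := free_exact (chT _ _ cP) cZ.
    by move=> _ A k; apply: minimal; have [[]] := cP A.
  have [A|h [hP hE]] := ex (fun A => g A *m D) (chain_image gP).
    by rewrite -kbd_mul gE; have [[]] := cP A.
  have [h' [h'P h'E]] := chain_lift hP.
  exists (fun A => g A - kbdF h' A); split=> A; last first.
    by rewrite kbdB ?dd ?subr0 //; exact: xscaleB.
  have [[_ hh] hz] := kchainB kF gP (kbd_chain key (@xscaleB r') kF h'P) A.
  split=> //; split=> //.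
  rewrite mulmxBl kbd_mul -hE; apply/eqP; rewrite subr_eq0; apply/eqP.
  by apply: eq_kbd => B; rewrite h'E.
have [c' [c'P c'E]] := chain_lift cP.
have [A||w [wP wE]] := ex (kbdF c').
- have [[_ h] z] := kbd_chain key (@xscaleB r') kF c'P A; split=> //; split=> //.
  by rewrite kbd_mul -(cZ A); apply: eq_kbd => B; rewrite c'E.
- by move=> A; apply: dd.
have [||g [gP gE]] := free_exact (kchainB kF c'P (chT _ _ wP)).
- by move=> A; rewrite kbdB ?wE ?subrr //; exact: xscaleB.
- by [].
exists (fun A => g A *m D); split; first exact: chain_image.
move=> A; rewrite -kbd_mul gE mulmxBl c'E; have [[-> _] _] := wP A; by rewrite subr0.
Qed.

(** Degree-[j] minimal generators: by minimality the rows of [D] are independent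
    modulo the irrelevant ideal. *)
Lemma syzygy_gen j : ~ mexact key a N 0 j <-> exists k, b k = j.
Proof.
split=> [nex|[k bk] ex].
  apply: contrapT => nk; apply: nex => c cP cZ.
  have [c' [c'P c'E]] := chain_lift cP.
  have kc' A : kbdF c' A = 0.
    rewrite /kbd big1 // => p pA; have [_ ->] := c'P (p |: A).
      by rewrite (sub_morph0 (xscaleB _)) sgn0.
    by rewrite cardsU1 pA.
  have [_ A k|g [gP gE]] := free_exact c'P kc'.
    apply: memN_msupp_eq0; apply/negP => mc; have [[_ hc] zc] := c'P A.
    have := hc k _ mc; rewrite mdeg0 add0n => e.
    have [Ai|Ai] := eqVneq #|A| 0%N; last by move: mc; rewrite zc // mxE msupp0.
    by apply: nk; exists k; rewrite -e Ai addn0.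
  exists (fun A => g A *m D); split; first exact: chain_image.
  by move=> A; rewrite -kbd_mul gE c'E.
pose u0 : 'rV[R]_r' := delta_mx 0 k.
pose c (A : {set 'I_n}) : 'rV[R]_r := if A == set0 then u0 *m D else 0.
have [A|A|w [wP wE]] := ex c.
- rewrite /c; case: eqP => [->|A0].
    rewrite cards0; split=> //; split; first by apply/N_image; exists u0.
    rewrite -rowE => l m; rewrite mxE addn0 -bk; exact: hD.
  by split=> //; split; [case: image_submod | exact: hrow0].
- rewrite /kbd big1 // => p pA; rewrite /c; case: eqP => [/setP/(_ p)|_].
    by rewrite !inE eqxx.
  by rewrite (sub_morph0 (xscaleB _)) sgn0.
have [w' [w'P w'E]] := chain_lift wP.
have /(minimal k) : (u0 - kbdF w' set0) *m D = 0.
  rewrite mulmxBl kbd_mul (eq_kbd _ _ w'E) wE /c eqxx subrr //.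
rewrite !mxE !eqxx mcoeffB mcoeff1 eqxx.
rewrite (_ : (kbdF w' set0 0 k)@_0%MM = 0) ?subr0; first by move/eqP; rewrite oner_eq0.
rewrite (kbd_nat key (x := @xscale r') (y := @xmul K n) (f := fun v : 'rV[R]_r' => v 0 k)).
- rewrite /kbd raddf_sum big1 // => p _ /=.
  have -> (t : bool) (f : R) : (sgn t f)@_0%MM = sgn t f@_0%MM.
    by case: t; rewrite /sgn ?mcoeffN.
  by rewrite mcoeff_xmul mnm0E eqxx sgn0.
- by move=> u v; rewrite !mxE.
- by move=> p v; rewrite !mxE.
Qed.

End Shift.
End Rows.

(** * Minimal graded free resolutions *)

Section MinimalGenerators.
Variables (K : fieldType) (n : nat).
Local Notation R := {mpoly K[n]}.

Definition graded_sub r (a : 'I_r -> nat) (N : 'rV[R]_r -> Prop) : Prop :=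
  forall j v, N v -> N (rcomp a j 0 v).

(** A graded submodule of a graded free module, bundled so that taking syzygies can
    be iterated. *)
Record gmod := GMod {
  gm_rank : nat;
  gm_deg : 'I_gm_rank -> nat;
  gm_pred : 'rV[R]_gm_rank -> Prop;
  gm_submod : is_submod gm_pred;
  gm_graded : graded_sub gm_deg gm_pred }.

Record mingens (M : gmod) := MinGens {
  mg_rank : nat;
  mg_deg : 'I_mg_rank -> nat;
  mg_mx : 'M[R]_(mg_rank, gm_rank M);
  mg_hom : hmat mg_deg (@gm_deg M) mg_mx;
  mg_image : forall v, gm_pred v <-> exists u, v = u *m mg_mx;
  mg_minimal : forall (u : 'rV[R]_mg_rank) k, u *m mg_mx = 0 -> (u 0 k)@_0%MM = 0 }.

Lemma mspan_rows r (s : seq 'rV[R]_r) v : mspan s v <->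
  exists u : 'rV[R]_(size s), v = u *m \matrix_(i, l) (s`_i) 0 l.
Proof.
split=> [|[u ->]].
  elim=> [|f w u ws _ [u' ->]]; first by exists 0; rewrite mul0mx.
  have iw : (index w s < size s)%N by rewrite index_mem.
  exists (f *: delta_mx 0 (Ordinal iw) + u'); rewrite mulmxDl -scalemxAl; congr (_ *: _ + _).
  by apply/rowP => l; rewrite -rowE !mxE /= nth_index.
rewrite mulmx_sum_row; apply: mspan_sum => i _; apply: mspan_scale; apply: mspan_gen.
rewrite (_ : row i _ = s`_i) ?mem_nth //.
by apply/rowP => l; rewrite !mxE.
Qed.

Lemma rcomp_partition r (a : 'I_r -> nat) (v : 'rV[R]_r) :
  exists B, v = \sum_(j < B) rcomp a j 0 v.
Proof.
exists (\max_(k < r) (msize (v 0%R k) + a k))%N.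
apply/rowP => k; rewrite summxE; apply/mpolyP => m; rewrite raddf_sum /=.
under eq_bigr do rewrite mxE mcoeff_hcomp addn0.
have [mv|mv] := boolP (m \in msupp (v 0 k)); last first.
  by rewrite (memN_msupp_eq0 mv) big1 // => j _; case: eqP.
have lt_m : (mdeg m + a k < \max_(k < r) (msize (v 0%R k) + a k))%N.
  apply: (@leq_trans (msize (v 0%R k) + a k)%N); last exact: (leq_bigmax_cond _ isT).
  by rewrite ltn_add2r msize_mdeg_lt.
rewrite (bigD1 (Ordinal lt_m)) //= eqxx big1 ?addr0 // => j; rewrite -val_eqE /= eq_sym.
by move/negbTE ->.
Qed.

Variable M : gmod.
Local Notation r := (gm_rank M).
Local Notation a := (@gm_deg M).
Local Notation N := (@gm_pred M).

Definition homogeneous_gens (s : seq ('rV[R]_r * nat)) : Prop :=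
  (forall p, p \in s -> N p.1 /\ hrow a p.2 0 p.1) /\
  forall v, N v -> mspan (map fst s) v.

Lemma homogeneous_gens_ex : exists s, homogeneous_gens s.
Proof.
have [s [sN sg]] := submod_fg (gm_submod M).
have [B BP] := choice (rcomp_partition a).
exists (flatten [seq [seq (rcomp a j 0 v, j) | j <- iota 0 (B v)] | v <- s]); split=> [p|v Nv].
  case/flatten_mapP => v /sN Nv /mapP[j _ ->]; split; last exact: hrow_rcomp.
  exact: gm_graded.
apply: (mspan_trans (s := s)); last exact: sg.
move=> u us; rewrite (BP u); apply: mspan_sum => j _; apply: mspan_gen.
apply/mapP; exists (rcomp a j 0 u, val j) => //; apply/flatten_mapP; exists u => //.
by apply: map_f; rewrite mem_iota /= add0n.
Qed.

(** A homogeneous generating family with the least number of elements: a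
    homogeneous relation with a constant coefficient would make one superfluous. *)
Lemma mingens_ex : exists G : mingens M, True.
Proof.
pose P k := `[< exists s, homogeneous_gens s /\ size s = k >].
have exP : exists k, P k.
  by have [s sP] := homogeneous_gens_ex; exists (size s); apply/asboolP; exists s.
case: (ex_minnP exP) => k /asboolP[s [[sN sg] sk]] kmin {exP}.
pose D : 'M[R]_(size s, r) := \matrix_(i, l) (nth (0, 0%N) s i).1 0 l.
pose b (i : 'I_(size s)) := (nth (0, 0%N) s i).2.
have sP (i : 'I_(size s)) : N (nth (0, 0%N) s i).1 /\ hrow a (b i) 0 (nth (0, 0%N) s i).1.
  by apply: sN; apply: mem_nth.
have hD : hmat b a D.
  by move=> i l; rewrite mxE; have [_ /(_ l)] := sP i; rewrite addn0.
have rowD i : row i D = (nth (0, 0%N) s i).1 by apply/rowP => l; rewrite !mxE.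
have im v : N v <-> exists u, v = u *m D.
  split=> [/sg/mspan_rows|[u ->]].
    rewrite size_map => -[u ->]; exists u; congr (_ *m _).
    by apply/matrixP => i l; rewrite !mxE (nth_map (0, 0%N)).
  rewrite mulmx_sum_row; have [N0 NB NZ] := gm_submod M.
  apply: big_ind => // [u1 u2 N1 N2|i _].
    by rewrite -(opprK u2) -(sub0r u2); apply: (NB) => //; apply: NB.
  by apply: NZ; rewrite rowD; have [] := sP i.
suff min (u : 'rV[R]_(size s)) i : u *m D = 0 -> (u 0 i)@_0%MM = 0.
  by exists (MinGens hD im min).
move=> uD0; apply/eqP; apply: contraT => ui.
(* The component of degree [b i] of the relation has a constant at [i]. *)
pose u' := rcomp b (b i) 0 u.
have u'D : u' *m D = 0.
  rewrite -(rcomp_mul hD) uD0; apply/rowP => l; rewrite !mxE.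
  by rewrite (sub_morph0 (hcompB _ _)).
pose c := (u 0 i)@_0%MM.
have u'i : u' 0 i = c%:MP.
  apply/mpolyP => m; rewrite mxE mcoeff_hcomp mcoeffC addn0.
  have -> : ((mdeg m + b i)%N == b i) = (m == 0%MM).
    by rewrite -{2}(add0n (b i)) eqn_add2r mdeg_eq0.
  by case: eqP => [->|]; rewrite ?mulr1 ?mulr0.
pose s' := take i s ++ drop i.+1 s.
have ss : size s' = (size s).-1.
  by rewrite size_cat size_drop size_takel ?(ltnW (ltn_ord i)) //; have := ltn_ord i; lia.
have sE : s = take i s ++ nth (0, 0%N) s i :: drop i.+1 s.
  by rewrite -drop_nth ?cat_take_drop.
have s's p : p \in s' -> p \in s.
  by rewrite sE /s' !mem_cat inE => /orP[->|->]; rewrite ?orbT.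
have nth_s' (l : 'I_(size s)) : l != i -> nth (0, 0%N) s l \in s'.
  move=> li; rewrite mem_cat; have [l_lt|i_le] := ltnP l i.
    by apply/orP; left; rewrite -(nth_take _ l_lt) mem_nth // size_takel // ltnW.
  have i_lt : (i < l)%N by rewrite ltn_neqAle i_le andbT eq_sym.
  apply/orP; right; have := nth_drop i.+1 (0, 0%N) s (l - i.+1); rewrite subnKC // => <-.
  by apply: mem_nth; rewrite size_drop ltn_sub2r //; apply: leq_ltn_trans i_lt _.
have hs' : homogeneous_gens s'.
  split=> [p /s's/sN //|v /sg]; apply: mspan_trans => x /mapP[p ps ->].
  have [p_i|p_ni] := eqVneq (index p s) i; last first.
    have pl : (index p s < size s)%N by rewrite index_mem.
    apply: mspan_gen; apply: map_f; rewrite -(nth_index (0, 0%N) ps).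
    exact: (nth_s' (Ordinal pl)).
  have -> : p.1 = row i D by rewrite rowD -p_i nth_index.
  have -> : row i D = - (c^-1)%:MP *: \sum_(l | l != i) u' 0 l *: row l D.
    move: u'D; rewrite mulmx_sum_row (bigD1 i) //= u'i => /eqP; rewrite addr_eq0 => /eqP E.
    by rewrite scaleNr -scalerN -E scalerA -mpolyCM mulVf // mpolyC1 scale1r.
  apply: mspan_scale; apply: mspan_sum => l li; apply: mspan_scale; apply: mspan_gen.
  by rewrite rowD map_f // nth_s'.
have : (k <= size s')%N by apply: kmin; apply/asboolP; exists s'.
by rewrite ss -sk; have := ltn_ord i; lia.
Qed.

Definition mg : mingens M := projT1 (cid mingens_ex).

(** The module of syzygies of the chosen minimal generators; transparent, so that
    the ranks of consecutive steps of [tower] match by conversion. *)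
Definition syz : gmod.
Proof.
apply: (@GMod (mg_rank mg) (@mg_deg _ mg) (fun u => u *m mg_mx mg = 0)).
  by apply: kernel_submod.
by move=> j v v0; rewrite -(rcomp_mul (mg_hom (m := mg))) v0; apply/rowP => l;
  rewrite !mxE (sub_morph0 (hcompB _ _)).
Defined.

End MinimalGenerators.

Fixpoint tower (K : fieldType) (n : nat) (M : gmod K n) (k : nat) : gmod K n :=
  if k is k'.+1 then syz (tower M k') else M.

Section Resolution.
Variables (K : fieldType) (n : nat).
Local Notation R := {mpoly K[n]}.
Variable I : set {mpoly K[n]}.

Definition irow (v : 'rV[R]_1) : Prop := I (v 0 0).
Definition deg0 : 'I_1 -> nat := fun=> 0%N.

Section Existence.
Hypotheses (I_ideal : is_ideal I) (I_graded : is_graded I).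

Lemma irow_submod : is_submod irow.
Proof.
case: I_ideal => I0 IB IM; split=> [|u v Iu Iv|f v Iv]; rewrite /irow !mxE //.
  exact: IB.
exact: IM.
Qed.

Lemma irow_graded : graded_sub deg0 irow.
Proof. by move=> j v Iv; rewrite /irow mxE /hcomp addn0 /deg0 subn0; apply: I_graded. Qed.

Let M0 : gmod K n := GMod irow_submod irow_graded.
Let M := tower M0.

(** Minimal generators of successive syzygy modules form a resolution; each matrix
    has its rows in the kernel of the preceding one, where all constants vanish. *)
Lemma minimal_resolution_ex : exists F : graded_free_resolution I, minimal_resolution F.
Proof.
have aug_homog (k : 'I_(mg_rank (mg (M 0)))) :
    mg_mx (mg (M 0)) k 0 \is ((@mg_deg _ _ _ (mg (M 0)) k).-homog).
  by apply/dhomogP => m /(mg_hom (m := mg (M 0))) <-; rewrite addn0.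
have diff_homog i (k : 'I_(mg_rank (mg (M i.+1)))) (l : 'I_(mg_rank (mg (M i)))) :
    (mg_deg l <= mg_deg k)%N ->
    mg_mx (mg (M i.+1)) k l \is ((mg_deg k - mg_deg l)%N).-homog.
  by move=> _; apply/dhomogP => m /(mg_hom (m := mg (M i.+1))) <-; rewrite addnK.
have diff_eq0 i (k : 'I_(mg_rank (mg (M i.+1)))) (l : 'I_(mg_rank (mg (M i)))) :
    (mg_deg k < mg_deg l)%N -> mg_mx (mg (M i.+1)) k l = 0.
  move=> kl; apply/mpolyP => m; rewrite mcoeff0; apply: memN_msupp_eq0.
  apply/negP => /(mg_hom (m := mg (M i.+1))) e; move: kl; rewrite -e.
  by rewrite ltnNge leq_addl.
have aug_image f : I f <-> exists v : 'rV_(mg_rank (mg (M 0))), f = (v *m mg_mx (mg (M 0))) 0 0.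
  have im := mg_image (mg (M 0)); split=> [If|[v ->]].
    have /im[u Eu] : gm_pred (g := M 0) (const_mx f) by rewrite /= /irow mxE.
    by exists u; rewrite -Eu mxE.
  by apply/(im (v *m mg_mx (mg (M 0)))); exists v.
have exact_ i (v : 'rV_(mg_rank (mg (M i)))) :
    v *m mg_mx (mg (M i)) = 0 <-> exists w, v = w *m mg_mx (mg (M i.+1)).
  exact: (mg_image (mg (M i.+1)) v).
pose F := @GradedFreeResolution K n I (fun i => mg_rank (mg (M i)))
  (fun i k => mg_deg k) (mg_mx (mg (M 0))) (fun i => mg_mx (mg (M i.+1)))
  aug_homog diff_homog diff_eq0 aug_image (exact_ 0%N) (fun i => exact_ i.+1).
exists F => i k l /=.
have [_ +] := exact_ i (row k (mg_mx (mg (M i.+1)))).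
move=> /(_ (ex_intro _ (delta_mx 0 k) (rowE _ _))) /(mg_minimal (m := mg (M i)) l).
by rewrite mxE.
Qed.

End Existence.

Section Betti.
Variables (key : 'I_n -> nat) (key_inj : injective key).
Variable F : graded_free_resolution I.
Hypothesis F_minimal : minimal_resolution F.

Lemma irow_exact i j : mexact key deg0 irow i j <-> iexact key I i j.
Proof.
have kE (c : {set 'I_n} -> 'rV[R]_1) A :
    kbd key (@xscale K n 1) c A 0 0 = kbd key (@xmul K n) (fun B => c B 0 0) A.
  rewrite (kbd_nat key (x := @xscale K n 1) (y := @xmul K n) (f := fun v : 'rV[R]_1 => v 0 0)) //.
    by move=> u v; rewrite !mxE.
  by move=> p v; rewrite !mxE.
have kC (c : {set 'I_n} -> R) A :
    kbd key (@xscale K n 1) (fun B => const_mx (c B)) A = const_mx (kbd key (@xmul K n) c A).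
  by apply/rowP => k; rewrite (ord1 k) kE mxE; apply: eq_kbd => B; rewrite mxE.
split=> ex c cP cZ.
- have [A|A|w [wP wE]] := ex (fun A => const_mx (c A)).
  + have [[Ic hc] ci] := cP A; split; last by move/ci => ->; apply/rowP => k; rewrite !mxE.
    by split; [rewrite /irow mxE | move=> k; rewrite mxE].
  + by rewrite kC cZ; apply/rowP => k; rewrite !mxE.
  exists (fun A => w A 0 0); split=> A; last by rewrite -kE wE mxE.
  have [[Iw hw] wi] := wP A; split; last by move/wi ->; rewrite mxE.
  by split=> //; exact: (hw 0).
have [A|A|w [wP wE]] := ex (fun A => c A 0 0).
- have [[Ic hc] ci] := cP A; split; last by move/ci ->; rewrite mxE.
  by split=> //; exact: (hc 0).
- by rewrite -kE cZ mxE.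
exists (fun A => const_mx (w A)); split=> A.
  have [[Iw hw] wi] := wP A; split; last by move/wi ->; apply/rowP => k; rewrite !mxE.
  by split; [rewrite /irow mxE | move=> k; rewrite mxE].
by rewrite kC wE; apply/rowP => k; rewrite (ord1 k) mxE.
Qed.

Local Notation deg i := (@gfr_deg K n I F i).
Local Notation ker i := (fun u : 'rV[R]_(gfr_rank F i.+1) => u *m gfr_diff F i = 0).

Lemma aug_hmat : hmat (deg 0) deg0 (gfr_aug F).
Proof.
by move=> k l m; rewrite (ord1 l) => /(dhomog_mf (gfr_aug_homog k)) ->; rewrite addn0.
Qed.

Lemma diff_hmat i : hmat (deg i.+1) (deg i) (gfr_diff F i).
Proof.
move=> k l m; have [lk|kl] := leqP (gfr_deg l) (gfr_deg k).
  by move/(dhomog_mf (gfr_diff_homog lk)) ->; rewrite subnK.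
by rewrite gfr_diff_eq0 // msupp0.
Qed.

Lemma minimal_mul r' r (D : 'M[R]_(r', r)) (w : 'rV[R]_r') l :
  (forall k, (D k l)@_0%MM = 0) -> ((w *m D) 0 l)@_0%MM = 0.
Proof.
by move=> D0; rewrite mxE raddf_sum big1 // => k _ /=; rewrite rmorphM /= D0 mulr0.
Qed.

Lemma aug_minimal (u : 'rV[R]_(gfr_rank F 0)) k : u *m gfr_aug F = 0 -> (u 0 k)@_0%MM = 0.
Proof. by move/gfr_aug_exact => [w ->]; apply: minimal_mul => l; apply: F_minimal. Qed.

Lemma diff_minimal i (u : 'rV[R]_(gfr_rank F i.+1)) k :
  u *m gfr_diff F i = 0 -> (u 0 k)@_0%MM = 0.
Proof. by move/gfr_diff_exact => [w ->]; apply: minimal_mul => l; apply: F_minimal. Qed.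

Lemma aug_image v : irow v <-> exists u, v = u *m gfr_aug F.
Proof.
rewrite /irow (gfr_aug_image F); split=> -[u Eu]; exists u; last by rewrite Eu.
by apply/rowP => k; rewrite (ord1 k) Eu.
Qed.

Lemma graded_bettiP i j : graded_betti F i j != 0%N <-> exists k, deg i k = j.
Proof.
rewrite /graded_betti -lt0n; split=> [/card_gt0P[k]|[k kj]].
  by rewrite inE => /eqP; exists k.
by apply/card_gt0P; exists k; rewrite inE; apply/eqP.
Qed.

(** Shifting [i] times along syzygies leads to the minimal generators of the [i]-th
    syzygy module, that is, to the basis of the [i]-th free module. *)
Theorem betti_iexact i j : graded_betti F i j != 0%N <-> ~ iexact key I i j.
Proof.
rewrite graded_bettiP -irow_exact; case: i => [|i].
  by rewrite (syzygy_gen key_inj aug_hmat aug_image aug_minimal).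
rewrite (syzygy_shift key_inj aug_hmat aug_image aug_minimal).
suff H l k p (N : 'rV[R]_(gfr_rank F k) -> Prop) : p = (k + l).+1 ->
    (forall v, N v <-> exists w, v = w *m gfr_diff F k) ->
    ~ mexact key (deg k) N l j <-> exists q, deg p q = j.
  by apply: iff_sym; apply: (H i 0%N i.+1) => // v; exact: gfr_aug_exact.
elim: l k p N => [|l IH] k p N -> NE.
  by rewrite addn0 (syzygy_gen key_inj (@diff_hmat k) NE (@diff_minimal k)).
rewrite (syzygy_shift key_inj (@diff_hmat k) NE (@diff_minimal k)).
by apply: (IH k.+1) => [|v]; [rewrite addSnnS | exact: gfr_diff_exact].
Qed.

End Betti.

(** The Betti numbers of every minimal resolution vanish exactly where the Koszul
    homology does, and at least one minimal resolution exists. *)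
Theorem reg_iexact (key : 'I_n -> nat) : injective key -> is_ideal I -> is_graded I ->
  reg I = supremum -oo%E [set e | exists i j : nat, ~ iexact key I i j
    /\ e = (j%:Z - i%:Z)%:E]%classic.
Proof.
move=> key_inj II Ig; congr (supremum _ _); apply/seteqP; split=> [e [F [i [j [Fm Fb ->]]]]|].
  by exists i, j; split=> //; apply/(betti_iexact key_inj Fm).
move=> e [i [j [nex ->]]]; have [F Fm] := minimal_resolution_ex II Ig.
by exists F, i, j; split=> //; apply/(betti_iexact key_inj Fm).
Qed.

End Resolution.

(** * Regularity of joins *)

Section Supremum.
Implicit Types (y : \bar int).

(** A set of integers is unbounded above or has a maximum. For the empty set the
    equivalence holds because of the default value of the supremum. *)
Lemma supremum_le (A : set (\bar int)) y : (forall e, A e -> exists z : int, e = z%:E) ->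
  (supremum -oo%E A <= y)%E <-> forall e, A e -> (e <= y)%E.
Proof.
move=> Afin; have [->|A0] := eqVneq A classical_sets.set0.
  by rewrite supremum0 leNye; split.
have [e0 Ae0] : exists e, A e by move/classical_sets.set0P: A0.
have [z0 Ez0] := Afin _ Ae0.
suff [l lP] : exists l, supremums A l.
  have : supremums A (supremum -oo%E A).
    rewrite /supremum (negbTE A0); exact: (xgetPex _ (ex_intro _ l lP)).
  case=> ub lub; split=> [le_y e Ae|H]; last exact: lub.
  by apply: le_trans le_y; apply: ub.
have [[y0 y0P]|unb] := pselect (exists y0 : int, forall e, A e -> (e <= y0%:E)%E); last first.
  exists +oo%E; split=> [e _|[y1| |] ub].
  - exact: leey.
  - by case: unb; exists y1.
  - by [].
  - by have := ub _ Ae0; rewrite Ez0.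
pose P k := `[< A (z0 + k%:Z)%:E >].
have P0 : exists k, P k by exists 0%N; apply/asboolP; rewrite addr0 -Ez0.
have Pb k : P k -> (k <= `|y0 - z0|)%N.
  move/asboolP => /y0P; rewrite lee_fin => le_y0; rewrite -lez_nat.
  by apply: le_trans (ler_norm _); rewrite lerBrDl.
case: (ex_maxnP P0 Pb) => k /asboolP Ak kmax.
exists (z0 + k%:Z)%:E; split=> [e Ae|z ub]; last exact: ub.
have [z Ez] := Afin _ Ae; rewrite Ez lee_fin -lerBlDl.
have [le_z|/ltW lt_z] := leP z0 z; last first.
  by rewrite -subr_le0 in lt_z; apply: le_trans lt_z _.
have zn : z - z0 = `|z - z0|%N%:Z by rewrite gez0_abs // subr_ge0.
rewrite zn lez_nat; apply: kmax; apply/asboolP; rewrite -zn addrC subrK -Ez //.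
Qed.

End Supremum.

Section JoinReg.
Variables (K : fieldType) (n1 n2 n : nat).
Variables (phi1 : 'I_n1 -> 'I_n) (phi2 : 'I_n2 -> 'I_n).
Hypotheses (inj1 : injective phi1) (inj2 : injective phi2).
Hypothesis cover : forall p, (exists q, p = phi1 q) \/ (exists r, p = phi2 r).
Hypothesis disj : forall q r, phi1 q <> phi2 r.
Variables (P Q : {mpoly K[n]} -> Prop) (P1 Q1 : {mpoly K[n1]} -> Prop).
Variables (P2 Q2 : {mpoly K[n2]} -> Prop).

(** The diagonals [j - i] that occur for [P] are 3, those of [P1] and of [P2], and
    perhaps some below 3. *)
Theorem join_reg : join_situation phi1 phi2 P Q P1 Q1 P2 Q2 ->
  is_graded P -> is_graded P1 -> is_graded P2 ->
  (forall key, injective key -> forall i j, (i + 2 < j)%N -> iexact key Q i j) ->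
  (forall key, injective key -> forall i j, (i + 2 < j)%N -> iexact key Q1 i j) ->
  (forall key, injective key -> forall i j, (i + 2 < j)%N -> iexact key Q2 i j) ->
  ~ iexact val P 1 4 ->
  reg P = maxe (maxe (reg P1) (reg P2)) 3%:E.
Proof.
move=> js Pg P1g P2g Qex Q1ex Q2ex nex.
have keyi : injective (val : 'I_n -> nat) := val_inj.
have key1i : injective (val \o phi1) by apply: inj_comp.
have key2i : injective (val \o phi2) by apply: inj_comp.
rewrite (reg_iexact keyi (js_ideal js) Pg).
rewrite (reg_iexact key1i (js_ideal1 js) P1g) (reg_iexact key2i (js_ideal2 js) P2g).
set A := [set e | _]%classic; set B := [set e | _]%classic; set C := [set e | _]%classic.
have fin N (I : {mpoly K[N]} -> Prop) key : forall e, [set e | exists i j : nat, ~ iexact key I i j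
    /\ e = (j%:Z - i%:Z)%:E]%classic e -> exists z : int, e = z%:E.
  by move=> e [i [j [_ ->]]]; exists (j%:Z - i%:Z).
have supP N (I : {mpoly K[N]} -> Prop) key := supremum_le _ (@fin N I key).
have BA e : B e -> A e.
  case=> i [j [ne ->]]; exists i, j; split=> // ex; apply: ne.
  exact: (iexact_ret inj1 inj2 cover disj (js_ideal js) (js_emb1 js) (js_ret1 js)).
have cover' p : (exists r, p = phi2 r) \/ (exists q, p = phi1 q).
  by case: (cover p); [right | left].
have disj' r q : phi2 r <> phi1 q by move/esym/disj.
have CA e : C e -> A e.
  case=> i [j [ne ->]]; exists i, j; split=> // ex; apply: ne.
  exact: (iexact_ret inj2 inj1 cover' disj' (js_ideal js) (js_emb2 js) (js_ret2 js)).
have A3 : A 3%:E by exists 1%N, 4%N.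
have AE e : A e -> [\/ B e, C e | (e <= 3%:E)%E].
  case=> i [j [ne Ee]]; have [lt_ij|le_ij] := ltnP (i + 3) j; last first.
    by constructor 3; rewrite Ee lee_fin lerBlDl -PoszD lez_nat.
  have [d Ej d3] : exists2 d, j = (i + d)%N & (3 < d)%N.
    by exists (j - i)%N; lia.
  have Ed k : (d%:Z = (k + d)%N%:Z - k%:Z) by rewrite PoszD addrC addKr.
  have Eed : e = d%:Z%:E by rewrite Ee Ej (Ed i).
  apply: contrapT => no; apply: ne; rewrite Ej.
  apply: (join_iexact inj1 inj2 cover disj keyi js d3).
  - exact: Qex.
  - exact: Q1ex.
  - exact: Q2ex.
  - move=> k; apply: contrapT => nk; apply: no; constructor 1.
    by exists k, (k + d)%N; split=> //; rewrite Eed (Ed k).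
  - move=> k; apply: contrapT => nk; apply: no; constructor 2.
    by exists k, (k + d)%N; split=> //; rewrite Eed (Ed k).
apply/eqP; rewrite eq_le; apply/andP; split.
  apply/supP => e /AE[Be|Ce|e3].
  - by rewrite !le_max; apply/orP; left; apply/orP; left; move: e Be; apply/supP.
  - by rewrite !le_max; apply/orP; left; apply/orP; right; move: e Ce; apply/supP.
  - by rewrite le_max e3 orbT.
have supA e : A e -> (e <= supremum -oo A)%E by move: e; apply/supP.
rewrite !ge_max (supA _ A3) andbT; apply/andP; split; apply/supP => e He; apply: supA.
  exact: BA.
exact: CA.
Qed.

End JoinReg.

Local Close Scope ring_scope.

Theorem theorem2p1 (K : fieldType) (d : Order.disp_t) (T : finOrderType d)
    (G1 G2 : sgraph T)
    (dis : [disjoint vset G1 & vset G2])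
    (V1_nonempty : vset G1 != set0) (V2_nonempty : vset G2 != set0)
    (not_both_complete : ~ (complete_graph G1 /\ complete_graph G2))
    (le : rel 'X_{1..nvars (vset (graph_join dis))})
    (le_term : term_order le) :
  let J := binomial_edge_ideal K (graph_join dis) in
  let J1 := binomial_edge_ideal K G1 in
  let J2 := binomial_edge_ideal K G2 in
  let le1 := restrict_order (subsetUl (vset G1) (vset G2)) le in
  let le2 := restrict_order (subsetUr (vset G1) (vset G2)) le in
  reg J = maxe (maxe (reg J1) (reg J2)) 3%:E /\
  reg (initial_ideal le J)
    = maxe (maxe (reg (initial_ideal le1 J1)) (reg (initial_ideal le2 J2))) 3%:E.
Proof.
move=> J J1 J2 le1 le2.
set s1 := subsetUl _ _ in le1 *; set s2 := subsetUr _ _ in le2 *.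
have E1 : le1 = pull_order le (incl_var s1) by apply: restrict_orderE.
have E2 : le2 = pull_order le (incl_var s2) by apply: restrict_orderE.
have inj1 := @incl_var_inj _ _ _ s1; have inj2 := @incl_var_inj _ _ _ s2.
have t1 : term_order le1 by rewrite E1; apply: pull_term_order.
have t2 : term_order le2 by rewrite E2; apply: pull_term_order.
have js := join_situation_bei K dis.
have cover := @join_cover d T G1 G2 dis; have disj := @join_disj d T G1 G2 dis.
have [u [v [w [uv nuv wu wv]]]] :=
  join_induced_path dis V1_nonempty V2_nonempty not_both_complete.
have cK (A : {set T}) := complete_on_complete A.
split.
  apply: (join_reg inj1 inj2 cover disj js).
  - exact: (@bei_graded K d T (graph_join dis)).
  - exact: (@bei_graded K d T G1).
  - exact: (@bei_graded K d T G2).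
  - move=> key ki.
    exact: (@complete_iexact K d T (complete_on (vset (graph_join dis))) (cK _) le le_term key ki).
  - move=> key ki.
    exact: (@complete_iexact K d T (complete_on (vset G1)) (cK _) le1 t1 key ki).
  - move=> key ki.
    exact: (@complete_iexact K d T (complete_on (vset G2)) (cK _) le2 t2 key ki).
  - exact: (bei_not_exact uv nuv wu wv val_inj).
have ji := join_initial inj1 inj2 le_term js; rewrite -E1 -E2 in ji.
apply: (join_reg inj1 inj2 cover disj ji).
- exact: (initial_ideal_graded le_term (bei_ideal _ _)).
- exact: (initial_ideal_graded t1 (bei_ideal _ _)).
- exact: (initial_ideal_graded t2 (bei_ideal _ _)).
- move=> key ki.
  exact: (@complete_initial_iexact K d T (complete_on (vset (graph_join dis))) (cK _) le le_term key ki).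
- move=> key ki.
  exact: (@complete_initial_iexact K d T (complete_on (vset G1)) (cK _) le1 t1 key ki).
- move=> key ki.
  exact: (@complete_initial_iexact K d T (complete_on (vset G2)) (cK _) le2 t2 key ki).
case/orP: (vle_total le_term u v) => uv'.
  exact: (initial_not_exact uv nuv wu wv val_inj le_term uv').
apply: (initial_not_exact _ _ wv wu val_inj le_term uv'); first by rewrite eq_sym.
by rewrite adj_sym.
Qed.
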